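(* Let $1\le p<2$. Let $F:\mathbb{T}\to\mathbb{C}$ be such that $t\mapsto F(e^{it})$ is absolutely continuous on $[0,2\pi]$ (with $F(e^{i0})=F(e^{i2\pi})$), and suppose $\dot F\in L^p(0,2\pi)$, where $\dot F(e^{it})=\frac{d}{dt}F(e^{it})$. Let $w=P[F]$. Then $$\|w_z\|_{L^p}\le\left(C(p)+\frac{1}{2-p}\right)^{1/p}\|\dot F\|_{L^p}\quad\text{and}\quad \|\overline{w_{\bar z}}\|_{L^p}\le\left(C(p)+\frac{1}{2-p}\right)^{1/p}\|\dot F\|_{L^p},$$ where $C(p)=\int_0^1\left(\frac{4\tanh^{-1}r}{\pi r}\right)^p r\,dr$. In particular $w_z,\overline{w_{\bar z}}\in L^p(\mathbb{D})$.
   Context: $\mathbb{D}$ is the open unit disk and $\mathbb{T}$ the unit circle. For $F\in L^1(\mathbb{T})$, the Poisson integral is $P[F](re^{i\theta})=\int_0^{2\pi}P_r(t-\theta)F(e^{it})\,dt$ with $P_r(t-\theta)=\frac{1}{2\pi}\frac{1-r^2}{1-2r\cos(t-\theta)+r^2}$. $w_z=\frac12(w_x-iw_y)$, $w_{\bar z}=\frac12(w_x+iw_y)$. For $G$ on $[0,2\pi]$, $\|G\|_{L^p}=\left(\frac{1}{2\pi}\int_0^{2\pi}|G(e^{it})|^p\,dt\right)^{1/p}$. For a function $f$ on $\mathbb{D}$, $\|f\|_{L^p}=\left(\int_{\mathbb{D}}|f|^p\,dA\right)^{1/p}$ with $dA=\frac1\pi dx\,dy$ the normalized area measure. $\tanh^{-1}r=\frac12\log\frac{1+r}{1-r}$.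 *)

(* Defs.v *)
From HB Require Import structures.
From mathcomp Require Import all_boot all_order all_algebra.
From mathcomp Require Import all_classical all_reals all_analysis.
Set Implicit Arguments. Unset Strict Implicit. Unset Printing Implicit Defensive.
Import Order.TTheory GRing.Theory Num.Theory.
Import numFieldNormedType.Exports.
Local Open Scope classical_set_scope.
Local Open Scope ring_scope.

(* A complex-valued function t |-> F(e^{it}) is represented by its real part
   f1 and imaginary part f2 : R -> R.  The complex modulus |a + i b| is
   Num.sqrt (a^2 + b^2). *)
Definition cmod {R : realType} (a b : R) : R := Num.sqrt (a ^+ 2 + b ^+ 2).

Definition abs_continuous_on {R : realType} (a b : R) (f1 f2 : R -> R) : Prop :=
  forall eps : R, 0 < eps -> exists2 delta : R, 0 < delta &
    forall (n : nat) (ak bk : 'I_n -> R),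
      (forall k, a <= ak k /\ ak k <= bk k /\ bk k <= b) ->
      (forall k l, k != l -> bk k <= ak l \/ bk l <= ak k) ->
      \sum_(k < n) (bk k - ak k) < delta ->
      \sum_(k < n) cmod (f1 (bk k) - f1 (ak k)) (f2 (bk k) - f2 (ak k)) < eps.

(* Poisson kernel P_r(t - theta) at the point z = x + i y = r e^{i theta};
   note r cos(t - theta) = x cos t + y sin t and r^2 = x^2 + y^2. *)
Definition poisson_kernel {R : realType} (x y t : R) : R :=
  (2 * pi)^-1 * ((1 - (x ^+ 2 + y ^+ 2)) /
     (1 - 2 * (x * cos t + y * sin t) + (x ^+ 2 + y ^+ 2))).

(* Poisson integral P[g](x + i y) = int_0^{2pi} P_r(t-theta) g(t) dt
   (Lebesgue integral), for a real-valued g; applied to real and imaginary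
   parts separately. *)
Definition poisson_int {R : realType} (g : R -> R) (x y : R) : R :=
  Rintegral (@lebesgue_measure R) `[0, 2 * pi]%classic
    (fun t => poisson_kernel x y t * g t).

Definition itv02pi {R : realType} : set R := `[0, 2 * pi]%classic.
Definition itv01 {R : realType} : set R := `[0, 1]%classic.

Definition dx {R : realType} (h : R -> R -> R) (x y : R) : R :=
  derive1 (fun s => h s y) x.
Definition dy {R : realType} (h : R -> R -> R) (x y : R) : R :=
  derive1 (fun s => h x s) y.

(* |w_z| and |conj(w_zbar)| = |w_zbar| for w = u + i v:
   w_z = (w_x - i w_y)/2 = ((u_x + v_y) + i (v_x - u_y))/2,
   w_zbar = (w_x + i w_y)/2 = ((u_x - v_y) + i (v_x + u_y))/2. *)
Definition abs_wz {R : realType} (u v : R -> R -> R) (x y : R) : R :=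
  cmod ((dx u x y + dy v x y) / 2) ((dx v x y - dy u x y) / 2).
Definition abs_conj_wzbar {R : realType} (u v : R -> R -> R) (x y : R) : R :=
  cmod ((dx u x y - dy v x y) / 2) (- ((dx v x y + dy u x y) / 2)).

Definition unit_disk {R : realType} : set (R * R) :=
  [set z | z.1 ^+ 2 + z.2 ^+ 2 < 1].

Definition leb2 {R : realType} := ((@lebesgue_measure R) \x (@lebesgue_measure R))%E.

(* ||h||_{L^p(D)} with normalized area measure dA = dx dy / pi *)
Definition LpD {R : realType} (p : R) (h : R -> R -> R) : \bar R :=
  (((pi^-1)%R%:E * \int[leb2]_(z in unit_disk) ((`|h z.1 z.2| `^ p)%R%:E)) `^ (p^-1)%R)%E.

(* ||G||_{L^p} on [0, 2pi] with normalized measure dt / (2 pi) *)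
Definition LpT {R : realType} (p : R) (G : R -> R) : \bar R :=
  ((((2 * pi)^-1)%R%:E * \int[@lebesgue_measure R]_(t in itv02pi)
      ((`|G t| `^ p)%R%:E)) `^ (p^-1)%R)%E.

Definition artanh {R : realType} (r : R) : R := 2^-1 * ln ((1 + r) / (1 - r)).

Definition Cp {R : realType} (p : R) : \bar R :=
  (\int[@lebesgue_measure R]_(r in itv01)
     (((4 * artanh r / (pi * r)) `^ p * r)%R%:E))%E.

(* Main.v *)
Require Import Defs.
From HB Require Import structures.
From mathcomp Require Import all_boot all_order all_algebra.
From mathcomp Require Import all_classical all_reals all_analysis.
From mathcomp Require Import measurable_realfun ring lra.
Set Implicit Arguments. Unset Strict Implicit. Unset Printing Implicit Defensive.
Import Order.TTheory GRing.Theory Num.Theory.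
Import numFieldNormedType.Exports.
Local Open Scope classical_set_scope.
Local Open Scope ring_scope.

(* With z = r e^{i theta}, 2 z w_z = r w_r - i w_theta and
   2 conj(z) w_zbar = r w_r + i w_theta.  Integrating by parts, w_theta is the integral of
   dF/dt against the Poisson kernel P, of mass 1, and r w_r is its integral
   against the conjugate kernel Q, whose absolute mass on the circle of radius r
   is A = 4 artanh r / pi.  By Jensen's inequality and the convexity of s^p,
     r^p |w_z|^p <= (A^(p-1) int |Q| |dF/dt|^p + int P |dF/dt|^p) / 2.
   Tonelli and the rotation invariance of area separate the angular integral of
   |dF/dt|^p from the radial integrals of A^p r^(1-p) and r^(1-p), which are C(p)
   and 1 / (2 - p); C(p) is finite since artanh r <= 2 r / sqrt (1 - r).
   Absolute continuity gives the density of F: the variation function of F is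
   the distribution function of a measure dominated by Lebesgue measure, to
   which Radon-Nikodym applies. *)

(** Dividing by r^p leaves the singularity r^(1-p) at the origin, integrable because p < 2; the
    conjugate term is harmless there, A being of order r. At r = 1 the mass A blows up only
    logarithmically, so a crude bound by a power of 1 - r above -1 is enough. The constant is exact
    because the factor 1/2 coming from convexity turns the normalization 1 / pi of area into the
    normalization 1 / (2 pi) of arc length. Polar coordinates never appear as a change of variables:
    the angular part is a rotation of the plane, the radial part the law of the modulus on the disk.
    The pointwise bound holds off the origin only, and it is its majorant that is shown to be
    measurable; monotonicity of the integral then transfers the estimate to |w_z|^p. The derivative
    of F enters through its density, which agrees with the pointwise derivative almost
    everywhere. *)

(** The index is an arbitrary [finType] because gluing partitions of several intervals yields a
    family indexed by a sigma type. *)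
Definition abs_cont {R : realType} (f : R -> R) : Prop :=
  forall e : R, 0 < e -> exists2 d : R, 0 < d &
    forall (I : finType) (a b : I -> R), (forall k, a k <= b k) ->
      (forall k l, k != l -> b k <= a l \/ b l <= a k) ->
      \sum_k (b k - a k) < d -> \sum_k `|f (b k) - f (a k)| < e.

(** [f \o clamp T] extends f from [0, T] to the whole line by its endpoint values. *)
Definition clamp {R : realType} (T x : R) : R := Num.min (Num.max x 0) T.

(** * Absolute continuity and densities *)

Section clamp.
Context {R : realType} (T : R).
Hypothesis T0 : 0 <= T.

Lemma clamp_ge0 x : 0 <= clamp T x.
Proof. by rewrite /clamp le_min T0 le_max lexx orbT. Qed.

Lemma clamp_le x : clamp T x <= T.
Proof. by rewrite /clamp ge_min lexx orbT. Qed.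

Lemma clamp_id x : 0 <= x -> x <= T -> clamp T x = x.
Proof. by move=> x0 xT; rewrite /clamp max_l// min_l. Qed.

Lemma le_clamp x y : x <= y -> clamp T x <= clamp T y.
Proof.
move=> xy; rewrite /clamp /Num.min /Num.max.
by repeat case: ifPn; rewrite -?leNgt => *; lra.
Qed.

Lemma clamp_lip x y : x <= y -> clamp T y - clamp T x <= y - x.
Proof.
move=> xy; rewrite /clamp /Num.min /Num.max.
by repeat case: ifPn; rewrite -?leNgt => *; lra.
Qed.

(** [clamp T] is monotone and 1-Lipschitz, so it keeps intervals from overlapping and does not
    lengthen them; the increment of a component is at most the modulus of the increment. *)
Lemma abs_cont_clamp (f1 f2 : R -> R) : abs_continuous_on 0 T f1 f2 ->
  abs_cont (f1 \o clamp T) /\ abs_cont (f2 \o clamp T).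
Proof.
move=> f12; split => e e0; have [d d0 H] := f12 e e0; exists d => // I a b ab dis sd.
all: have := H _ (fun k : 'I_(#|I|) => clamp T (a (enum_val k)))
  (fun k : 'I_(#|I|) => clamp T (b (enum_val k))).
(* The hypothesis speaks of families indexed by ordinals, so I is enumerated. *)
all: have E (F : I -> R) : \sum_k F k = \sum_(k < #|I|) F (enum_val k).
1,3: by rewrite (reindex (@enum_val I (mem I)))//; apply: onW_bij; exact: enum_val_bij.
all: move=> /(_ (fun k => conj (clamp_ge0 _) (conj (le_clamp (ab _)) (clamp_le _)))) h.
all: rewrite E; apply: le_lt_trans (h _ _).
1,4: apply: ler_sum => k _; rewrite /cmod /= -sqrtr_sqr ler_wsqrtr//.
1,2: by rewrite ?lerDl ?lerDr sqr_ge0.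
1,3: move=> k l kl; have /dis[|] : enum_val k != enum_val l by
  rewrite (inj_eq enum_val_inj).
1-4: by move=> /le_clamp; tauto.
all: by apply: le_lt_trans sd; rewrite E; apply: ler_sum => k _; exact: clamp_lip.
Qed.

End clamp.

Section variation_abs_cont.
Context {R : realType} (f : R -> R).
Hypothesis acf : abs_cont f.

Lemma itv_partition_nthS (a b : R) s : itv_partition a b s ->
  forall k l, (k < l)%N -> (l <= size s)%N -> nth b (a :: s) k < nth b (a :: s) l.
Proof.
move=> [ps _] k l kl ls.
have srt : sorted <%R (a :: s) by [].
by apply: (sorted_ltn_nth lt_trans) => //; rewrite inE/= ltnS// (leq_trans (ltnW kl)).
Qed.

Lemma itv_partition_bounds (a b : R) s : itv_partition a b s ->
  \sum_(k < size s) (nth b (a :: s) k.+1 - nth b (a :: s) k) = b - a.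
Proof.
move=> [ps /eqP ls].
rewrite -(big_mkord xpredT (fun k => nth b (a :: s) k.+1 - nth b (a :: s) k)).
rewrite telescope_sumr//= -[in RHS]ls; congr (_ - _).
by rewrite (last_nth b).
Qed.

Lemma itv_partition_in (a b : R) s k : itv_partition a b s -> (k <= size s)%N ->
  a <= nth b (a :: s) k <= b.
Proof.
move=> abs ks; apply/andP; split.
  case: k ks => // k ks; apply/ltW; exact: (itv_partition_nthS abs (ltn0Sn k)).
have [_ /eqP lb] := abs; rewrite (last_nth b) in lb.
rewrite -[leRHS]lb; have [->//|kn] := eqVneq k (size s).
by apply/ltW/itv_partition_nthS => //; rewrite ltn_neqAle kn.
Qed.

(** For e = 1, every partition of an interval shorter than d has variation below 1. *)
Lemma abs_cont_small_variation : exists2 d : R, 0 < d &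
  forall a b, a <= b -> b - a < d -> total_variation a b f \is a fin_num.
Proof.
have [d d0 H] := acf ltr01; exists d => // a b ab bad.
apply/bounded_variationP => //; exists 1 => _ [s abs <-].
rewrite /variation big_mkord; apply/ltW/(H _ (fun k : 'I_(size s) => nth b (a :: s) k)
   (fun k : 'I_(size s) => nth b (a :: s) k.+1)).
- by move=> k; apply/ltW/(itv_partition_nthS abs).
- move=> k l; rewrite neq_ltn => /orP[kl|kl]; [left|right].
    have [->//|kl'] := eqVneq k.+1 (l : nat); apply/ltW/(itv_partition_nthS abs).
      by rewrite ltn_neqAle kl'.
    exact/ltnW.
  have [->//|kl'] := eqVneq l.+1 (k : nat); apply/ltW/(itv_partition_nthS abs).
    by rewrite ltn_neqAle kl'.
  exact/ltnW.
- by rewrite itv_partition_bounds.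
Qed.

(** The interval is cut into N equal pieces of length h < d, and variation is additive. *)
Lemma abs_cont_variation_fin a b : a <= b -> total_variation a b f \is a fin_num.
Proof.
move=> ab; have [d d0 H] := abs_cont_small_variation.
pose N := (Num.bound ((b - a) / d)).+1.
pose h := (b - a) / N%:R.
have h0 : 0 <= h by rewrite divr_ge0// subr_ge0.
have hd : h < d.
  rewrite /h ltr_pdivrMr// mulrC -ltr_pdivrMr//.
  have ba0 : 0 <= (b - a) / d by rewrite divr_ge0 ?subr_ge0// ltW.
  apply: lt_le_trans (archi_boundP ba0) _.
  by rewrite /N -natr1 lerDl.
suff: forall k : nat, total_variation a (a + k%:R * h) f \is a fin_num.
  move=> /(_ N); rewrite (_ : a + N%:R * h = b)//.
  by rewrite /h [X in a + X]mulrC divfK ?pnatr_eq0// addrC subrK.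
elim => [|k ih]; first by rewrite mul0r addr0 total_variationxx.
have h1 : a <= a + k%:R * h by rewrite lerDl mulr_ge0.
have h2 : a + k%:R * h <= a + k.+1%:R * h by rewrite lerD2l ler_wpM2r// ler_nat.
rewrite (total_variationD f h1 h2) fin_numD ih/=; apply: H => //.
by rewrite (_ : _ - _ = h)// -natr1; ring.
Qed.

(** In each interval a partition nearly attains the variation; the cells of all these partitions
    together form one finite family without overlaps, to which absolute continuity applies. The
    inequality is not strict because the slack eta tends to 0. *)
Lemma abs_cont_total_variation (e : R) : 0 < e -> exists2 d : R, 0 < d &
    forall (I : finType) (a b : I -> R), (forall k, a k <= b k) ->
      (forall k l, k != l -> b k <= a l \/ b l <= a k) ->
      \sum_k (b k - a k) < d ->
      \sum_k fine (total_variation (a k) (b k) f) <= e.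
Proof.
move=> e0; have [d d0 H] := acf e0; exists d => // I a b ab dis sd.
apply/ler_addgt0Pr => eta eta0.
(* The slack eta is shared equally; the successor covers an empty index type. *)
have /choice[s sP] : forall k, exists s, itv_partition (a k) (b k) s /\
  fine (total_variation (a k) (b k) f) <= variation (a k) (b k) f s + eta / (#|I|.+1)%:R.
  move=> k; have := ab k; rewrite le_eqVlt => /orP[/eqP akb|akb].
    exists [::]; split; first by split => //=; exact/eqP.
    rewrite akb total_variationxx /variation big_nil/= add0r.
    by rewrite divr_ge0// ltW.
  have fn := abs_cont_variation_fin (ab k).
  have ep : 0 < eta / (#|I|.+1)%:R by rewrite divr_gt0.
  have [_ [_ [s abs <-] <-]] := ub_ereal_sup_adherent ep fn.
  move=> lt; exists s; split => //.
  rewrite -lerBlDr -lee_fin EFinB fineK//; exact: ltW.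
apply: (@le_trans _ _ (\sum_k (variation (a k) (b k) f (s k) + eta / (#|I|.+1)%:R))).
  by apply: ler_sum => k _; have [] := sP k.
rewrite big_split/= lerD//; last first.
  rewrite sumr_const -[leLHS]mulr_natr mulrAC ler_pdivrMr// ler_pM2l//.
  by rewrite ler_nat.
under eq_bigr do rewrite /variation big_mkord.
rewrite (sig_big_dep xpredT (fun k => xpredT)
  (fun k (j : 'I_(size (s k))) => `|_|))/=.
(* A pair (k, j) names the j-th cell of the partition of the k-th interval. *)
pose J := {k : I & 'I_(size (s k))}.
pose A (u : J) := nth (b (tag u)) (a (tag u) :: s (tag u)) (tagged u).
pose B (u : J) := nth (b (tag u)) (a (tag u) :: s (tag u)) (tagged u).+1.
apply/ltW/(H J A B).
- move=> u; apply/ltW/itv_partition_nthS => //.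
  by have [] := sP (tag u).
- move=> [k i] [l j]; have [kl|kl _] := eqVneq k l; last first.
    rewrite /A /B/=; have [sk _] := sP k; have [sl _] := sP l.
    have /andP[k1 k2] := itv_partition_in sk (ltnW (ltn_ord i)).
    have /andP[k3 k4] := itv_partition_in sk (ltn_ord i).
    have /andP[l1 l2] := itv_partition_in sl (ltnW (ltn_ord j)).
    have /andP[l3 l4] := itv_partition_in sl (ltn_ord j).
    by case: (dis _ _ kl) => ?; [left|right]; lra.
  move: j; rewrite -kl => j.
  rewrite -tag_eqE /tag_eq/= eqxx tagged_asE/= => ij; rewrite /A /B/=.
  have [abs _] := sP k; move: ij; rewrite neq_ltn => /orP[ij|ij]; [left|right].
    have [E|kl'] := eqVneq i.+1 (j : nat); first by rewrite -E.
    apply/ltW; apply: (itv_partition_nthS (k := i.+1) abs).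
      by rewrite ltn_neqAle kl'.
    exact/ltnW.
  have [E|kl'] := eqVneq j.+1 (i : nat); first by rewrite -E.
  apply/ltW; apply: (itv_partition_nthS (k := j.+1) abs).
    by rewrite ltn_neqAle kl'.
  exact/ltnW.
- have <- : \sum_k \sum_(j < size (s k))
      (nth (b k) (a k :: s k) j.+1 - nth (b k) (a k :: s k) j) = \sum_u (B u - A u).
    by rewrite (sig_big_dep xpredT (fun k => xpredT)
      (fun k (j : 'I_(size (s k))) => (_ - _)))/=.
  rewrite (eq_bigr (fun k => b k - a k))// => k _.
  by apply: itv_partition_bounds; have [] := sP k.
Qed.

End variation_abs_cont.

Section density.
Context {R : realType}.
Local Notation mu := (@lebesgue_measure R).

Lemma abs_cont_continuous (f : R -> R) : abs_cont f -> continuous f.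
Proof.
move=> acf x; apply/(@cvgrPdist_lt _ R^o) => e e0; have [d d0 H] := acf e e0.
near=> y.
have yd : `|x - y| < d by near: y; exact: (@cvgr_dist_lt _ R^o).
have := H 'I_1 (fun=> Num.min x y) (fun=> Num.max x y); rewrite !big_ord1.
have -> : `|f (Num.max x y) - f (Num.min x y)| = `|f x - f y|.
  by rewrite /Num.min /Num.max; case: ifP => // _; rewrite distrC.
apply.
- by move=> _; rewrite /Num.min /Num.max; case: ltP => // /ltW.
- by move=> k l; rewrite !ord1.
- by move: yd; rewrite ltr_norml => /andP[y1 y2]; rewrite /Num.min /Num.max; case: (ltP x y) => xy; lra.
Unshelve. all: by end_near. Qed.

Lemma lebesgue_stieltjes_itv (h : cumulative R R) (a b : R) : a <= b ->
  lebesgue_stieltjes_measure h `]a, b]%classic = (h b - h a)%:E.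
Proof.
move=> ab; rewrite /lebesgue_stieltjes_measure/= /measure_extension/= measurable_mu_extE/=; last exact: is_ocitv.
by rewrite wlength_itv_bnd.
Qed.

(** A null set is covered by half-open intervals of total length below d, and absolute continuity
    bounds the h-mass of any finite part of the cover by e. *)
Lemma lebesgue_stieltjes_dominated (h : cumulative R R) : abs_cont h ->
  forall A, measurable A -> mu A = 0%E -> lebesgue_stieltjes_measure h A = 0%E.
Proof.
move=> ach A mA A0; apply/eqP; rewrite eq_le measure_ge0 andbT.
apply/lee_addgt0Pr => e e0; rewrite add0e.
have [d d0 H] := ach e e0.
have : (mu A < d%:E)%E by rewrite A0 lte_fin.
(* Lebesgue measure is unfolded to an infimum over countable covers by half-open intervals. *)
rewrite {1}/lebesgue_measure/= /lebesgue_stieltjes_measure/= /measure_extension/mu_ext/=.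
move=> /ereal_inf_lt[_ [F [mF AF] <-] Fd].
have mF' n : measurable (F n : set (measurableTypeR R)).
  by apply: sub_sigma_algebra; exact: mF.
have mUF n : measurable (\big[setU/set0]_(i < n) F i : set (measurableTypeR R)).
  by apply: bigsetU_measurable => i _.
apply: (@le_trans _ _ (lebesgue_stieltjes_measure h (\bigcup_n F n))).
  by apply: le_measure => //; rewrite inE//; exact: bigcupT_measurable.
(* The finite unions increase to the whole cover, so bounding each of them suffices. *)
have ndU : nondecreasing_seq (fun n => \big[setU/set0]_(i < n) F i).
  by move=> m n mn; apply/subsetPset; exact: subset_bigsetU.
have := @nondecreasing_cvg_mu _ _ R (lebesgue_stieltjes_measure h)
  (fun n => \big[setU/set0]_(i < n) F i) mUF.
rewrite (_ : \bigcup_n \big[setU/set0]_(i < n) F i = \bigcup_n F n); last first.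
  apply/seteqP; split => x [n _].
    by rewrite -bigcup_mkord => -[i /= _ Fi]; exists i.
  by move=> Fn; exists n.+1 => //; rewrite -bigcup_mkord; exists n => /=.
move=> /(_ (bigcupT_measurable _ mF') ndU) cv.
rewrite -(cvg_lim _ cv)//; apply: lime_le; first by apply/cvg_ex; eexists; exact: cv.
near=> n => /=.
have mB : measurable (\big[setU/set0]_(i < n) F i : set (SetRing.type (ocitv_type R))).
  by apply: bigsetU_measurable => i _; apply: SetRing.measurable_subring; exact: mF.
have muB : (mu (\big[setU/set0]_(i < n) F i) < d%:E)%E.
  apply: le_lt_trans Fd.
  apply: (@le_trans _ _ (\sum_(i < n) mu (F i))%E).
    by apply: Boole_inequality => i _; exact: mF'.
  have -> : (\sum_(i < n) mu (F i) = \sum_(0 <= i < n) wlength idfun (F i))%E.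
    rewrite big_mkord; apply: eq_bigr => i _.
    exact: (measurable_mu_extE _ (mF i)).
  apply: nneseries_lim_ge => k _ _; exact: wlength_ge0.
(* The sets F i may overlap; their finite union, an element of the ring generated by half-open
   intervals, is also a disjoint union of finitely many nonempty such intervals. *)
have [D [Dfin D0 Dtriv mD DE]] := SetRing.ring_finite_set mB.
have Dm X : D X -> measurable (X : set (measurableTypeR R)).
  by move=> DX; apply: sub_sigma_algebra; apply: mD; rewrite inE.
have /finite_seqP[s0 Ds0] := Dfin.
pose s := undup s0.
have Ds : D = [set` s] by rewrite Ds0; apply/seteqP; split => x /=; rewrite mem_undup.
have DsP k : (k < size s)%N -> D (nth set0 s k).
  by move=> ks; rewrite Ds /= mem_nth.
have /choice[ab abP] : forall k : 'I_(size s), exists x : R * R,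
    x.1 < x.2 /\ nth set0 s k = `]x.1, x.2]%classic.
  move=> k; have Dk := DsP _ (ltn_ord k).
  have := mD _ (mem_set Dk); rewrite /measurable/= => /ocitvP[k0|[x x12 kx]].
    by have := D0 _ Dk; rewrite k0 => /set0P; rewrite eqxx.
  by exists x.
have E (nu : {measure set (measurableTypeR R) -> \bar R}) :
    nu (\big[setU/set0]_(i < n) F i) = (\sum_(k < size s) nu (nth set0 s k))%E.
  rewrite DE measure_fin_bigcup//.
  rewrite Ds -fsbig_seq ?undup_uniq//=.
  by rewrite (big_nth set0) big_mkord.
rewrite E (eq_bigr (fun k => (h (ab k).2 - h (ab k).1)%:E)); last first.
  by move=> k _; rewrite (abP k).2; exact: lebesgue_stieltjes_itv (ltW (abP k).1).
rewrite sumEFin lee_fin; apply: le_trans (ltW (H _ (fun k => (ab k).1) (fun k => (ab k).2) _ _ _)).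
- by apply: ler_sum => k _; exact: ler_norm.
- by move=> k; apply/ltW; have [] := abP k.
- move=> k l kl; have [k1 k2] := abP k; have [l1 l2] := abP l.
  have [?|h1] := leP (ab k).2 (ab l).1; first by left.
  have [?|h2] := leP (ab l).2 (ab k).1; first by right.
  exfalso.
  (* Were the two intervals to overlap, the smaller right end would lie in both. *)
  pose m := Num.min (ab k).2 (ab l).2.
  have /Dtriv : (nth set0 s k `&` nth set0 s l) !=set0.
    exists m; rewrite k2 l2; split => /=; rewrite in_itv/= /m lt_min ge_min lexx ?orbT ?andbT/=.
      by rewrite k1 h2.
    by rewrite h1 l1.
  move=> /(_ (DsP _ (ltn_ord k)) (DsP _ (ltn_ord l))) /eqP.
  by rewrite nth_uniq ?undup_uniq// => /eqP/val_inj/eqP; rewrite (negbTE kl).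
- rewrite -lte_fin -sumEFin; apply: le_lt_trans muB; rewrite E le_eqVlt; apply/orP; left.
  apply/eqP; apply: eq_bigr => k _; rewrite (abP k).2.
  exact/esym/(lebesgue_stieltjes_itv idfun (ltW (abP k).1)).
Unshelve. all: by end_near. Qed.

(** Restriction to ]0, T] makes the Stieltjes measure of h finite; its Radon-Nikodym density with
    respect to Lebesgue measure is g. *)
Lemma nondecreasing_density (h : R -> R) (T : R) : 0 <= T ->
  {homo h : x y / x <= y} -> abs_cont h ->
  exists g : R -> R, mu.-integrable setT (EFin \o g) /\
    forall t, 0 <= t -> t <= T -> (h t - h 0)%:E = (\int[mu]_(x in `]0%R, t]) (g x)%:E)%E.
Proof.
move=> T0 ndh ach.
have rc : forall x, h @ at_right x --> h x.
  exact/right_continuousW/abs_cont_continuous.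
pose H : cumulative R R := HB.pack h (isCumulative.Build R _ R h ndh rc).
pose D : set (measurableTypeR R) := `]0, T]%classic.
have mD : measurable D by exact: measurable_itv.
have Doo : (lebesgue_stieltjes_measure H D < +oo)%E.
  by rewrite lebesgue_stieltjes_itv// ltry.
pose nu : {finite_measure set (measurableTypeR R) -> \bar R} := mfrestr mD Doo.
have numu : nu `<< mu.
  apply/null_content_dominatesP => A mA A0.
  apply: (@lebesgue_stieltjes_dominated H ach); first exact: measurableI.
  by apply/eqP; rewrite eq_le measure_ge0 andbT -A0 le_measure// inE//; exact: measurableI.
have [g [g0 gfin gint gE]] := radon_nikodym_sigma_finite numu.
exists (fine \o g); split.
  by apply: eq_integrable gint => // x _ /=; rewrite fineK.
move=> t t0 tT; have := gE `]0, t]%classic (measurable_itv _).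
have -> : nu `]0, t]%classic = (h t - h 0)%:E.
  rewrite -(lebesgue_stieltjes_itv H t0).
  apply: (congr1 (lebesgue_stieltjes_measure H)); apply: setIidl => x.
  by rewrite /D/= !in_itv/= => /andP[-> xt]; rewrite (le_trans xt).
by move=> ->; apply: eq_integral => x _ /=; rewrite fineK.
Qed.

End density.

Section density_of_abs_cont.
Context {R : realType}.
Local Notation mu := (@lebesgue_measure R).

(** Jordan decomposition f = V - W with V the variation function: both parts are nondecreasing and
    absolutely continuous, hence have densities. *)
Lemma abs_cont_density (f : R -> R) (T : R) : 0 <= T -> abs_cont f ->
  exists g : R -> R, mu.-integrable setT (EFin \o g) /\
    forall t, 0 <= t -> t <= T -> f t = f 0 + Rintegral mu `[0, t]%classic g.
Proof.
move=> T0 acf.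
pose V x := fine (total_variation 0 (clamp T x) f).
have VD a b : a <= b -> V b - V a = fine (total_variation (clamp T a) (clamp T b) f).
  move=> ab; rewrite /V (total_variationD f (clamp_ge0 T0 a) (le_clamp T ab)).
  rewrite fineD ?(abs_cont_variation_fin acf) ?clamp_ge0// ?le_clamp//.
  by rewrite addrAC subrr add0r.
have VD0 a b : a <= b -> 0 <= V b - V a.
  by move=> ab; rewrite VD//; apply: fine_ge0; apply: total_variation_ge0; exact: le_clamp.
have fV a b : a <= b -> `|f (clamp T b) - f (clamp T a)| <= V b - V a.
  move=> ab; rewrite VD// -lee_fin fineK ?(abs_cont_variation_fin acf) ?le_clamp//.
  by apply: total_variation_ge; exact: le_clamp.
pose W x := V x - f (clamp T x).
(* Increments dominated by those of c V give absolute continuity; this is used for V with c = 1 and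
   for W with c = 2. The 2 in e / (2 * c) makes the final inequality strict. *)
have key (h : R -> R) (c : R) : 0 < c ->
    (forall a b, a <= b -> `|h b - h a| <= c * (V b - V a)) -> abs_cont h.
  move=> c0 hc e e0; have e2 : 0 < e / (2 * c) by rewrite divr_gt0// mulr_gt0.
  have [d d0 H] := abs_cont_total_variation acf e2.
  exists d => // I a b ab dis sd.
  apply: (@le_lt_trans _ _ (c * (e / (2 * c)))); last first.
    by rewrite (_ : c * _ = e / 2); [lra|field; rewrite gt_eqF].
  apply: (@le_trans _ _ (\sum_k c * (V (b k) - V (a k)))).
    by apply: ler_sum => k _; exact: hc.
  rewrite -mulr_sumr ler_pM2l//; under eq_bigr do rewrite VD//.
  apply: (H _ (fun k => clamp T (a k)) (fun k => clamp T (b k))).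
  - by move=> k; exact: le_clamp.
  - by move=> k l /dis[] h1; [left|right]; exact: le_clamp.
  - by apply: le_lt_trans sd; apply: ler_sum => k _; exact: clamp_lip.
have acV : abs_cont V.
  by apply: (key V 1) => // a b ab; rewrite mul1r ger0_norm// VD0.
have acW : abs_cont W.
  apply: (key W 2) => // a b ab.
  have -> : W b - W a = (V b - V a) - (f (clamp T b) - f (clamp T a)) by rewrite /W; ring.
  apply: le_trans (ler_normB _ _) _.
  by rewrite (ger0_norm (VD0 _ _ ab)) mulr2n mulrDl mul1r lerD2l fV.
have ndV : {homo V : x y / x <= y} by move=> x y xy; rewrite -subr_ge0 VD0.
have ndW : {homo W : x y / x <= y}.
  move=> x y xy; rewrite -subr_ge0.
  have -> : W y - W x = (V y - V x) - (f (clamp T y) - f (clamp T x)) by rewrite /W; ring.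
  by rewrite subr_ge0; apply: le_trans (ler_norm _) (fV _ _ xy).
have [g1 [ig1 g1E]] := nondecreasing_density T0 ndV acV.
have [g2 [ig2 g2E]] := nondecreasing_density T0 ndW acW.
have i12 : mu.-integrable setT (EFin \o (g1 \- g2)).
  rewrite (_ : _ \o _ = (EFin \o g1) \- (EFin \o g2))%E; first exact: integrableB.
  by apply/funext => x /=; rewrite EFinB.
exists (g1 \- g2); split=> // t t0 tT.
have i1 : mu.-integrable `]0, t]%classic (EFin \o g1) by exact: integrableS ig1.
have i2 : mu.-integrable `]0, t]%classic (EFin \o g2) by exact: integrableS ig2.
rewrite -Rintegral_itv_obnd_cbnd; last exact: integrableS i12.
rewrite RintegralB//.
rewrite /Rintegral -g1E// -g2E//= /W !clamp_id//; ring.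
Qed.

(** This is Lebesgue differentiation of the indefinite integral; at an interior point t, f coincides
    near t with that integral up to a constant. *)
Lemma density_derive1 (f g : R -> R) (T : R) : mu.-integrable setT (EFin \o g) ->
  (forall t, 0 <= t -> t <= T -> f t = f 0 + Rintegral mu `[0, t]%classic g) ->
  {ae mu, forall t, 0 < t -> t < T -> derive1 f t = g t}.
Proof.
move=> ig fE.
have ig0 y : mu.-integrable [set` Interval (BLeft 0) (BRight y)] (EFin \o g).
  exact: integrableS ig.
have lg : locally_integrable [set: R] g.
  by apply: open_integrable_locally; [exact: openT|exact: ig].
have := FTC1 ig0 lg.
apply: filterS; first exact: (ae_filter_ringOfSetsType mu).
move=> t H t0 tT.
have [|dF <-] := H; first by rewrite /= lte_fin.
rewrite !derive1E.
transitivity ('D_1 (cst (f 0) + (fun x => Rintegral mu `[0, x]%classic g)) t).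
  apply: near_eq_derive.
  near=> y; rewrite /= fE//.
    by apply/ltW; near: y; exact: lt_nbhsr.
  by apply/ltW; near: y; exact: lt_nbhsl.
by rewrite deriveD// derive_cst add0r.
Unshelve. all: by end_near. Qed.

End density_of_abs_cont.

(** * Rotation invariance of area and integration of radial functions *)

Section lebesgue_translation.
Context {R : realType}.
Local Notation mu := (@lebesgue_measure R).

Lemma lebesgue_measure_translation (c : R) (A : set R) : measurable A ->
  pushforward mu ((fun x => x + c) : _ -> measurableTypeR R) A = mu A.
Proof.
move=> mA.
have mc : measurable_fun setT ((fun x => x + c) : measurableTypeR R -> measurableTypeR R).
  exact: measurable_funD.
apply/esym/lebesgue_measure_unique => //= _ [[a b]] _ <-.
rewrite /pushforward (_ : _ @^-1` _ = `]a - c, b - c]%classic); last first.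
  by apply/seteqP; split => x /=; rewrite !in_itv/= ltrBlDr lerBrDr.
rewrite !lebesgue_measure_itv/= !lte_fin ltrD2r; case: ifP => // _.
by rewrite -!EFinB; congr (_%:E); lra.
Qed.

Lemma ge0_integral_translation (f : R -> \bar R) (c : R) :
  measurable_fun setT f -> (forall x, 0 <= f x)%E ->
  (\int[mu]_x f (x + c)%R = \int[mu]_x f x)%E.
Proof.
move=> mf f0.
have mc : measurable_fun setT ((fun x => x + c) : measurableTypeR R -> measurableTypeR R).
  exact: measurable_funD.
have := @ge0_integral_pushforward _ _ _ _ R _ mc mu setT f.
rewrite preimage_setT => <- //; apply: eq_measure_integral => //= A mA _.
exact: lebesgue_measure_translation.
Qed.

End lebesgue_translation.

Section plane_rotation.
Context {R : realType}.
Local Notation mu := (@lebesgue_measure R).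
Implicit Type f : R * R -> \bar R.

(** For fixed z.2 the shear is a translation of z.1, so Tonelli reduces the claim to dimension
    one. *)
Lemma ge0_integral_shear1 f (c : R) :
  measurable_fun setT f -> (forall x, 0 <= f x)%E ->
  (\int[leb2]_z f ((z.1 + c * z.2)%R, z.2) = \int[leb2]_z f z)%E.
Proof.
move=> mf f0.
have ms : measurable_fun setT (fun z : R * R => (z.1 + c * z.2, z.2)).
  apply: measurable_fun_pair => //=; apply: measurable_funD => //=.
  exact: measurable_funM.
rewrite /leb2 fubini_tonelli2//=; last exact: (measurableT_comp mf ms).
rewrite fubini_tonelli2//; apply: eq_integral => y _; rewrite /fubini_G/=.
apply: (ge0_integral_translation (f := fun x => f (x, y))) => //.
exact/measurableT_comp.
Qed.

Lemma ge0_integral_shear2 f (c : R) :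
  measurable_fun setT f -> (forall x, 0 <= f x)%E ->
  (\int[leb2]_z f (z.1, (z.2 + c * z.1)%R) = \int[leb2]_z f z)%E.
Proof.
move=> mf f0.
have ms : measurable_fun setT (fun z : R * R => (z.1, z.2 + c * z.1)).
  apply: measurable_fun_pair => //=; apply: measurable_funD => //=.
  exact: measurable_funM.
rewrite /leb2 fubini_tonelli1//=; last exact: (measurableT_comp mf ms).
rewrite fubini_tonelli1//; apply: eq_integral => x _; rewrite /fubini_F/=.
apply: (ge0_integral_translation (f := fun y => f (x, y))) => //.
exact/measurableT_comp.
Qed.

(* A rotation with s != 0 is a product of three shears; the half-turn is the
   square of a quarter-turn. *)
Lemma ge0_integral_rotation f (c s : R) : c ^+ 2 + s ^+ 2 = 1 ->
  measurable_fun setT f -> (forall x, 0 <= f x)%E ->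
  (\int[leb2]_z f ((c * z.1 - s * z.2)%R, (s * z.1 + c * z.2)%R) =
   \int[leb2]_z f z)%E.
Proof.
have mrot a b : measurable_fun setT (fun z : R * R => (a * z.1 - b * z.2, b * z.1 + a * z.2)).
  by apply: measurable_fun_pair => /=; [apply: measurable_funB|apply: measurable_funD];
    exact: measurable_funM.
have key f' a b : b != 0 -> a ^+ 2 + b ^+ 2 = 1 ->
    measurable_fun setT f' -> (forall x, 0 <= f' x)%E ->
    (\int[leb2]_z f' ((a * z.1 - b * z.2)%R, (b * z.1 + a * z.2)%R) =
    \int[leb2]_z f' z)%E.
  (* For a = cos u and b = sin u, k is - tan(u / 2): the rotation is a horizontal shear by k, a
     vertical one by b, and again a horizontal one by k. *)
  move=> b0 ab mf f0; pose k := (a - 1) / b.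
  have ms1 : measurable_fun setT (fun z : R * R => (z.1 + k * z.2, z.2)).
    apply: measurable_fun_pair => //=; apply: measurable_funD => //=.
    exact: measurable_funM.
  have ms2 : measurable_fun setT (fun z : R * R => (z.1, z.2 + b * z.1)).
    apply: measurable_fun_pair => //=; apply: measurable_funD => //=.
    exact: measurable_funM.
  rewrite -(ge0_integral_shear1 k mf f0).
  rewrite -(@ge0_integral_shear2 (fun z => f' (z.1 + k * z.2, z.2)) b) => //; last first.
    exact: (measurableT_comp mf ms1).
  rewrite -(@ge0_integral_shear1 (fun z => f' (z.1 + k * (z.2 + b * z.1), z.2 + b * z.1)) k) => //; last first.
    exact: (measurableT_comp (measurableT_comp mf ms1) ms2).
  apply: eq_integral => -[x y] _ /=; congr (f' (_, _)); last by rewrite /k; field.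
  have -> : x + k * y + k * (y + b * (x + k * y)) =
    a * x + k * (a + 1) * y by rewrite /k; field.
  rewrite (_ : k * (a + 1) = - b); first by ring.
  have bk : b * k = a - 1 by rewrite /k; field.
  apply: (mulfI b0); rewrite mulrA bk.
  have -> : b * - b = a ^+ 2 - 1 by rewrite -ab; ring.
  by ring.
move=> cs mf f0; have [s0|s0] := eqVneq s 0; last exact: key.
have c0 : c != 0.
  by apply/eqP => c0; move: cs; rewrite c0 s0 expr0n addr0 => /eqP; rewrite eq_sym oner_eq0.
(* Here c is 1 or -1. A quarter-turn followed by the rotation of cosine 0 and sine - c is the
   identity for c = 1 and the half-turn for c = -1. *)
rewrite -(key f 0 1) ?expr0n ?expr1n ?add0r ?oner_neq0//.
rewrite -(key (fun z => f (0 * z.1 - 1 * z.2, 1 * z.1 + 0 * z.2)) s (- c)) ?oppr_eq0 ?sqrrN//; last 2 first.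
- by rewrite addrC.
- exact: (measurableT_comp mf (mrot 0 1)).
apply: eq_integral => -[x y] _ /=; congr (f (_, _)); ring.
Qed.

End plane_rotation.

Section radial.
Context {R : realType}.
Local Notation mu := (@lebesgue_measure R).

Lemma integral_mrestr d (T : measurableType d) (m : {measure set T -> \bar R})
  (D : set T) (mD : measurable D) (f : T -> \bar R) :
  measurable_fun setT f -> (forall x, 0 <= f x)%E ->
  (\int[mrestr m mD]_x f x = \int[m]_(x in D) f x)%E.
Proof.
move=> mf f0; rewrite (@ge0_negligible_integral _ _ _ (mrestr m mD) setT (~` D)) //.
  2: exact: measurableC.
  2: exact: (etrans (congr1 m (setICl D)) (measure0 m)).
rewrite setTD setCK; apply: eq_measure_integral => A mA AD.
exact: (congr1 m (setIidl AD)).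
Qed.

(** Antiderivative for the integral that the substitution x = r cos t produces in
    [integral_half_chord]. *)
Lemma is_derive_half_disc (r t : R) :
  is_derive t 1 (fun t => r ^+ 2 * (t - sin t * cos t)) (2 * r ^+ 2 * sin t ^+ 2).
Proof.
apply: is_derive_eq; rewrite /GRing.scale/=.
have := cos2Dsin2 t => e.
rewrite -!expr2 mulrN -expr2 -{1}e; ring.
Qed.

(** The integrand is the length of the vertical chord at abscissa x. The substitution x = r cos t is
    decreasing on [0, pi]. *)
Lemma integral_half_chord (r : R) : 0 < r ->
  (\int[mu]_(x in `[(- r)%R, r]) (2 * Num.sqrt (r ^+ 2 - x ^+ 2))%:E = (pi * r ^+ 2)%:E)%E.
Proof.
move=> r0; pose F t := r * cos t : R.
have dF (t : R) : is_derive t 1 F (- (r * sin t)).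
  by apply: is_derive_eq; rewrite /GRing.scale/= mulrN.
have F'E : derive1 F = fun t => - (r * sin t).
  by apply/funext => t; rewrite derive1E; apply: derive_val.
have cF' : continuous (fun t : R => - (r * sin t)).
  by move=> t; apply/differentiable_continuous/derivable1_diffP.
have -> : - r = F pi by rewrite /F cospi mulrN1.
have -> : (\int[mu]_(x in `[F pi, r]) (2 * Num.sqrt (r ^+ 2 - x ^+ 2))%:E =
   \int[mu]_(x in `[F pi, F 0%R]) (2 * Num.sqrt (r ^+ 2 - x ^+ 2))%:E)%E.
  by rewrite /F cos0 mulr1.
rewrite (integration_by_substitution_decreasing (pi_ge0 R)); last 6 first.
- move=> x y xpi ypi xy; rewrite /F ltr_pM2l//.
  by rewrite ltr_cos.
- by rewrite F'E => x _; exact: cF'.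
- by rewrite F'E; apply/cvg_ex; exists (- (r * sin 0)); apply: cvg_at_right_filter; exact: cF'.
- by rewrite F'E; apply/cvg_ex; exists (- (r * sin pi)); apply: cvg_at_left_filter; exact: cF'.
- have cF t : F x @[x --> t] --> F t.
    by apply: differentiable_continuous; apply/derivable1_diffP; exact: ex_derive.
  split => //; first by apply: cvg_at_right_filter; exact: cF.
  by apply: cvg_at_left_filter; exact: cF.
- apply: continuous_subspaceT => x.
  apply: (@continuous_comp _ _ _ (fun y : R => r ^+ 2 - y ^+ 2) (fun u : R => 2 * Num.sqrt u)).
    exact/differentiable_continuous/derivable1_diffP.
  apply: (@continuous_comp _ _ _ (@Num.sqrt R) ( *%R 2)).
    exact: sqrt_continuous.
  exact: mulrl_continuous.
transitivity (\int[mu]_(t in `[0%R, pi]) (2 * r ^+ 2 * sin t ^+ 2)%:E)%E.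
  apply: eq_integral => t; rewrite inE/= in_itv/= => /andP[t0 tpi].
  congr (_%:E); rewrite /= !fctE F'E /F opprK.
  have -> : r ^+ 2 - (r * cos t) ^+ 2 = (r * sin t) ^+ 2.
    have -> : (r * sin t) ^+ 2 = r ^+ 2 * (1 - cos t ^+ 2).
      by rewrite -(cos2Dsin2 t); ring.
    by ring.
  rewrite sqrtr_sqr ger0_norm; first by ring.
  by apply: mulr_ge0; [exact: ltW|apply: sin_ge0_pi; rewrite t0].
pose H (t : R) := r ^+ 2 * (t - sin t * cos t).
have dH (t : R) : is_derive t 1 H (2 * r ^+ 2 * sin t ^+ 2) := is_derive_half_disc r t.
have cH t : H x @[x --> t] --> H t.
  by apply: differentiable_continuous; apply/derivable1_diffP; exact: ex_derive.
rewrite (@continuous_FTC2 _ _ H).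
- by rewrite /H sinpi sin0 !mul0r !subr0 mulr0 sube0 mulrC.
- exact: pi_gt0.
- by apply: continuous_subspaceT => x; apply/differentiable_continuous/derivable1_diffP.
- split => //; first by apply: cvg_at_right_filter; exact: cH.
  by apply: cvg_at_left_filter; exact: cH.
- by move=> t _; rewrite derive1E; apply: derive_val.
Qed.

Definition zdisc (r : R) : set (R * R) := [set z | z.1 ^+ 2 + z.2 ^+ 2 < r ^+ 2].

Lemma measurable_zdisc r : measurable (zdisc r).
Proof.
have -> : zdisc r = (fun z => z.1 ^+ 2 + z.2 ^+ 2) @^-1` `]-oo, r ^+ 2[%classic.
  by apply/seteqP; split => z; rewrite /zdisc/= in_itv.
rewrite -[X in measurable X]setTI; apply: measurable_funD => //; exact: measurable_funX.
Qed.

Lemma disc_area (r : R) : 0 < r -> leb2 (zdisc r) = (pi * r ^+ 2)%:E.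
Proof.
move=> r0; rewrite -integral_half_chord// /leb2 /product_measure1.
rewrite [RHS]integral_mkcond; apply: eq_integral => x _.
rewrite /= patchE; have [xr|xr] := boolP (x \in `[(- r), r]%classic).
  have -> : xsection (zdisc r) x =
      ball (0 : R) (Num.sqrt (r ^+ 2 - x ^+ 2)).
    apply/seteqP; split => y; rewrite /xsection/= inE /zdisc/= /ball/= sub0r normrN -sqrtr_sqr.
      rewrite -ltrBrDl => h; rewrite ltr_sqrt//.
      exact: le_lt_trans (sqr_ge0 y) h.
    by move=> h; rewrite -ltrBrDl -ltr_sqrt// -sqrtr_gt0 (le_lt_trans _ h)// sqrtr_ge0.
  by rewrite lebesgue_measure_ball// mulr_natl.
rewrite (_ : xsection _ _ = set0) ?measure0//.
apply/seteqP; split => y //; rewrite /xsection/= inE /zdisc/= => h.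
move: xr; rewrite notin_setE/= in_itv/= => /negP; apply/negP; rewrite negbK.
rewrite -ler_norml -(ger0_norm (ltW r0)) -!sqrtr_sqr ler_sqrt ?sqr_ge0//.
by apply/ltW/(le_lt_trans _ h); rewrite lerDl sqr_ge0.
Qed.

End radial.

Section radial_integral.
Context {R : realType}.
Local Notation mu := (@lebesgue_measure R).
Local Notation rho := (fun z : R * R => Num.sqrt (z.1 ^+ 2 + z.2 ^+ 2)).

Lemma measurable_rho : measurable_fun setT rho.
Proof.
have ms : measurable_fun setT (@Num.sqrt R).
  by apply: continuous_measurable_fun; exact: sqrt_continuous.
apply: (measurableT_comp ms).
by apply: measurable_funD; exact: measurable_funX.
Qed.

Lemma unit_disk_zdisc : unit_disk = zdisc (1 : R).
Proof. by rewrite /unit_disk /zdisc expr1n. Qed.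

Lemma measurable_unit_disk : measurable (unit_disk : set (R * R)).
Proof. by rewrite unit_disk_zdisc; exact: measurable_zdisc. Qed.

(* The region below the graph of [r |-> 2 pi r] on [0, 1[: its first
   projection has the same law as the modulus on the disk. *)
Definition radial_region : set (R * R) :=
  [set z | 0 <= z.1 /\ z.1 < 1 /\ 0 <= z.2 /\ z.2 <= 2 * pi * z.1].

Lemma measurable_radial_region : measurable radial_region.
Proof.
have -> : radial_region = ((fst @^-1` `[0, 1[%classic) `&` (snd @^-1` `[0, +oo[%classic))
   `&` ((fun z => 2 * pi * z.1 - z.2) @^-1` `[0, +oo[%classic).
  apply/seteqP; split => z /=; rewrite /radial_region/= !in_itv/= !andbT subr_ge0.
    by move=> [-> [-> [-> ->]]].
  by move=> [[/andP[-> ->] ->] ->].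
apply: measurableI; first apply: measurableI.
- by rewrite -[X in measurable X]setTI; apply: measurable_fst => //.
- by rewrite -[X in measurable X]setTI; apply: measurable_snd => //.
- rewrite -[X in measurable X]setTI; apply: measurable_funB => //.
  exact: measurable_funM.
Qed.

Lemma xsection_radial_region (x : R) : xsection radial_region x =
  if (0 <= x) && (x < 1) then `[0, 2 * pi * x]%classic else set0.
Proof.
apply/seteqP; split => y; rewrite /xsection/= inE /radial_region/=.
  by move=> [-> [-> [y0 yx]]]/=; rewrite in_itv/= y0.
by case: ifPn => // /andP[-> ->]/=; rewrite in_itv/= => /andP[-> ->].
Qed.

Lemma integral_linear (a : R) : 0 <= a ->
  (\int[mu]_(x in `[0%R, a]) (2 * pi * x)%:E = (pi * a ^+ 2)%:E)%E.
Proof.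
rewrite le_eqVlt => /orP[/eqP<-|a0].
  by rewrite set_itv1 integral_set1 expr0n mulr0.
pose F (x : R) := pi * x ^+ 2.
have dF (x : R) : is_derive x 1 F (2 * pi * x).
  by apply: is_derive_eq; rewrite /GRing.scale/=; ring.
have cF (t : R) : F x @[x --> t] --> F t.
  by apply/differentiable_continuous/derivable1_diffP.
rewrite (@continuous_FTC2 _ _ F)//.
- by rewrite /F expr0n mulr0 sube0.
- by apply: continuous_subspaceT => x; exact: mulrl_continuous.
- split => //; first by apply: cvg_at_right_filter; exact: cF.
  by apply: cvg_at_left_filter; exact: cF.
- by move=> t _; rewrite derive1E; apply: derive_val.
Qed.

(** Both image measures give a ray ]-oo, a[ with a > 0 the mass pi min(a, 1)^2, and 0 to the other
    rays; the rays are stable under intersection, generate the Borel sets and have finite mass. *)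
Lemma radial_law (A : set R) : measurable A ->
  pushforward (mrestr leb2 measurable_unit_disk) (rho : measurableTypeR R * measurableTypeR R -> measurableTypeR R) A =
  pushforward (mrestr leb2 measurable_radial_region) (fst : measurableTypeR R * measurableTypeR R -> measurableTypeR R) A.
Proof.
move=> mA.
have mf : measurable_fun setT (rho : measurableTypeR R * measurableTypeR R -> measurableTypeR R) by exact: measurable_rho.
have mg : measurable_fun setT (fst : measurableTypeR R * measurableTypeR R -> measurableTypeR R) by exact: measurable_fst.
have disc (a : R) : 0 < a -> leb2 (rho @^-1` `]-oo, a[%classic `&` unit_disk) =
    (pi * (Num.min a 1) ^+ 2)%:E.
  move=> a0; have m0 : 0 < Num.min a 1 by rewrite lt_min a0 ltr01.
  rewrite -(disc_area m0); congr (_ _).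
  apply/seteqP; split => z; rewrite unit_disk_zdisc /zdisc/= in_itv/=.
    move=> [za z1]; rewrite /Num.min; case: ifP => // _.
    rewrite -ltr_sqrt ?exprn_gt0// sqrtr_sqr gtr0_norm//.
  move=> h; split.
    rewrite -(gtr0_norm a0) -sqrtr_sqr ltr_sqrt ?exprn_gt0//.
    by apply: lt_le_trans h _; rewrite ler_pXn2r ?nnegrE ?(ltW m0) ?(ltW a0)// ge_min lexx.
  by apply: lt_le_trans h _; rewrite ler_pXn2r ?nnegrE ?(ltW m0)// ge_min lexx orbT.
pose G := [set B | exists x : R, B = `]-oo, x[%classic].
apply: (@measure_unique _ _ (measurableTypeR R) G (fun n => `]-oo, n%:R[%classic) _ _ _ _
  (pushforward (mrestr leb2 measurable_unit_disk) (rho : measurableTypeR R * measurableTypeR R -> measurableTypeR R))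
  (pushforward (mrestr leb2 measurable_radial_region) (fst : measurableTypeR R * measurableTypeR R -> measurableTypeR R))) => //.
- exact: RGenInftyO.measurableE.
- move=> _ _ [x ->] [y ->]; exists (Num.min x y).
  by apply/seteqP; split => z /=; rewrite !in_itv/= lt_min => /andP.
- by move=> n; exists n%:R.
- rewrite -subTset => x _; exists (Num.bound `|x|) => //=; rewrite in_itv/=.
  by apply: le_lt_trans (ler_norm _) _; exact: archi_boundP.
- move=> _ [a ->].
  suff: leb2 (rho @^-1` `]-oo, a[%classic `&` unit_disk) =
    leb2 (fst @^-1` `]-oo, a[%classic `&` radial_region) by [].
  have [a0|a0] := leP a 0.
    transitivity (0%E : \bar R); [|symmetry].
      rewrite (_ : _ `&` _ = set0) ?measure0//; apply/seteqP; split => z //=.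
      rewrite in_itv/= => -[za _].
      by have := le_lt_trans (sqrtr_ge0 _) (lt_le_trans za a0); rewrite ltxx.
    rewrite (_ : _ `&` _ = set0) ?measure0//; apply/seteqP; split => z //=.
    rewrite in_itv/= /radial_region/= => -[za [z0 _]].
    by have := le_lt_trans z0 (lt_le_trans za a0); rewrite ltxx.
  rewrite disc// -integral_linear ?le_min ?ltW//.
  rewrite /leb2 /product_measure1 -[LHS]integral_itv_bndo_bndc; last first.
    by apply/measurable_EFinP; exact: measurable_funM.
  rewrite [LHS]integral_mkcond; apply: eq_integral => x _; rewrite patchE/=.
  have -> : xsection (fst @^-1` `]-oo, a[ `&` radial_region) x =
     if x < a then xsection radial_region x else set0.
    apply/seteqP; split => y; rewrite /xsection/=.
      by move=> /set_mem/= -[]; rewrite in_itv/= => -> h; apply/mem_set.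
    by case: ifPn => // xa /set_mem h; apply/mem_set; split => //=; rewrite in_itv.
  rewrite xsection_radial_region mem_setE in_itv/= lt_min.
  case: (0 <= x) / boolP => x0 /=; last by case: ifP => _; exact/esym/measure0.
  case: (boolP (x < a)) => xa /=; last exact/esym/measure0.
  case: (boolP (x < 1)) => x1 /=; last exact/esym/measure0.
  rewrite lebesgue_measure_itv/= lte_fin; case: ltP => [_|]; first by rewrite sube0.
  rewrite pmulr_rle0 ?mulr_gt0 ?pi_gt0// => x0'.
  by have /eqP-> : x == 0; [rewrite eq_le x0 x0'|rewrite mulr0].
- move=> n.
  suff: (leb2 (rho @^-1` `]-oo, n%:R[%classic `&` unit_disk) < +oo)%E by [].
  apply: (@le_lt_trans _ _ (leb2 (zdisc (1:R)))).
    rewrite -unit_disk_zdisc; apply: le_measure; rewrite ?inE//; last exact: measurable_unit_disk.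
    apply: measurableI; last exact: measurable_unit_disk.
    by rewrite -[X in measurable X]setTI; exact: mf.
  by rewrite disc_area ?ltry.
Qed.

(** [radial_law] moves the integral to [radial_region], where Tonelli applies: the section over r
    has length 2 pi r. *)
Lemma integral_radial (psi : R -> \bar R) : measurable_fun setT psi ->
  (forall r, 0 <= psi r)%E ->
  (\int[leb2]_(z in unit_disk) psi (rho z) =
   \int[mu]_(r in `[0%R, 1%R]) ((2 * pi * r)%:E * psi r))%E.
Proof.
move=> mpsi psi0.
have mf : measurable_fun setT (rho : measurableTypeR R * measurableTypeR R -> measurableTypeR R) by exact: measurable_rho.
have mg : measurable_fun setT (fst : measurableTypeR R * measurableTypeR R -> measurableTypeR R) by exact: measurable_fst.
rewrite -(integral_mrestr leb2 measurable_unit_disk (f := psi \o rho)); last 2 first.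
- exact: (measurableT_comp mpsi mf).
- by move=> z; exact: psi0.
have := @ge0_integral_pushforward _ _ _ _ R _ mf (mrestr leb2 measurable_unit_disk) setT psi.
rewrite preimage_setT => <- //.
transitivity (\int[pushforward (mrestr leb2 measurable_radial_region)
    (fst : measurableTypeR R * measurableTypeR R -> measurableTypeR R)]_x psi x)%E.
  by apply: eq_measure_integral => A mA _; exact: radial_law.
have := @ge0_integral_pushforward _ _ _ _ R _ mg (mrestr leb2 measurable_radial_region) setT psi.
rewrite preimage_setT => -> //.
rewrite (integral_mrestr leb2 measurable_radial_region (f := psi \o fst)); last 2 first.
- exact: (measurableT_comp mpsi mg).
- by move=> z; exact: psi0.
rewrite integral_mkcond /leb2 fubini_tonelli1/=; last 2 first.
- by apply/(measurable_restrictT _ _).1; [exact: measurable_radial_region|apply: measurable_funTS; exact: (measurableT_comp mpsi mg)].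
- by move=> z; rewrite patchE; case: ifP => //=.
rewrite -[RHS]integral_itv_bndo_bndc; last first.
  apply: measurable_funTS; apply: emeasurable_funM => //.
  by apply/measurable_EFinP; exact: measurable_funM.
rewrite [RHS]integral_mkcond; apply: eq_integral => x _; rewrite /fubini_F patchE/=.
transitivity (\int[mu]_(y in xsection radial_region x) psi x)%E.
  rewrite [RHS]integral_mkcond; apply: eq_integral => y _; rewrite !patchE/=.
  by rewrite mem_xsection.
rewrite integral_cst; last by apply: measurable_xsection; exact: measurable_radial_region.
rewrite xsection_radial_region mem_setE in_itv/=.
case: ifP => [/andP[x0 x1]|_]; last by rewrite measure0 mule0.
rewrite muleC; congr (_ * _)%E.
rewrite lebesgue_measure_itv/= lte_fin; case: ltP => [_|]; first by rewrite sube0.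
rewrite pmulr_rle0 ?mulr_gt0 ?pi_gt0// => x0'.
by have /eqP-> : x == 0; [rewrite eq_le x0 x0'|rewrite mulr0].
Qed.

End radial_integral.

(** * Kernels of the derivatives of a Poisson integral *)

Section poisson_calculus.
Context {R : realType}.
Implicit Types x y t : R.

(** This is |e^{it} - z|^2 for z = x + i y. *)
Definition pden x y t := 1 - 2 * (x * cos t + y * sin t) + (x ^+ 2 + y ^+ 2).

(* With z = x + i y, the complex kernel i / (2 pi (e^{it} - z)) is a primitive
   in t of the z-derivative of the Poisson kernel; [pa] and [pb] are twice its
   real part and minus twice its imaginary part. *)
Definition pa x y t := (sin t - y) / (pi * pden x y t).
Definition pb x y t := (x - cos t) / (pi * pden x y t).

(** [da] and [db] are the x- and y-derivatives of the Poisson kernel and, at the same time, the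
    t-derivatives of [pa] and [pb]; integration by parts rests on this coincidence. *)
Definition da x y t :=
  ((1 - (x ^+ 2 + y ^+ 2)) * (cos t - x) - x * pden x y t) / (pi * pden x y t ^+ 2).
Definition db x y t :=
  ((1 - (x ^+ 2 + y ^+ 2)) * (sin t - y) - y * pden x y t) / (pi * pden x y t ^+ 2).

(** Reverse triangle inequality |e^{it} - z| >= 1 - |z|, obtained from Cauchy-Schwarz for (x, y) and
    (cos t, sin t). *)
Lemma pden_ge x y t (rho : R) : 0 <= rho -> rho <= 1 -> x ^+ 2 + y ^+ 2 <= rho ^+ 2 ->
  (1 - rho) ^+ 2 <= pden x y t.
Proof.
move=> rho0 rho1 xy; pose r := Num.sqrt (x ^+ 2 + y ^+ 2).
have r2 : r ^+ 2 = x ^+ 2 + y ^+ 2 by rewrite sqr_sqrtr// addr_ge0// sqr_ge0.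
have r0 : 0 <= r by exact: sqrtr_ge0.
have rr : r <= rho by rewrite -(@ler_pXn2r _ 2) ?nnegrE// r2.
have cs : x * cos t + y * sin t <= r.
  apply: le_trans (ler_norm _) _; rewrite -(@ler_pXn2r _ 2) ?nnegrE// real_normK ?num_real//.
  rewrite r2 -[leRHS]mulr1 -(cos2Dsin2 t) -subr_ge0.
  by rewrite [X in 0 <= X](_ : _ = (x * sin t - y * cos t) ^+ 2) ?sqr_ge0//; ring.
apply: (@le_trans _ _ ((1 - r) ^+ 2)).
  by rewrite ler_pXn2r ?nnegrE ?subr_ge0// ?lerB// (le_trans rr).
rewrite /pden -r2; move: cs; lra.
Qed.

Lemma pden_gt0 x y t : x ^+ 2 + y ^+ 2 < 1 -> 0 < pden x y t.
Proof.
move=> xy; pose r := Num.sqrt (x ^+ 2 + y ^+ 2).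
have r1 : r < 1 by rewrite -[ltRHS]sqrtr1 ltr_sqrt.
apply: lt_le_trans (@pden_ge x y t r _ _ _); first by rewrite exprn_gt0// subr_gt0.
- exact: sqrtr_ge0.
- exact: ltW.
- by rewrite sqr_sqrtr// addr_ge0// sqr_ge0.
Qed.

(** Parallelogram law: the values of [pden] at z and - z add up to 2 + 2 |z|^2, and the value at - z
    is nonnegative. *)
Lemma pden_le x y t : x ^+ 2 + y ^+ 2 < 1 -> pden x y t <= 4.
Proof.
move=> xy; have := @pden_ge (- x) (- y) t 1 ler01 (lexx _).
rewrite !sqrrN expr1n subrr expr0n/= => /(_ (ltW xy)).
rewrite /pden !sqrrN !mulNr; lra.
Qed.

Lemma is_derive_div (n d : R -> R) (t n' d' : R) : d t != 0 ->
  is_derive t 1 n n' -> is_derive t 1 d d' ->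
  is_derive t 1 (fun s => n s / d s) ((n' * d t - n t * d') / d t ^+ 2).
Proof.
move=> d0 dn dd.
have dV := is_deriveV d0 dd.
have := is_deriveM dn dV => dM.
apply: (is_derive_eq dM); rewrite /GRing.scale/= /GRing.scale/= ; field.
exact: d0.
Qed.

Lemma is_derive_pden_x x y t : is_derive x 1 (fun s => pden s y t) (2 * (x - cos t)).
Proof.
by apply: is_derive_eq; rewrite /GRing.scale/=; ring.
Qed.

Lemma is_derive_pden_y x y t : is_derive y 1 (fun s => pden x s t) (2 * (y - sin t)).
Proof.
by apply: is_derive_eq; rewrite /GRing.scale/=; ring.
Qed.

Lemma is_derive_pden_t x y t : is_derive t 1 (pden x y) (2 * (x * sin t - y * cos t)).
Proof.
by apply: is_derive_eq; rewrite /GRing.scale/=; ring.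
Qed.

Lemma pi_neq0 : (pi : R) != 0. Proof. by rewrite gt_eqF// pi_gt0. Qed.

Lemma is_derive_poisson_x x y t : pden x y t != 0 ->
  is_derive x 1 (fun s => poisson_kernel s y t) (da x y t).
Proof.
move=> d0; have dn : is_derive x 1 (fun s => 1 - (s ^+ 2 + y ^+ 2)) (- (2 * x)).
  by apply: is_derive_eq; rewrite /GRing.scale/=; ring.
have dk := is_deriveZ ((2 * pi)^-1) (is_derive_div (d := fun s => pden s y t) d0 dn (is_derive_pden_x x y t)).
apply: (is_derive_eq dk); rewrite /GRing.scale/= /da.
by move: (pi) pi_neq0 => p p0; field; rewrite d0 p0.
Qed.

Lemma is_derive_poisson_y x y t : pden x y t != 0 ->
  is_derive y 1 (fun s => poisson_kernel x s t) (db x y t).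
Proof.
move=> d0; have dn : is_derive y 1 (fun s => 1 - (x ^+ 2 + s ^+ 2)) (- (2 * y)).
  by apply: is_derive_eq; rewrite /GRing.scale/=; ring.
have dk := is_deriveZ ((2 * pi)^-1) (is_derive_div (d := fun s => pden x s t) d0 dn (is_derive_pden_y x y t)).
apply: (is_derive_eq dk); rewrite /GRing.scale/= /db.
by move: (pi) pi_neq0 => p p0; field; rewrite d0 p0.
Qed.

Lemma is_derive_pa x y t : pden x y t != 0 -> is_derive t 1 (pa x y) (da x y t).
Proof.
move=> d0; have dn : is_derive t 1 (fun s => sin s - y) (cos t).
  by apply: is_derive_eq; rewrite subr0.
have dd : is_derive t 1 (fun s => pi * pden x y s) (pi * (2 * (x * sin t - y * cos t))).
  exact: is_deriveZ _ (is_derive_pden_t x y t).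
have d0' : pi * pden x y t != 0 by rewrite mulf_neq0// pi_neq0.
apply: (is_derive_eq (is_derive_div (d := fun s => pi * pden x y s) d0' dn dd)); rewrite /da.
(* The two numerators differ by 2 x (cos^2 t + sin^2 t - 1). *)
rewrite (_ : (1 - _) * _ - _ = cos t * pden x y t -
    (sin t - y) * (2 * (x * sin t - y * cos t))).
  by move: (pi) pi_neq0 => p p0; field; rewrite d0 p0.
have s2 : sin t ^+ 2 = 1 - cos t ^+ 2 by rewrite -(cos2Dsin2 t); ring.
apply/eqP; rewrite -subr_eq0 /pden; apply/eqP.
transitivity (2 * x * (cos t ^+ 2 + sin t ^+ 2 - 1)); first by ring.
by rewrite cos2Dsin2 subrr mulr0.
Qed.

Lemma is_derive_pb x y t : pden x y t != 0 -> is_derive t 1 (pb x y) (db x y t).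
Proof.
move=> d0; have dn : is_derive t 1 (fun s => x - cos s) (sin t).
  by apply: is_derive_eq; ring.
have dd : is_derive t 1 (fun s => pi * pden x y s) (pi * (2 * (x * sin t - y * cos t))).
  exact: is_deriveZ _ (is_derive_pden_t x y t).
have d0' : pi * pden x y t != 0 by rewrite mulf_neq0// pi_neq0.
apply: (is_derive_eq (is_derive_div (d := fun s => pi * pden x y s) d0' dn dd)); rewrite /db.
rewrite (_ : (1 - _) * _ - _ = sin t * pden x y t -
    (x - cos t) * (2 * (x * sin t - y * cos t))).
  by move: (pi) pi_neq0 => p p0; field; rewrite d0 p0.
apply/eqP; rewrite -subr_eq0 /pden; apply/eqP.
transitivity (2 * y * (cos t ^+ 2 + sin t ^+ 2 - 1)); first by ring.
by rewrite cos2Dsin2 subrr mulr0.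
Qed.

End poisson_calculus.

(** * Differentiation under the integral sign and integration by parts *)

Section parametric.
Context {R : realType}.
Local Notation mu := (@lebesgue_measure R).
Local Notation I2 := (`[0, 2 * pi]%classic : set R).

Lemma two_pi_gt0 : 0 < 2 * pi :> R.
Proof. by rewrite mulr_gt0 ?pi_gt0. Qed.

Lemma integrable_cont_itv (f : R -> R) : continuous f -> mu.-integrable I2 (EFin \o f).
Proof.
move=> cf; apply: continuous_compact_integrable; first exact: segment_compact.
exact: continuous_subspaceT.
Qed.

Lemma integrable_cst_itv (c : R) : mu.-integrable I2 (EFin \o cst c).
Proof. by apply: integrable_cont_itv => t; exact: cvg_cst. Qed.

Lemma integrable_bounded_mul (k f : R -> R) (M : R) : measurable_fun I2 k ->
  (forall t, `|k t| <= M) -> mu.-integrable I2 (EFin \o f) ->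
  mu.-integrable I2 (EFin \o (fun t => k t * f t)).
Proof.
move=> mk kM intf.
have mf : measurable_fun I2 f by apply/measurable_EFinP; exact: measurable_int intf.
have iM : mu.-integrable I2 (EFin \o (fun t => M * f t)).
  rewrite (_ : _ \o _ = fun t => (M%:E * (EFin \o f) t)%E); last by apply/funext.
  exact: integrableZl.
apply: le_integrable iM => //.
  by apply/measurable_EFinP; apply: measurable_funM.
move=> t _; rewrite /= lee_fin !normrM ler_wpM2r//.
exact: le_trans (kM t) (ler_norm _).
Qed.

(** The integrable function |M f| dominates the s-derivative of the integrand for all s in ]u,
    v[. *)
Lemma is_derive_parametric (k k' : R -> R -> R) (f : R -> R) (a u v M : R) :
  u < a -> a < v -> mu.-integrable I2 (EFin \o f) ->
  (forall s t : R, u < s -> s < v -> is_derive s 1 (k^~ t) (k' s t)) ->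
  (forall s, u < s -> s < v -> continuous (k s)) ->
  (forall s t, u < s -> s < v -> `|k s t| <= M) ->
  (forall s t, u < s -> s < v -> `|k' s t| <= M) ->
  is_derive a 1 (fun s => Rintegral mu I2 (fun t => k s t * f t))
    (Rintegral mu I2 (fun t => k' a t * f t)).
Proof.
move=> ua av intf dk ck kM k'M.
have dkf s t : u < s -> s < v -> is_derive s 1 (fun s => k s t * f t) (k' s t * f t).
  move=> us sv; have := dk s t us sv => h.
  have := is_deriveM h (is_derive_cst (f t) s 1) => h'.
  by apply: (is_derive_eq h'); rewrite scaler0 add0r /GRing.scale/= mulrC.
have E s t : u < s -> s < v -> partial1of2 (fun s t => k s t * f t) s t = k' s t * f t.
  by move=> us sv; rewrite partial1of2E; have := dkf s t us sv => h; apply: derive_val.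
have Ia : (`]u, v[%classic : set R) a by rewrite /= in_itv/= ua av.
have intk s : (`]u, v[%classic : set R) s -> mu.-integrable I2 (EFin \o (fun t => k s t * f t)).
  rewrite /= in_itv/= => /andP[us sv].
  apply: (integrable_bounded_mul _ (fun t => kM s t us sv)) => //.
  by apply: measurable_funTS; apply: continuous_measurable_fun; exact: ck.
have dkI s t : (`]u, v[%classic : set R) s -> I2 t -> derivable (fun s => k s t * f t) s 1.
  by rewrite /= in_itv/= => /andP[us sv] _; have := dkf s t us sv => h; exact: ex_derive.
have iM : mu.-integrable I2 (EFin \o (fun t => `|M * f t|)).
  rewrite (_ : _ \o _ = (fun t => `|(M%:E * (EFin \o f) t)|)%E); last by apply/funext.
  by apply: integrable_abse; exact: integrableZl.
have ub s t : (`]u, v[%classic : set R) s -> I2 t ->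
    `|partial1of2 (fun s t => k s t * f t) s t| <= `|M * f t|.
  rewrite /= in_itv/= => /andP[us sv] _; rewrite E// !normrM ler_wpM2r//.
  exact: le_trans (k'M s t us sv) (ler_norm _).
apply: DeriveDef.
  exact: (@derivable_under_integral R _ _ mu (fun s t => k s t * f t) I2 (measurable_itv _)
    a u v Ia intk dkI _ (fun t => normr_ge0 _) iM ub).
rewrite -derive1E.
rewrite (@differentiation_under_integral R _ _ mu (fun s t => k s t * f t) I2 (measurable_itv _)
  a u v Ia intk dkI _ (fun t => normr_ge0 _) iM ub).
by apply: eq_Rintegral => t _; rewrite E.
Qed.

(** As f is only an indefinite integral, the formula is Fubini for a(t) g(s) on the triangle 0 <= s
    <= t <= 2 pi. Periodicity of A and of f removes the boundary terms. *)
Lemma integration_by_parts_density (A a f g : R -> R) (M : R) :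
  (forall t : R, is_derive t 1 A (a t)) -> continuous a ->
  (forall t, `|a t| <= M) -> (forall t, `|A t| <= M) ->
  A (2 * pi) = A 0 -> f (2 * pi) = f 0 ->
  mu.-integrable I2 (EFin \o f) -> mu.-integrable setT (EFin \o g) ->
  (forall t, 0 <= t -> t <= 2 * pi -> f t = f 0 + Rintegral mu `[0, t]%classic g) ->
  Rintegral mu I2 (fun t => a t * f t) = - Rintegral mu I2 (fun t => A t * g t).
Proof.
move=> dA ca aM AM A2 f2 intf ig fE.
have mg : measurable_fun setT g by apply/measurable_EFinP; exact: measurable_int ig.
have ma : measurable_fun setT a by exact: continuous_measurable_fun.
have cA t : A s @[s --> t] --> A t.
  by apply/differentiable_continuous/derivable1_diffP; have := dA t => h; exact: ex_derive.
have mA : measurable_fun setT A by apply: continuous_measurable_fun => t; exact: cA.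
have M0 : 0 <= M by apply: le_trans (aM 0).
have ig2 : mu.-integrable I2 (EFin \o g) by exact: integrableS ig.
have inta s : 0 <= s -> s <= 2 * pi -> Rintegral mu `[s, 2 * pi]%classic a = A (2 * pi) - A s.
  move=> s0; rewrite le_eqVlt => /orP[/eqP->|s2].
    by rewrite set_itv1 /Rintegral integral_set1/= subrr.
  rewrite /Rintegral (@continuous_FTC2 _ a A)//.
  - exact: continuous_subspaceT.
  - split; first by move=> t _; have := dA t => h; exact: ex_derive.
      by apply: cvg_at_right_filter; exact: cA.
    by apply: cvg_at_left_filter; exact: cA.
  - by move=> t _; rewrite derive1E; have := dA t => h; apply: derive_val.
(* This cancels the term in f 0 that the inner integral over s leaves behind. *)
have int0 : Rintegral mu I2 a = 0 by rewrite inta ?(ltW two_pi_gt0)// A2 subrr.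
pose D : set (R * R) := [set z | 0 <= z.2 /\ z.2 <= z.1 /\ z.1 <= 2 * pi].
have mD : measurable D.
  have -> : D = ((snd @^-1` `[0, +oo[%classic) `&` (fst @^-1` `]-oo, 2 * pi]%classic))
     `&` ((fun z => z.1 - z.2) @^-1` `[0, +oo[%classic).
    apply/seteqP; split => z /=; rewrite /D/= !in_itv/= !andbT subr_ge0.
      by move=> [-> [-> ->]].
    by move=> [[-> ->] ->].
  apply: measurableI; first apply: measurableI.
  - by rewrite -[X in measurable X]setTI; apply: measurable_snd => //.
  - by rewrite -[X in measurable X]setTI; apply: measurable_fst => //.
  - by rewrite -[X in measurable X]setTI; apply: measurable_funB => //.
pose h (z : R * R) := \1_D z * (a z.1 * g z.2).
have mh : measurable_fun setT h.
  apply: measurable_funM; first exact: measurable_indic.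
  by apply: measurable_funM; [apply: (measurableT_comp ma)|apply: (measurableT_comp mg)].
have h1 t : t \in I2 -> forall s, h (t, s) = \1_(`[0, t]%classic) s * (a t * g s).
  rewrite inE/= in_itv/= => /andP[t0 t2] s; rewrite /h !indicE; congr ((nat_of_bool _)%:R * _).
  apply/idP/idP; rewrite !inE/= /D/= in_itv/=; first by move=> [-> [-> _]].
  by move=> /andP[-> ->].
have h10 t : t \notin I2 -> forall s, h (t, s) = 0.
  rewrite notin_setE/= in_itv/= => t2 s.
  have nD : ~ D (t, s) by move=> -[/= s0 [st t2']]; apply: t2; rewrite (le_trans s0 st).
  by rewrite /h indicE memNset// mul0r.
have h2 s : s \in I2 -> forall t, h (t, s) = \1_(`[s, 2 * pi]%classic) t * (a t * g s).
  rewrite inE/= in_itv/= => /andP[s0 s2] t; rewrite /h !indicE; congr ((nat_of_bool _)%:R * _).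
  apply/idP/idP; rewrite !inE/= /D/= in_itv/=; first by move=> [_ [-> ->]].
  by move=> /andP[-> ->].
have h20 s : s \notin I2 -> forall t, h (t, s) = 0.
  rewrite notin_setE/= in_itv/= => s2 t.
  have nD : ~ D (t, s) by move=> -[/= s0 [st t2]]; apply: s2; rewrite s0 (le_trans st).
  by rewrite /h indicE memNset// mul0r.
(* The absolute integral is at most 2 pi M times the L^1 norm of g. *)
have ih : ((mu \x mu)%E).-integrable setT (EFin \o h).
  have mEh : measurable_fun setT (EFin \o h) by exact/measurable_EFinP.
  apply: (integrable12ltyP mu mu mEh).2.
  apply: (@le_lt_trans _ _ (\int[mu]_(t in I2) (M%:E * \int[mu]_s `|(g s)%:E|))%E).
    rewrite [leRHS]integral_mkcond; apply: ge0_le_integral => //.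
    - by move=> t _; apply: integral_ge0.
    - refine (measurable_fun_fubini_tonelli_F (m2 := mu) (fun z => `|(h z)%:E|%E) _ _) => //.
      exact: measurableT_comp.
    - by apply/(measurable_restrictT _ _).1 => //; exact: measurable_cst.
    move=> t _; rewrite patchE; case: ifPn => tI; last first.
      by rewrite integral0_eq// => s _; rewrite /= h10// normr0.
    rewrite -ge0_integralZl//=; last first.
      by apply/measurable_EFinP; exact: measurableT_comp.
    apply: ge0_le_integral => //.
    - apply/measurable_EFinP; apply: measurableT_comp => //.
      exact: (measurableT_comp mh (pair1_measurable t)).
    - apply: measurable_funeM; apply/measurable_EFinP; exact: measurableT_comp.
    - move=> s _; rewrite /= -EFinM lee_fin h1// normrM normrM.
      rewrite indicE ger0_norm; last by case: (_ \in _).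
      apply: (@le_trans _ _ (`|a t| * `|g s|)); last by rewrite ler_wpM2r.
      by case: (_ \in _); rewrite ?mul1r ?mul0r// mulr_ge0.
  rewrite integral_cst//= lebesgue_measure_itv/= lte_fin two_pi_gt0 sube0.
  have /fineK <- : (\int[mu]_s `|(g s)%:E|)%E \is a fin_num.
    by rewrite ge0_fin_numE ?integral_ge0//; have /integrableP[] := ig.
  by rewrite -!EFinM ltry.
have := Fubini ih.
have L1 t : t \in I2 -> (\int[mu]_s (EFin \o h) (t, s) = (a t * (f t - f 0))%:E)%E.
  move=> tI; move: (tI); rewrite inE/= in_itv/= => /andP[t0 t2].
  transitivity (\int[mu]_(s in `[0%R, t]) ((a t)%:E * (g s)%:E))%E.
    rewrite [RHS]integral_mkcond; apply: eq_integral => s _; rewrite patchE/= h1// indicE.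
    by case: (s \in _); rewrite ?mul1r ?mul0r.
  have igt : mu.-integrable `[0, t]%classic (EFin \o g) by exact: integrableS ig.
  rewrite integralZl//= (fE _ t0 t2) addrC addKr EFinM /Rintegral fineK//.
  exact: integrable_fin_num.
have L10 t : t \notin I2 -> (\int[mu]_s (EFin \o h) (t, s) = 0)%E.
  by move=> tI; rewrite integral0_eq// => s _; rewrite /= h10.
have L2 s : s \in I2 -> (\int[mu]_t (EFin \o h) (t, s) = ((A (2 * pi) - A s) * g s)%:E)%E.
  move=> sI; move: (sI); rewrite inE/= in_itv/= => /andP[s0 s2].
  transitivity (\int[mu]_(t in `[s, (2 * pi)%R]) ((g s)%:E * (a t)%:E))%E.
    rewrite [RHS]integral_mkcond; apply: eq_integral => t _; rewrite patchE/= h2// indicE.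
    by case: (t \in _); rewrite ?mul1r ?mul0r//= mulrC.
  have ias : mu.-integrable `[s, 2 * pi]%classic (EFin \o a).
    apply: continuous_compact_integrable; first exact: segment_compact.
    exact: continuous_subspaceT.
  rewrite integralZl//= -inta// [in RHS]mulrC EFinM /Rintegral fineK//.
  exact: integrable_fin_num.
have L20 s : s \notin I2 -> (\int[mu]_t (EFin \o h) (t, s) = 0)%E.
  by move=> sI; rewrite integral0_eq// => t _; rewrite /= h20.
have -> : (\int[mu]_x \int[mu]_y (EFin \o h) (x, y) =
    \int[mu]_(t in I2) (a t * (f t - f 0))%:E)%E.
  rewrite [RHS]integral_mkcond; apply: eq_integral => t _; rewrite patchE.
  by case: ifPn => tI; [rewrite L1|rewrite L10].
have -> : (\int[mu]_y \int[mu]_x (EFin \o h) (x, y) =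
    \int[mu]_(t in I2) ((A (2 * pi) - A t) * g t)%:E)%E.
  rewrite [RHS]integral_mkcond; apply: eq_integral => t _; rewrite patchE.
  by case: ifPn => tI; [rewrite L2|rewrite L20].
move=> /(congr1 fine).
have iaf : mu.-integrable I2 (EFin \o (fun t => a t * f t)).
  exact: (integrable_bounded_mul (measurable_funTS ma) aM).
have iac : mu.-integrable I2 (EFin \o (fun t => a t * f 0)).
  by apply: (integrable_bounded_mul (measurable_funTS ma) aM) => //; exact: integrable_cst_itv.
have iAg : mu.-integrable I2 (EFin \o (fun t => A t * g t)).
  exact: (integrable_bounded_mul (measurable_funTS mA) AM).
have icg : mu.-integrable I2 (EFin \o (fun t => A (2 * pi) * g t)).
  by apply: (integrable_bounded_mul (measurable_cst _) (M := `|A (2 * pi)|)).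
have -> : fine (\int[mu]_(t in I2) (a t * (f t - f 0))%:E) =
    Rintegral mu I2 (fun t => a t * f t).
  transitivity (Rintegral mu I2 (fun t => a t * f t - a t * f 0)).
    by apply: eq_Rintegral => t _; rewrite mulrBr.
  rewrite RintegralB// [X in _ - X]RintegralZr//; last exact: integrable_cont_itv.
  by rewrite int0 mul0r subr0.
move=> ->.
transitivity (Rintegral mu I2 (fun t => A (2 * pi) * g t - A t * g t)).
  by apply: eq_Rintegral => t _; rewrite mulrBl.
rewrite RintegralB// RintegralZl//.
(* The integral of g over a period is f(2 pi) - f(0). *)
have -> : Rintegral mu I2 g = 0.
  by have := fE _ (ltW two_pi_gt0) (lexx _); rewrite f2 => /esym/eqP; rewrite -subr_eq0 addrAC subrr add0r => /eqP.
by rewrite mulr0 sub0r.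
Qed.

End parametric.

(** * Periodic integrands and the polar angle *)

Section periodic.
Context {R : realType}.
Local Notation mu := (@lebesgue_measure R).

Lemma ge0_integral_itv_translation (h : R -> \bar R) (a b c : R) :
  measurable_fun setT h -> (forall x, 0 <= h x)%E ->
  (\int[mu]_(x in `[a, b]) h (x + c)%R = \int[mu]_(x in `[(a + c)%R, (b + c)%R]) h x)%E.
Proof.
move=> mh h0; rewrite integral_mkcond [RHS]integral_mkcond.
rewrite -[RHS](@ge0_integral_translation _ _ c).
- apply: eq_integral => x _; rewrite !patchE !mem_setE !in_itv/= !lerD2r.
  by [].
- by apply/(measurable_restrictT _ _).1 => //; exact: measurable_funTS.
- by move=> x; rewrite patchE; case: ifP => // _; exact: h0.
Qed.

Lemma ge0_integral_itv_cat (h : R -> \bar R) (a b c : R) : a <= b -> b <= c ->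
  measurable_fun setT h -> (forall x, 0 <= h x)%E ->
  (\int[mu]_(x in `[a, c]) h x = \int[mu]_(x in `[a, b]) h x + \int[mu]_(x in `[b, c]) h x)%E.
Proof.
move=> ab bc mh h0.
have := @integral_itv_obnd_cbnd R b (BRight c) h (measurable_funTS mh) => /= <-.
rewrite (_ : `[a, c]%classic = `[a, b]%classic `|` `]b, c]%classic); last first.
  by rewrite -itv_bndbnd_setU ?bnd_simp.
rewrite ge0_integral_setU//=; first exact: measurable_funTS.
apply/disj_setPS => x [/=]; rewrite !in_itv/= => /andP[_ xb] /andP[bx _].
by have := le_lt_trans xb bx; rewrite ltxx.
Qed.

(** The shifted interval [- th, T - th] is cut at 0 and its left part moved by one period. *)
Lemma ge0_integral_periodic_shift (h : R -> \bar R) (T th : R) : 0 <= th -> th <= T ->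
  measurable_fun setT h -> (forall x, 0 <= h x)%E -> (forall x, h (x + T) = h x) ->
  (\int[mu]_(x in `[0%R, T]) h (x - th)%R = \int[mu]_(x in `[0%R, T]) h x)%E.
Proof.
move=> th0 thT mh h0 hT; rewrite ge0_integral_itv_translation// sub0r.
rewrite (@ge0_integral_itv_cat _ _ 0) ?oppr_le0 ?subr_ge0//.
rewrite [RHS](@ge0_integral_itv_cat _ _ (T - th)) ?subr_ge0 ?gerBl//.
rewrite addeC; congr (_ + _)%E.
transitivity (\int[mu]_(x in `[(- th)%R, 0%R]) h (x + T)%R)%E.
  by apply: eq_integral => x _; rewrite hT.
by rewrite ge0_integral_itv_translation// add0r addrC.
Qed.

Lemma cos_two_pi : cos (2 * pi) = 1 :> R.
Proof. by rewrite mulr_natl cos2pi. Qed.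

Lemma sin_two_pi : sin (2 * pi) = 0 :> R.
Proof. by rewrite mulr_natl sin2pi. Qed.

(** The angle is acos(x / r) in the upper half-plane and 2 pi minus that in the lower one. *)
Lemma polar_form (x y : R) : exists2 th, 0 <= th <= 2 * pi &
  x = Num.sqrt (x ^+ 2 + y ^+ 2) * cos th /\ y = Num.sqrt (x ^+ 2 + y ^+ 2) * sin th.
Proof.
set r := Num.sqrt _.
have r2 : r ^+ 2 = x ^+ 2 + y ^+ 2 by rewrite sqr_sqrtr// addr_ge0// sqr_ge0.
have r0 : 0 <= r by exact: sqrtr_ge0.
have [r00|rn0] := eqVneq r 0.
  have /eqP : x ^+ 2 + y ^+ 2 = 0 by rewrite -r2 r00 expr0n.
  rewrite paddr_eq0 ?sqr_ge0// !sqrf_eq0 => /andP[/eqP -> /eqP ->].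
  by exists 0; rewrite ?lexx ?mulr_ge0 ?pi_ge0// r00 !mul0r.
have rp : 0 < r by rewrite lt_neqAle eq_sym rn0.
have xr : -1 <= x / r <= 1.
  rewrite -ler_norml -(@ler_pXn2r _ 2) ?nnegrE// real_normK ?num_real// expr1n.
  by rewrite exprMn exprVn ler_pdivrMr ?exprn_gt0// mul1r r2 lerDl sqr_ge0.
have ac0 : 0 <= acos (x / r) by exact: acos_ge0.
have acpi : acos (x / r) <= pi by exact: acos_lepi.
have xE : x = r * cos (acos (x / r)) by rewrite acosK ?in_itv//= mulrC divfK.
have y2 : y ^+ 2 = (r * sin (acos (x / r))) ^+ 2.
  have -> : (r * sin (acos (x / r))) ^+ 2 =
      r ^+ 2 * (cos (acos (x / r)) ^+ 2 + sin (acos (x / r)) ^+ 2) - (r * cos (acos (x / r))) ^+ 2 by ring.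
  by rewrite cos2Dsin2 mulr1 -xE r2 addrC addKr.
have sac : 0 <= r * sin (acos (x / r)).
  by apply: mulr_ge0 => //; apply: sin_ge0_pi; rewrite ac0.
have [y0|y0] := leP 0 y.
  exists (acos (x / r)).
    by rewrite ac0 (le_trans acpi)// ler_peMl ?pi_ge0// ler1n.
  split => //; apply/eqP; rewrite -(@eqrXn2 _ 2)//; exact/eqP.
exists (2 * pi - acos (x / r)).
  by apply/andP; split; have := pi_ge0 R; move: ac0 acpi; lra.
have c2 (u : R) : cos (2 * pi - u) = cos u.
  by rewrite cosB cos_two_pi sin_two_pi mul1r mul0r addr0.
have s2 (u : R) : sin (2 * pi - u) = - sin u.
  by rewrite sinB cos_two_pi sin_two_pi mul1r mul0r sub0r.
rewrite c2 s2; split => //; apply/eqP; rewrite mulrN -eqr_oppLR -(@eqrXn2 _ 2)// ?sqrrN.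
  exact/eqP.
by rewrite oppr_ge0 ltW.
Qed.

End periodic.

Section conjugate_kernel.
Context {R : realType}.
Local Notation mu := (@lebesgue_measure R).
Local Notation I2 := (`[0, 2 * pi]%classic : set R).

(* With z = r e^{i theta}, this is r sin(t - theta) / (pi |e^{it} - z|^2), the
   kernel of r d/dr of the Poisson integral in terms of the derivative. *)
Definition conj_kernel (x y t : R) := (x * sin t - y * cos t) / (pi * pden x y t).

Lemma continuous_pden (x y : R) : continuous (pden x y).
Proof. by move=> t; apply/differentiable_continuous/derivable1_diffP. Qed.

Lemma continuous_conj_kernel (x y : R) : x ^+ 2 + y ^+ 2 < 1 -> continuous (conj_kernel x y).
Proof.
move=> xy t; apply/differentiable_continuous/derivable1_diffP.
have d0 : pi * pden x y t != 0 by rewrite mulf_neq0 ?pi_neq0// gt_eqF// pden_gt0.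
have dn : is_derive t 1 (fun s => x * sin s - y * cos s) (x * cos t + y * sin t).
  by apply: is_derive_eq; rewrite /GRing.scale/=; ring.
have dd : is_derive t 1 (fun s => pi * pden x y s) (pi * (2 * (x * sin t - y * cos t))).
  exact: is_deriveZ _ (is_derive_pden_t x y t).
have := is_derive_div (d := fun s => pi * pden x y s) d0 dn dd => h; exact: ex_derive.
Qed.

(** For z = r the kernel has the sign of sin t and the primitive ln(pden) / (2 pi). As [pden] rises
    from (1 - r)^2 at 0 to (1 + r)^2 at pi and falls back, the mass is twice the increment of the
    primitive over [0, pi]. *)
Lemma integral_abs_conj_kernel_real (r : R) : 0 <= r -> r < 1 ->
  (\int[mu]_(t in I2) `|conj_kernel r 0 t|%:E = (4 * artanh r / pi)%:E)%E.
Proof.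
move=> r0 r1; have rr : r ^+ 2 + 0 ^+ 2 < 1 :> R.
  by rewrite expr0n addr0 expr_lt1.
pose H (t : R) := (2 * pi)^-1 * ln (pden r 0 t).
have dH (t : R) : is_derive t 1 H (conj_kernel r 0 t).
  have dp : 0 < pden r 0 t by exact: pden_gt0.
  have h1 := is_derive_pden_t r 0 t.
  have h2 := is_derive1_ln dp.
  have h3 := is_derive1_comp h2 h1.
  have h4 := is_deriveZ ((2 * pi)^-1) h3.
  apply: (is_derive_eq h4); rewrite /conj_kernel /GRing.scale/=.
  by move: (pi) (@pi_neq0 R) (gt_eqF dp) => p p0 /negbT d0; field; rewrite d0 p0.
have cH (t : R) : H x @[x --> t] --> H t.
  by apply/differentiable_continuous/derivable1_diffP; have := dH t => h; exact: ex_derive.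
have ck := continuous_conj_kernel rr.
have ftc (a b : R) : a < b ->
    (\int[mu]_(t in `[a, b]) (conj_kernel r 0 t)%:E = (H b - H a)%:E)%E.
  move=> ab; rewrite (@continuous_FTC2 _ _ H)// ?EFinB//.
  - exact: continuous_subspaceT.
  - split; first by move=> t _; have := dH t => h; exact: ex_derive.
      by apply: cvg_at_right_filter; exact: cH.
    by apply: cvg_at_left_filter; exact: cH.
  - by move=> t _; rewrite derive1E; have := dH t => h; apply: derive_val.
have mk : measurable_fun setT (fun t => `|conj_kernel r 0 t|%:E%E).
  by apply/measurable_EFinP; apply: measurableT_comp => //; exact: continuous_measurable_fun.
have pip := pi_gt0 R.
rewrite (@ge0_integral_itv_cat _ _ _ pi) ?pi_ge0//; last first.
  by rewrite ler_peMl ?pi_ge0// ler1n.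
have sgn1 t : t \in `[0, pi]%classic -> 0 <= conj_kernel r 0 t.
  rewrite inE/= => /sin_ge0_pi s0; rewrite /conj_kernel mul0r subr0 divr_ge0 ?mulr_ge0//.
    exact: pi_ge0.
  exact/ltW/pden_gt0.
have sgn2 t : t \in `[pi, 2 * pi]%classic -> conj_kernel r 0 t <= 0.
  rewrite inE/= in_itv/= => /andP[t1 t2].
  have s0 : 0 <= sin (t - pi) by apply: sin_ge0_pi; apply/andP; split; lra.
  have -> : conj_kernel r 0 t = - ((r * sin (t - pi)) / (pi * pden r 0 t)).
    by rewrite sinB cospi sinpi /conj_kernel mul0r subr0 mulr0 subr0 mulrN1 mulrN mulNr opprK.
  rewrite oppr_le0 divr_ge0 ?mulr_ge0//.
    exact: pi_ge0.
  exact/ltW/pden_gt0.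
have -> : (\int[mu]_(t in `[0%R, pi]) `|conj_kernel r 0 t|%:E = (H pi - H 0)%:E)%E.
  rewrite -ftc//; apply: eq_integral => t tI; congr (_%:E).
  by rewrite ger0_norm// sgn1.
have -> : (\int[mu]_(t in `[pi, (2 * pi)%R]) `|conj_kernel r 0 t|%:E = (- (H (2 * pi) - H pi))%:E)%E.
  rewrite EFinN -ftc; last by rewrite ltr_pMl// ltr1n.
  have ik : mu.-integrable `[pi, 2 * pi]%classic (EFin \o conj_kernel r 0).
    apply: continuous_compact_integrable; first exact: segment_compact.
    exact: continuous_subspaceT.
  rewrite -mulN1e -integralZl//; apply: eq_integral => t tI.
  by rewrite /= mulN1e -EFinN ler0_norm// sgn2.
have p0 : pden r 0 0 = (1 - r) ^+ 2 by rewrite /pden cos0 sin0; ring.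
have p2 : pden r 0 (2 * pi) = (1 - r) ^+ 2 by rewrite /pden cos_two_pi sin_two_pi; ring.
have pp : pden r 0 pi = (1 + r) ^+ 2 by rewrite /pden cospi sinpi; ring.
have r1' : 0 < 1 - r by rewrite subr_gt0.
have r1'' : 0 < 1 + r by rewrite ltr_wpDr.
rewrite -EFinD /H p0 p2 pp !lnXn// /artanh ln_div//.
congr (_%:E); rewrite -[_ *+ 2]mulr_natl -[_ *+ 2 in X in _ + X]mulr_natl.
by move: (ln _) (ln _) => u v; move: (pi) (@pi_neq0 R) => p pn0; field.
Qed.

Lemma conj_kernel_polar (r th t : R) :
  conj_kernel (r * cos th) (r * sin th) t = conj_kernel r 0 (t - th).
Proof.
rewrite /conj_kernel /pden cosB sinB; congr (_ / (_ * _)); first by ring.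
have -> : (r * cos th) ^+ 2 + (r * sin th) ^+ 2 = r ^+ 2 * (cos th ^+ 2 + sin th ^+ 2) by ring.
by rewrite cos2Dsin2; ring.
Qed.

(** Rotating z to the real axis shifts t, which periodicity absorbs. *)
Lemma integral_abs_conj_kernel (x y : R) : x ^+ 2 + y ^+ 2 < 1 ->
  (\int[mu]_(t in I2) `|conj_kernel x y t|%:E =
   (4 * artanh (Num.sqrt (x ^+ 2 + y ^+ 2)) / pi)%:E)%E.
Proof.
move=> xy; have [th /andP[th0 th2] [xE yE]] := polar_form x y.
set r := Num.sqrt _ in xE yE *.
have r0 : 0 <= r by exact: sqrtr_ge0.
have r1 : r < 1 by rewrite -[ltRHS]sqrtr1 ltr_sqrt.
rewrite -integral_abs_conj_kernel_real//.
rewrite -[RHS](ge0_integral_periodic_shift th0 th2); last 3 first.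
- apply/measurable_EFinP; apply: measurableT_comp => //; apply: continuous_measurable_fun.
  by apply: continuous_conj_kernel; rewrite expr0n addr0 expr_lt1.
- by [].
- move=> t; congr (`|_|%:E); rewrite /conj_kernel /pden.
  by rewrite cosD sinD cos_two_pi sin_two_pi !mulr1 !mulr0 subr0 addr0.
by apply: eq_integral => t _; rewrite -conj_kernel_polar -xE -yE.
Qed.

End conjugate_kernel.

(** * Inequalities *)

Section jensen.
Context {R : realType}.
Local Notation mu := (@lebesgue_measure R).
Local Notation I2 := (`[0, 2 * pi]%classic : set R).

Lemma cmod_ge0 (a b : R) : 0 <= cmod a b. Proof. exact: sqrtr_ge0. Qed.

Lemma cmod_sqr (a b : R) : cmod a b ^+ 2 = a ^+ 2 + b ^+ 2.
Proof. by rewrite sqr_sqrtr// addr_ge0 ?sqr_ge0. Qed.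

Lemma le_dot_cmod (a b c d : R) : a * c + b * d <= cmod a b * cmod c d.
Proof.
apply: le_trans (ler_norm _) _; rewrite -(@ler_pXn2r _ 2) ?nnegrE ?mulr_ge0 ?cmod_ge0//.
rewrite real_normK ?num_real// exprMn !cmod_sqr -subr_ge0.
by rewrite [X in 0 <= X](_ : _ = (a * d - b * c) ^+ 2) ?sqr_ge0//; ring.
Qed.

Lemma cmodD (a b c d : R) : cmod (a + c) (b + d) <= cmod a b + cmod c d.
Proof.
rewrite -(@ler_pXn2r _ 2) ?nnegrE ?addr_ge0 ?cmod_ge0// sqrrD !cmod_sqr.
have := le_dot_cmod a b c d; rewrite -[_ *+ 2]mulr_natl; lra.
Qed.

Lemma cmodZ (c a b : R) : cmod (c * a) (c * b) = `|c| * cmod a b.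
Proof. by rewrite /cmod !exprMn -mulrDr sqrtrM ?sqr_ge0// sqrtr_sqr. Qed.

(** The graph of s^p lies above its tangent at m. This is Young's inequality for s and m^(p-1) with
    exponents p and p / (p - 1); p = 1, which has no finite conjugate, is separate. *)
Lemma powR_tangent (p s m : R) : 1 <= p -> 0 <= s -> 0 < m ->
  m `^ p + p * m `^ (p - 1) * (s - m) <= s `^ p.
Proof.
move=> p1 s0 m0; have p0 : 0 < p by apply: lt_le_trans p1.
have mp : m `^ p = m * m `^ (p - 1).
  by rewrite -{2}(powRr1 (ltW m0)) -powRD ?subrKC// (gt_eqF m0) implybT.
have mp0 : 0 < m `^ (p - 1) by rewrite powR_gt0.
have key : s * m `^ (p - 1) <= s `^ p / p + m `^ p * (1 - p^-1).
  have [->|pn1] := eqVneq p 1; first by rewrite subrr powRr0 mulr1 invr1 subrr mulr0 addr0 mulr1 powRr1.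
  have p1' : 0 < p - 1 by rewrite subr_gt0 lt_neqAle eq_sym pn1.
  have q0 : 0 < p / (p - 1) by rewrite divr_gt0.
  have := @conjugate_powR R s (m `^ (p - 1)) p (p / (p - 1)) s0 (ltW mp0) p0 q0.
  have pq : p^-1 + (p / (p - 1))^-1 = 1 by field; rewrite !gt_eqF.
  move=> /(_ pq) h; apply: le_trans h _; rewrite -powRrM.
  rewrite (_ : (p - 1) * (p / (p - 1)) = p); last by field; rewrite gt_eqF.
  by rewrite (_ : (p / (p - 1))^-1 = 1 - p^-1)//; field; rewrite !gt_eqF.
have : p * (s * m `^ (p - 1)) <= p * (s `^ p / p + m `^ p * (1 - p^-1)) by rewrite ler_pM2l.
have -> : p * (s `^ p / p + m `^ p * (1 - p^-1)) = s `^ p + m `^ p * (p - 1).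
  by field; rewrite gt_eqF.
rewrite mp; move: (m `^ (p - 1)) (s `^ p) => u v; nra.
Qed.

(** Adding the tangent inequalities at the midpoint for a and for b cancels the linear terms. *)
Lemma powR_mid_convex (p a b : R) : 1 <= p -> 0 <= a -> 0 <= b ->
  ((a + b) / 2) `^ p <= (a `^ p + b `^ p) / 2.
Proof.
move=> p1 a0 b0; have : 0 <= (a + b) / 2 by rewrite divr_ge0// addr_ge0.
rewrite le_eqVlt => /orP[/eqP <-|m0].
  by rewrite powR0 ?divr_ge0 ?addr_ge0 ?powR_ge0// gt_eqF// (lt_le_trans _ p1).
have := powR_tangent p1 a0 m0; have := powR_tangent p1 b0 m0.
lra.
Qed.

(** Jensen's inequality for the probability |K| dt / A: the tangent inequality at the mean m = N /
    A, integrated against |K|, gives A m^p = N^p / A^(p-1) as a lower bound. The right-hand side may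
    be infinite. *)
Lemma jensen_kernel (K g1 g2 : R -> R) (p A : R) : 1 <= p -> 0 <= A ->
  continuous K -> mu.-integrable I2 (EFin \o g1) -> mu.-integrable I2 (EFin \o g2) ->
  (\int[mu]_(t in I2) `|K t|%:E = A%:E)%E ->
  ((cmod (Rintegral mu I2 (fun t => K t * g1 t)) (Rintegral mu I2 (fun t => K t * g2 t)) `^ p)%:E <=
   (A `^ (p - 1))%:E * \int[mu]_(t in I2) (`|K t| * cmod (g1 t) (g2 t) `^ p)%:E)%E.
Proof.
move=> p1 A0 cK i1 i2 KA; have p0 : 0 < p by apply: lt_le_trans p1.
have mK : measurable_fun I2 K by apply: measurable_funTS; exact: continuous_measurable_fun.
have mnK : measurable_fun I2 (fun t => `|K t|) by exact: measurableT_comp.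
have [B KB] : exists B, forall t, t \in I2 -> `|K t| <= B.
  have cpt : compact (K @` I2).
    apply: continuous_compact; last exact: segment_compact.
    exact: continuous_subspaceT.
  have [B [Br HB]] := compact_bounded cpt; exists (B + 1) => t; rewrite inE => tI.
  by apply: (HB (B + 1)); [rewrite ltrDl|exists t].
pose K' t := if t \in I2 then K t else 0.
have mg1 : measurable_fun I2 g1 by apply/measurable_EFinP; exact: measurable_int i1.
have mg2 : measurable_fun I2 g2 by apply/measurable_EFinP; exact: measurable_int i2.
pose G t := cmod (g1 t) (g2 t).
have ms : measurable_fun setT (@Num.sqrt R).
  by apply: continuous_measurable_fun; exact: sqrt_continuous.
have mG : measurable_fun I2 G.
  by apply: (measurableT_comp ms); apply: measurable_funD; exact: measurable_funX.
have iabs (g : R -> R) : mu.-integrable I2 (EFin \o g) -> mu.-integrable I2 (EFin \o (fun t => `|g t|)).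
  by move=> ig; exact: integrable_abse ig.
have B0 : 0 <= B.
  apply: le_trans (normr_ge0 (K 0)) (KB 0 _).
  by rewrite inE/= in_itv/= lexx mulr_ge0// pi_ge0.
have iG : mu.-integrable I2 (EFin \o G).
  apply: le_integrable (integrableD _ (iabs _ i1) (iabs _ i2)) => //.
    exact/measurable_EFinP.
  move=> t _; rewrite /= lee_fin (ger0_norm (cmod_ge0 _ _)) ger0_norm ?addr_ge0//.
  have := cmodD (g1 t) 0 0 (g2 t); rewrite addr0 add0r => /le_trans; apply.
  by rewrite /cmod expr0n/= addr0 add0r !sqrtr_sqr.
have iK (g : R -> R) : mu.-integrable I2 (EFin \o g) -> mu.-integrable I2 (EFin \o (fun t => K t * g t)).
  move=> ig; have mg : measurable_fun I2 g by apply/measurable_EFinP; exact: measurable_int ig.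
  apply: le_integrable (integrableZl _ B (iabs _ ig)) => //.
    by apply/measurable_EFinP; exact: measurable_funM.
  move=> t tI; rewrite /= lee_fin !normrM normr_id (ger0_norm B0) ler_wpM2r//.
  by apply: KB; rewrite inE.
have iaK (g : R -> R) : mu.-integrable I2 (EFin \o g) -> mu.-integrable I2 (EFin \o (fun t => `|K t| * g t)).
  move=> ig; have mg : measurable_fun I2 g by apply/measurable_EFinP; exact: measurable_int ig.
  apply: le_integrable (iK _ ig) => //.
    by apply/measurable_EFinP; exact: measurable_funM.
  by move=> t tI; rewrite /= lee_fin !normrM normr_id.
set a := Rintegral mu I2 (fun t => K t * g1 t).
set b := Rintegral mu I2 (fun t => K t * g2 t).
pose N := Rintegral mu I2 (fun t => `|K t| * G t).
have N0 : 0 <= N by apply: Rintegral_ge0 => t _; rewrite mulr_ge0 ?cmod_ge0.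
(* Triangle inequality for a vector integral: a^2 + b^2 is the integral of K (a g1 + b g2), at most
   cmod a b times N by Cauchy-Schwarz, and one factor [cmod a b] cancels. *)
have abN : cmod a b <= N.
  have [ab0|abn0] := eqVneq (cmod a b) 0; first by rewrite ab0.
  have abp : 0 < cmod a b by rewrite lt_neqAle eq_sym abn0 cmod_ge0.
  rewrite -(ler_pM2l abp) -expr2 cmod_sqr /N -RintegralZl//; last exact: iaK.
  have -> : a ^+ 2 + b ^+ 2 = Rintegral mu I2 (fun t => a * (K t * g1 t) + b * (K t * g2 t)).
    rewrite RintegralD//; last 2 first.
    - exact: (integrableZl _ a (iK _ i1)).
    - exact: (integrableZl _ b (iK _ i2)).
    rewrite RintegralZl//; last exact: iK.
    rewrite RintegralZl//; last exact: iK.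
  apply: le_Rintegral => //.
  - apply: (integrableD _ (integrableZl _ a (iK _ i1)) (integrableZl _ b (iK _ i2))) => //.
  - exact: (integrableZl _ (cmod a b) (iaK _ iG)).
  move=> t _; have -> : a * (K t * g1 t) + b * (K t * g2 t) = K t * (a * g1 t + b * g2 t) by ring.
  apply: le_trans (ler_norm _) _; rewrite normrM mulrCA ler_wpM2l//.
  rewrite ler_norml le_dot_cmod andbT lerNl.
  have := le_dot_cmod (- a) (- b) (g1 t) (g2 t).
  by rewrite {1 2}/cmod !sqrrN !mulNr -opprD.
apply: (@le_trans _ _ (N `^ p)%:E).
  by rewrite lee_fin ge0_ler_powR ?nnegrE ?cmod_ge0// ltW.
have intge0 : (0 <= \int[mu]_(t in I2) (`|K t| * G t `^ p)%:E)%E.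
  by apply: integral_ge0 => t _; rewrite lee_fin mulr_ge0 ?powR_ge0.
have [N00|Nn0] := eqVneq N 0.
  by rewrite N00 powR0 ?gt_eqF// mule_ge0// lee_fin powR_ge0.
have Np : 0 < N by rewrite lt_neqAle eq_sym Nn0.
have RA : Rintegral mu I2 (fun t => `|K t|) = A by rewrite /Rintegral KA.
(* If A were 0, K would vanish almost everywhere and N would be 0. *)
have Ap : 0 < A.
  rewrite lt_neqAle A0 andbT; apply/eqP => A00; move: Nn0; rewrite /N.
  have : (\int[mu]_(t in I2) `|K t|%:E = 0)%E by rewrite KA -A00.
  have /(ae_eq_integral_abs mu (measurable_itv _)) : measurable_fun I2 (EFin \o K) by exact/measurable_EFinP.
  move=> H /H K0.
  have E : (\int[mu]_(t in I2) (`|K t| * G t)%:E = \int[mu]_(t in I2) (cst 0 t))%E.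
    apply: ae_eq_integral => //.
      by apply/measurable_EFinP; exact: measurable_funM.
    by apply: filterS K0 => t /= h tI; have := h tI => -[->]; rewrite normr0 mul0r.
  by rewrite /Rintegral E integral0 eqxx.
have [->|/negP/negP] := eqVneq (\int[mu]_(t in I2) (`|K t| * G t `^ p)%:E)%E +oo%E.
  by rewrite gt0_muley ?leey// lte_fin powR_gt0.
rewrite -ltey => Ioo.
have mGp : measurable_fun I2 (fun t => G t `^ p).
  exact: (measurableT_comp (measurable_powR p) mG).
have iKGp : mu.-integrable I2 (EFin \o (fun t => `|K t| * G t `^ p)).
  apply/integrableP; split; first by apply/measurable_EFinP; exact: measurable_funM.
  apply: le_lt_trans Ioo; rewrite le_eqVlt; apply/orP; left; apply/eqP.
  by apply: eq_integral => t _; rewrite /= ger0_norm// mulr_ge0 ?powR_ge0.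
have -> : (\int[mu]_(t in I2) (`|K t| * G t `^ p)%:E)%E =
   (Rintegral mu I2 (fun t => `|K t| * G t `^ p))%:E.
  by rewrite /Rintegral fineK//; exact: integrable_fin_num.
rewrite -EFinM lee_fin.
pose m := N / A; have m0 : 0 < m by rewrite divr_gt0.
have icK : mu.-integrable I2 (EFin \o (fun t => `|K t|)).
  by apply/integrableP; split; [exact/measurable_EFinP|]; under eq_integral do rewrite /= normr_id; rewrite KA ltry.
pose c1 := m `^ p - p * m `^ (p - 1) * m; pose c2 := p * m `^ (p - 1).
have : Rintegral mu I2 (fun t => c1 * `|K t| + c2 * (`|K t| * G t)) <=
    Rintegral mu I2 (fun t => `|K t| * G t `^ p).
  apply: le_Rintegral => //.
    apply: (integrableD _ (integrableZl _ c1 icK) (integrableZl _ c2 (iaK _ iG))) => //.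
  move=> t _; rewrite (_ : _ + _ = `|K t| * (m `^ p + p * m `^ (p - 1) * (G t - m))); last first.
    by rewrite /c1 /c2; ring.
  by rewrite ler_wpM2l// powR_tangent// cmod_ge0.
rewrite RintegralD//; last 2 first.
- exact: (integrableZl _ c1 icK).
- exact: (integrableZl _ c2 (iaK _ iG)).
rewrite !RintegralZl//; last exact: iaK.
rewrite RA -/N.
(* The slope terms cancel because N = m A. *)
have -> : c1 * A + c2 * N = A * m `^ p.
  by rewrite /c1 /c2 /m; field; rewrite gt_eqF.
have -> : A * m `^ p = N `^ p / A `^ (p - 1).
  rewrite /m powRM ?invr_ge0// ?(ltW Ap)// -powR_inv1 ?(ltW Ap)// -powRrM mulN1r powRN.
  rewrite powRB ?(gt_eqF Ap) ?implybT// powRr1 ?(ltW Ap)//.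
  by field; rewrite !gt_eqF// powR_gt0.
by rewrite ler_pdivrMr ?powR_gt0// mulrC.
Qed.

End jensen.

(** * Finiteness of C(p) *)

Section finiteness.
Context {R : realType}.
Local Notation mu := (@lebesgue_measure R).

Lemma measurable_invr : measurable_fun setT (@GRing.inv R).
Proof.
rewrite -(setUv [set (0 : R)]); apply/measurable_funU => //.
  exact: measurableC.
split; first exact: measurable_fun_set1.
apply: open_continuous_measurable_fun.
  exact/closed_openC/accessible_closed_set1/hausdorff_accessible/Rhausdorff.
by move=> x; rewrite inE/= => /eqP x0; exact: inv_continuous.
Qed.

Lemma measurable_artanh : measurable_fun setT (@artanh R).
Proof.
apply: measurable_funM => //; apply: (measurableT_comp (@measurable_ln R)).
apply: measurable_funM; first exact: measurable_funD.
by apply: (measurableT_comp measurable_invr); exact: measurable_funB.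
Qed.

Lemma measurable_Cp_integrand (p : R) :
  measurable_fun setT (fun r : R => (4 * artanh r / (pi * r)) `^ p * r).
Proof.
apply: measurable_funM => //; apply: (measurableT_comp (measurable_powR p)).
apply: measurable_funM; first by apply: measurable_funM => //; exact: measurable_artanh.
by apply: (measurableT_comp measurable_invr); exact: measurable_funM.
Qed.

Lemma artanh_ge0 (r : R) : 0 <= r -> r < 1 -> 0 <= artanh r.
Proof.
move=> r0 r1; rewrite /artanh mulr_ge0// ln_ge0// ler_pdivlMr ?subr_gt0//; lra.
Qed.

(* artanh r = ln s <= s - 1 with s = sqrt ((1 + r) / (1 - r)). *)
Lemma artanh_le (r : R) : 0 <= r -> r < 1 -> artanh r <= 2 * r / Num.sqrt (1 - r).
Proof.
move=> r0 r1; have p1 : 0 < 1 + r by rewrite ltr_wpDr.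
have p2 : 0 < 1 - r by rewrite subr_gt0.
pose a := Num.sqrt (1 + r); pose b := Num.sqrt (1 - r).
have a0 : 0 < a by rewrite sqrtr_gt0.
have b0 : 0 < b by rewrite sqrtr_gt0.
have a2 : a ^+ 2 = 1 + r by rewrite sqr_sqrtr ?ltW.
have b2 : b ^+ 2 = 1 - r by rewrite sqr_sqrtr ?ltW.
have a1 : 1 <= a by rewrite -[leLHS]sqrtr1 ler_wsqrtr// lerDl.
have -> : artanh r = ln (a / b).
  rewrite /artanh -a2 -b2 -expr_div_n lnXn ?divr_gt0//.
  by move: (ln _) => u; field.
apply: (@le_trans _ _ (a / b - 1)).
  have := @le_ln1Dx R (a / b - 1); rewrite subrKC; apply.
  by rewrite ltrBrDl subrr divr_gt0.
rewrite -/b ler_pdivlMr// mulrBl mul1r divfK ?gt_eqF//.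
(* As a + b >= 1, a positive a - b is at most this product. *)
have : (a - b) * (a + b) = 2 * r by rewrite -subr_sqr a2 b2; ring.
have [ab|ab] := leP (a - b) 0; first by move=> _; apply: le_trans ab _; rewrite mulr_ge0.
by move=> <-; rewrite ler_peMr ?(ltW ab)//; apply: ler_wpDr => //; exact: ltW.
Qed.

(** For a < 0 the integrand is unbounded near 0, so the antiderivative is used on [1/(n+1), 1] and n
    tends to infinity. *)
Lemma integral_powR_le (a : R) : - 1 < a ->
  (\int[mu]_(r in `[0%R, 1%R]) (r `^ a)%:E <= ((a + 1)^-1)%:E)%E.
Proof.
move=> a1; have a10 : 0 < a + 1 by rewrite -ltrBlDr sub0r.
have mp : measurable_fun setT (fun r : R => (r `^ a)%:E).
  by apply/measurable_EFinP; exact: measurable_powR.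
pose F (n : nat) : set R := `[n.+1%:R^-1, 1]%classic.
have nF : nondecreasing_seq F.
  move=> m n mn; apply/subsetPset => x; rewrite /F/= !in_itv/= => /andP[mx ->].
  by rewrite andbT; apply: le_trans mx; rewrite lef_pV2 ?posrE// ler_nat.
have UF : \bigcup_n F n = `]0, 1]%classic.
  apply/seteqP; split => x.
    move=> [n _]; rewrite /F/= !in_itv/= => /andP[nx ->]; rewrite andbT.
    by apply: lt_le_trans nx; rewrite invr_gt0.
  rewrite /= in_itv/= => /andP[x0 x1]; exists (Num.bound x^-1) => //.
  rewrite /F/= in_itv/= x1 andbT -[leRHS]invrK lef_pV2 ?posrE ?invr_gt0//.
  apply/ltW; apply: lt_le_trans (archi_boundP _) _; first by rewrite invr_ge0 ltW.
  by rewrite ler_nat.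
have := @integral_itv_obnd_cbnd R 0 (BRight 1) (fun r => (r `^ a)%:E) (measurable_funTS mp) => /= <-.
rewrite -UF.
have cv : (\int[mu]_(x in F n) (x `^ a)%:E @[n --> \oo] --> \int[mu]_(x in \bigcup_i F i) (x `^ a)%:E)%E.
  apply: ge0_nondecreasing_set_cvg_integral => //.
  - by move=> n; exact: measurable_itv.
  - by move=> n; exact: measurable_funTS.
  - by move=> n x _; rewrite lee_fin powR_ge0.
rewrite -(cvg_lim _ cv)//; apply: lime_le; first by apply/cvg_ex; eexists; exact: cv.
near=> n.
pose H (x : R) := (a + 1)^-1 * x `^ (a + 1).
have dH (x : R) : 0 < x -> is_derive x 1 H (x `^ a).
  move=> x0; apply: (is_derive_eq (is_deriveZ ((a + 1)^-1) (is_derive1_powR (a + 1) x0))).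
  by rewrite /GRing.scale/= mulrA mulVf ?mul1r ?addrK// gt_eqF.
have cH (x : R) : 0 < x -> H s @[s --> x] --> H x.
  by move=> x0; apply/differentiable_continuous/derivable1_diffP; have := dH x x0 => h; exact: ex_derive.
have n0 : 0 < n.+1%:R^-1 :> R by rewrite invr_gt0.
have [/eqP n1|n1] := eqVneq (n.+1%:R^-1 : R) 1.
  by rewrite /F (eqP n1) set_itv1 integral_set1 lee_fin invr_ge0 ltW.
have n11 : n.+1%:R^-1 < 1 :> R by rewrite lt_neqAle n1 invf_le1// ler1n.
rewrite /F (@continuous_FTC2 _ _ H)//.
- rewrite -EFinB lee_fin /H powR1 mulr1 gerBl mulr_ge0 ?powR_ge0//.
  by rewrite invr_ge0 ltW.
- apply: derivable_within_continuous => x; rewrite in_itv/= => /andP[nx _].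
  have x0 : 0 < x by apply: lt_le_trans nx.
  by have := is_derive1_powR a x0 => h; exact: ex_derive.
- split.
  + move=> x; rewrite in_itv/= => /andP[nx _].
    by have := dH x (lt_trans n0 nx) => h; exact: ex_derive.
  + by apply: cvg_at_right_filter; exact: cH.
  + by apply: cvg_at_left_filter; exact: cH.
- move=> x; rewrite in_itv/= => /andP[nx _].
  by rewrite derive1E; have := dH x (lt_trans n0 nx) => h; apply: derive_val.
Unshelve. all: by end_near. Qed.

Lemma ge0_integral_onem (f : R -> \bar R) :
  measurable_fun setT f -> (forall x, 0 <= f x)%E ->
  (\int[mu]_(x in `[0%R, 1%R]) f (1 - x)%R = \int[mu]_(x in `[0%R, 1%R]) f x)%E.
Proof.
move=> mf f0.
have mN : measurable_fun setT (-%R : measurableTypeR R -> measurableTypeR R) by [].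
have mf1 : measurable_fun setT (fun x : R => f (x + 1)).
  by apply: (measurableT_comp mf); exact: measurable_funD.
transitivity (\int[mu]_(x in `[(-1)%R, 0%R]) f (x + 1)%R)%E; last first.
  by rewrite ge0_integral_itv_translation// addNr add0r.
rewrite [RHS](@eq_measure_integral _ _ _ _ (pushforward mu (-%R : _ -> measurableTypeR R))); last first.
  by move=> A mA _; apply/esym; exact: lebesgue_measureN.
rewrite (ge0_integral_pushforward mN)//; last exact: measurable_funTS.
have -> : -%R @^-1` `[-1, 0]%classic = `[0, 1]%classic :> set R.
  by apply/seteqP; split => x; rewrite /= !in_itv/= lerN2 oppr_le0 andbC.
by apply: eq_integral => x _ /=; rewrite addrC.
Qed.

(** [artanh_le] bounds the integrand by (8 / pi)^p (1 - r)^(-p/2), where -p/2 > -1. *)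
Lemma Cp_lty (p : R) : 1 <= p -> p < 2 -> (Cp p < +oo)%E.
Proof.
move=> p1 p2; have p0 : 0 < p by apply: lt_le_trans p1.
rewrite /Cp /itv01; pose c : R := (8 / pi) `^ p.
apply: (@le_lt_trans _ _ (c%:E * \int[mu]_(r in `[0%R, 1%R]) ((1 - r) `^ (- (p / 2)))%:E)%E).
  have m1 : measurable_fun setT (fun r : R => (r `^ (- (p / 2)))%:E).
    by apply/measurable_EFinP; exact: measurable_powR.
  have m2 : measurable_fun setT (fun r : R => ((1 - r) `^ (- (p / 2)))%:E).
    by apply: (measurableT_comp m1); exact: measurable_funB.
  rewrite -ge0_integralZl//; last 3 first.
  - exact: measurable_funTS.
  - by move=> r _; rewrite lee_fin powR_ge0.
  - by rewrite lee_fin powR_ge0.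
  apply: ge0_le_integral => //.
  - by move=> r /=; rewrite in_itv/= => /andP[r0 _]; rewrite lee_fin mulr_ge0 ?powR_ge0.
  - apply/measurable_EFinP; apply: measurable_funTS.
    exact: measurable_Cp_integrand.
  - by apply: measurable_funTS; exact: measurable_funeM.
  move=> r /=; rewrite in_itv/= => /andP[r0 r1]; rewrite -EFinM lee_fin.
  (* At r = 1 the conventions 1/0 = 0 and ln 0 = 0 make [artanh] and the integrand vanish. *)
  have [->|rn1] := eqVneq r 1.
    rewrite /artanh subrr invr0 mulr0 ln0// mulr0 mulr0 mul0r powR0 ?gt_eqF// mul0r.
    by rewrite mulr_ge0 ?powR_ge0.
  have rl1 : r < 1 by rewrite lt_neqAle rn1.
  have [->|rn0] := eqVneq r 0; first by rewrite mulr0 mulr_ge0 ?powR_ge0.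
  have rp : 0 < r by rewrite lt_neqAle eq_sym rn0.
  have q : 0 < 1 - r by rewrite subr_gt0.
  have sq : 0 < Num.sqrt (1 - r) by rewrite sqrtr_gt0.
  apply: (@le_trans _ _ ((4 * artanh r / (pi * r)) `^ p)).
    by rewrite ler_piMr ?powR_ge0.
  apply: (@le_trans _ _ ((8 / pi * (Num.sqrt (1 - r))^-1) `^ p)).
    apply: ge0_ler_powR; rewrite ?nnegrE ?(ltW p0)//.
    - by apply: divr_ge0; apply: mulr_ge0 => //; [exact: artanh_ge0|exact: pi_ge0].
    - by rewrite mulr_ge0 ?divr_ge0 ?invr_ge0 ?pi_ge0 ?(ltW sq).
    rewrite ler_pdivrMr ?mulr_gt0 ?pi_gt0//.
    have -> : 8 / pi * (Num.sqrt (1 - r))^-1 * (pi * r) = 4 * (2 * r / Num.sqrt (1 - r)).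
      by move: (pi) (@pi_neq0 R) => u u0; field; rewrite u0 gt_eqF.
    by rewrite ler_pM2l// artanh_le.
  rewrite powRM ?divr_ge0 ?invr_ge0 ?pi_ge0 ?(ltW sq)//.
  rewrite ler_wpM2l ?powR_ge0// -powR12_sqrt ?(ltW q)// -powRN -powRrM.
  by rewrite (_ : - 2^-1 * p = - (p / 2)) ?lexx//; field.
have m1 : measurable_fun setT (fun r : R => (r `^ (- (p / 2)))%:E).
  by apply/measurable_EFinP; exact: measurable_powR.
rewrite (ge0_integral_onem m1); last by move=> x; rewrite lee_fin powR_ge0.
have a1 : -1 < - (p / 2) by rewrite ltrN2 ltr_pdivrMr// mul1r.
apply: (@le_lt_trans _ _ (c%:E * ((- (p / 2) + 1)^-1)%:E)%E).
  by rewrite lee_wpmul2l ?lee_fin ?powR_ge0//; exact: integral_powR_le.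
by rewrite -EFinM ltry.
Qed.

End finiteness.

(** * The gradient of a Poisson integral in terms of the boundary density *)

Section gradient.
Context {R : realType}.
Local Notation mu := (@lebesgue_measure R).
Local Notation I2 := (`[0, 2 * pi]%classic : set R).

Lemma continuous_div (n d : R -> R) : continuous n -> continuous d ->
  (forall t, d t != 0) -> continuous (fun t => n t / d t).
Proof. by move=> cn cd d0 t; apply: cvgM; [exact: cn|apply: cvgV => //; exact: cd]. Qed.

Lemma continuous_poisson_kernel (x y : R) : x ^+ 2 + y ^+ 2 < 1 ->
  continuous (poisson_kernel x y).
Proof.
move=> xy.
have c1 : continuous (fun t : R => (1 - (x ^+ 2 + y ^+ 2)) / pden x y t).
  apply: continuous_div; first by move=> t; exact: cvg_cst.
    exact: continuous_pden.
  by move=> t; rewrite gt_eqF// pden_gt0.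
by move=> t; apply: cvgM; [exact: cvg_cst|exact: c1].
Qed.

Lemma continuous_da (x y : R) : x ^+ 2 + y ^+ 2 < 1 -> continuous (da x y).
Proof.
move=> xy; apply: continuous_div.
- by move=> t; apply/differentiable_continuous/derivable1_diffP.
- by move=> t; apply/differentiable_continuous/derivable1_diffP.
- by move=> t; rewrite mulf_neq0 ?pi_neq0// expf_neq0// gt_eqF// pden_gt0.
Qed.

Lemma continuous_db (x y : R) : x ^+ 2 + y ^+ 2 < 1 -> continuous (db x y).
Proof.
move=> xy; apply: continuous_div.
- by move=> t; apply/differentiable_continuous/derivable1_diffP.
- by move=> t; apply/differentiable_continuous/derivable1_diffP.
- by move=> t; rewrite mulf_neq0 ?pi_neq0// expf_neq0// gt_eqF// pden_gt0.
Qed.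

Lemma continuous_pa (x y : R) : x ^+ 2 + y ^+ 2 < 1 -> continuous (pa x y).
Proof.
move=> xy; apply: continuous_div.
- by move=> t; apply/differentiable_continuous/derivable1_diffP.
- by move=> t; apply/differentiable_continuous/derivable1_diffP.
- by move=> t; rewrite mulf_neq0 ?pi_neq0// gt_eqF// pden_gt0.
Qed.

Lemma continuous_pb (x y : R) : x ^+ 2 + y ^+ 2 < 1 -> continuous (pb x y).
Proof.
move=> xy; apply: continuous_div.
- by move=> t; apply/differentiable_continuous/derivable1_diffP.
- by move=> t; apply/differentiable_continuous/derivable1_diffP.
- by move=> t; rewrite mulf_neq0 ?pi_neq0// gt_eqF// pden_gt0.
Qed.

(** For |z| <= rho the denominators are at least pi e^2, where e = (1 - rho)^2 <= 1 bounds [pden]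
    below. The numerators are at most 6 = 2 + 4, the extreme case being [da] and [db]. *)
Lemma kernel_bounds (rho : R) : 0 <= rho -> rho < 1 -> exists M : R,
  forall x y t : R, x ^+ 2 + y ^+ 2 <= rho ^+ 2 ->
  [/\ `|poisson_kernel x y t| <= M, `|da x y t| <= M, `|db x y t| <= M,
      `|pa x y t| <= M & `|pb x y t| <= M].
Proof.
move=> r0 r1; pose e := (1 - rho) ^+ 2; exists (6 / (pi * e ^+ 2)) => x y t xy.
have xy1 : x ^+ 2 + y ^+ 2 < 1 by apply: le_lt_trans xy _; rewrite expr_lt1.
have pip := pi_gt0 R.
have e0 : 0 < e by rewrite exprn_gt0// subr_gt0.
have e1 : e <= 1 by rewrite /e expr_le1 ?subr_ge0 ?(ltW r1)//; lra.
have D0 : 0 < pden x y t by exact: pden_gt0.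
have eD : e <= pden x y t by apply: pden_ge => //; exact: ltW.
have D4 : pden x y t <= 4 by exact: pden_le.
have nx : `|x| <= 1.
  rewrite -(@ler_pXn2r _ 2) ?nnegrE// real_normK ?num_real// expr1n.
  by apply: le_trans (ltW xy1); rewrite lerDl sqr_ge0.
have ny : `|y| <= 1.
  rewrite -(@ler_pXn2r _ 2) ?nnegrE// real_normK ?num_real// expr1n.
  by apply: le_trans (ltW xy1); rewrite lerDr sqr_ge0.
have nc : `|cos t| <= 1 by rewrite ler_norml cos_geN1 cos_le1.
have ns : `|sin t| <= 1 by rewrite ler_norml sin_geN1 sin_le1.
have n1 : `|1 - (x ^+ 2 + y ^+ 2)| <= 1.
  by rewrite ger0_norm ?subr_ge0 ?(ltW xy1)// gerBl addr_ge0 ?sqr_ge0.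
have b2 (u v : R) : `|u| <= 1 -> `|v| <= 1 -> `|u - v| <= 2.
  move=> hu hv; apply: le_trans (ler_normB _ _) _.
  by rewrite [leRHS](_ : _ = 1 + 1) ?lerD//; lra.
have key (n d : R) : `|n| <= 6 -> pi * e ^+ 2 <= d -> `|n / d| <= 6 / (pi * e ^+ 2).
  move=> n6 dd; have pe : 0 < pi * e ^+ 2 by rewrite mulr_gt0// exprn_gt0.
  have d0 : 0 < d by apply: lt_le_trans dd.
  rewrite normrM normfV (gtr0_norm d0) ler_pM ?invr_ge0 ?(ltW d0)//.
  by rewrite lef_pV2 ?posrE.
have ee : e ^+ 2 <= e by rewrite expr2 ler_piMr// ltW.
have e2D : pi * e ^+ 2 <= pi * pden x y t.
  by rewrite ler_pM2l//; apply: le_trans ee eD.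
have e2D2 : pi * e ^+ 2 <= pi * pden x y t ^+ 2.
  by rewrite ler_pM2l// ler_pXn2r ?nnegrE// ltW.
have b6 (u v : R) : `|u| <= 1 -> `|v| <= 1 -> `|(1 - (x ^+ 2 + y ^+ 2)) * (u - v) - v * pden x y t| <= 6.
  move=> hu hv; apply: le_trans (ler_normB _ _) _; rewrite !normrM (gtr0_norm D0).
  rewrite [leRHS](_ : _ = 1 * 2 + 1 * 4); last by lra.
  by apply: lerD; apply: ler_pM => //; [exact: b2|exact: ltW].
split.
- have -> : poisson_kernel x y t = (1 - (x ^+ 2 + y ^+ 2)) / (2 * pi * pden x y t).
    by rewrite /poisson_kernel -/(pden x y t); move: (pi) (@pi_neq0 R) => q q0; field; rewrite q0 gt_eqF.
  apply: key; first by apply: le_trans n1 _; lra.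
  by apply: le_trans e2D _; rewrite ler_pM2r// ler_peMl ?(ltW pip)// ler1n.
- by apply: key => //; exact: b6.
- by apply: key => //; exact: b6.
- by apply: key => //; apply: le_trans (b2 _ _ ns ny) _; lra.
- by apply: key => //; apply: le_trans (b2 _ _ nx nc) _; lra.
Qed.

Lemma disk_radius (x y : R) : x ^+ 2 + y ^+ 2 < 1 ->
  exists2 rho : R, 0 <= rho < 1 & x ^+ 2 + y ^+ 2 < rho ^+ 2.
Proof.
move=> xy; have q0 : 0 <= x ^+ 2 + y ^+ 2 by rewrite addr_ge0 ?sqr_ge0.
exists (Num.sqrt ((1 + (x ^+ 2 + y ^+ 2)) / 2)).
  by rewrite sqrtr_ge0 -[ltRHS]sqrtr1 ltr_sqrt//; lra.
by rewrite sqr_sqrtr; lra.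
Qed.

Section density.
Variables (f g : R -> R).
Hypothesis intf : mu.-integrable I2 (EFin \o f).
Hypothesis intg : mu.-integrable setT (EFin \o g).
Hypothesis fE : forall t, 0 <= t -> t <= 2 * pi ->
  f t = f 0 + Rintegral mu `[0, t]%classic g.
Hypothesis f2 : f (2 * pi) = f 0.

(** Differentiation under the integral produces [da] against f; integration by parts turns it into
    [pa] against g. *)
Lemma is_derive_poisson_int_x (x y : R) : x ^+ 2 + y ^+ 2 < 1 ->
  is_derive x 1 (poisson_int f ^~ y) (- Rintegral mu I2 (fun t => pa x y t * g t)).
Proof.
move=> xy; have [rho /andP[rho0 rho1] xyr] := disk_radius xy.
have [M bM] := kernel_bounds rho0 rho1.
(* Half the horizontal chord at height y of the disc of radius rho: x varies in ]- w, w[, where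
   [kernel_bounds] is uniform. *)
pose w := Num.sqrt (rho ^+ 2 - y ^+ 2).
have w2 : w ^+ 2 = rho ^+ 2 - y ^+ 2.
  by rewrite sqr_sqrtr// subr_ge0; apply: le_trans (ltW xyr); rewrite lerDr sqr_ge0.
have w0 : 0 <= w by exact: sqrtr_ge0.
have inw s : - w < s -> s < w -> s ^+ 2 + y ^+ 2 <= rho ^+ 2.
  move=> s1 s2; rewrite -lerBrDr -w2 -(real_normK (num_real s)).
  by rewrite ler_pXn2r ?nnegrE// ler_norml !ltW.
have /andP[xw1 xw2] : - w < x < w.
  rewrite -ltr_norml -(@ltr_pXn2r _ 2) ?nnegrE// real_normK ?num_real// w2.
  by rewrite ltrBrDr.
have r21 : rho ^+ 2 < 1 by rewrite expr_lt1.
have D0 s t : - w < s -> s < w -> pden s y t != 0.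
  by move=> s1 s2; rewrite gt_eqF// pden_gt0// (le_lt_trans (inw _ s1 s2)).
have <- : Rintegral mu I2 (fun t => da x y t * f t) = - Rintegral mu I2 (fun t => pa x y t * g t).
  apply: (@integration_by_parts_density R (pa x y) (da x y) f g M).
  - by move=> t; apply: is_derive_pa; exact: D0.
  - exact: continuous_da.
  - by move=> t; have [] := bM x y t (ltW xyr).
  - by move=> t; have [] := bM x y t (ltW xyr).
  - by rewrite /pa /pden cos_two_pi sin_two_pi cos0 sin0.
  - exact: f2.
  - exact: intf.
  - exact: intg.
  - exact: fE.
apply: (@is_derive_parametric R (fun s t => poisson_kernel s y t) (fun s t => da s y t) f x (- w) w M).
- exact: xw1.
- exact: xw2.
- exact: intf.
- by move=> s t s1 s2; apply: is_derive_poisson_x; exact: D0.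
- by move=> s s1 s2; apply: continuous_poisson_kernel; exact: le_lt_trans (inw _ s1 s2) r21.
- by move=> s t s1 s2; have [] := bM s y t (inw _ s1 s2).
- by move=> s t s1 s2; have [] := bM s y t (inw _ s1 s2).
Qed.

Lemma is_derive_poisson_int_y (x y : R) : x ^+ 2 + y ^+ 2 < 1 ->
  is_derive y 1 (poisson_int f x) (- Rintegral mu I2 (fun t => pb x y t * g t)).
Proof.
move=> xy; have [rho /andP[rho0 rho1] xyr] := disk_radius xy.
have [M bM] := kernel_bounds rho0 rho1.
pose w := Num.sqrt (rho ^+ 2 - x ^+ 2).
have w2 : w ^+ 2 = rho ^+ 2 - x ^+ 2.
  by rewrite sqr_sqrtr// subr_ge0; apply: le_trans (ltW xyr); rewrite lerDl sqr_ge0.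
have w0 : 0 <= w by exact: sqrtr_ge0.
have inw s : - w < s -> s < w -> x ^+ 2 + s ^+ 2 <= rho ^+ 2.
  move=> s1 s2; rewrite -lerBrDl -w2 -(real_normK (num_real s)).
  by rewrite ler_pXn2r ?nnegrE// ler_norml !ltW.
have /andP[xw1 xw2] : - w < y < w.
  rewrite -ltr_norml -(@ltr_pXn2r _ 2) ?nnegrE// real_normK ?num_real// w2.
  by rewrite ltrBrDl.
have r21 : rho ^+ 2 < 1 by rewrite expr_lt1.
have D0 s t : - w < s -> s < w -> pden x s t != 0.
  by move=> s1 s2; rewrite gt_eqF// pden_gt0// (le_lt_trans (inw _ s1 s2)).
have <- : Rintegral mu I2 (fun t => db x y t * f t) = - Rintegral mu I2 (fun t => pb x y t * g t).
  apply: (@integration_by_parts_density R (pb x y) (db x y) f g M).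
  - by move=> t; apply: is_derive_pb; exact: D0.
  - exact: continuous_db.
  - by move=> t; have [] := bM x y t (ltW xyr).
  - by move=> t; have [] := bM x y t (ltW xyr).
  - by rewrite /pb /pden cos_two_pi sin_two_pi cos0 sin0.
  - exact: f2.
  - exact: intf.
  - exact: intg.
  - exact: fE.
apply: (@is_derive_parametric R (fun s t => poisson_kernel x s t) (fun s t => db x s t) f y (- w) w M).
- exact: xw1.
- exact: xw2.
- exact: intf.
- by move=> s t s1 s2; apply: is_derive_poisson_y; exact: D0.
- by move=> s s1 s2; apply: continuous_poisson_kernel; exact: le_lt_trans (inw _ s1 s2) r21.
- by move=> s t s1 s2; have [] := bM x s t (inw _ s1 s2).
- by move=> s t s1 s2; have [] := bM x s t (inw _ s1 s2).
Qed.

End density.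

Lemma is_derive0_cst (h : R -> R) (w : R) :
  (forall s : R, - w < s -> s < w -> is_derive s 1 h 0) ->
  forall s : R, - w < s -> s < w -> h s = h 0.
Proof.
move=> dh.
have key (a b : R) : - w < a -> b < w -> a < b -> h a = h b.
  move=> aw bw ab; have d x : x \in `[a, b] -> is_derive x 1 h 0.
    by rewrite in_itv/= => /andP[ax xb]; apply: dh; [exact: lt_le_trans ax|exact: le_lt_trans bw].
  have dM x : x \in `]a, b[ -> is_derive x 1 h ((fun=> 0 : R) x).
    by move=> xab; apply: d; exact: subset_itv_oo_cc.
  have cM : {within `[a, b], continuous h}.
    by apply: derivable_within_continuous => x /d h'; exact: ex_derive.
  have [c _] := MVT ab dM cM.
  by rewrite mul0r => /eqP; rewrite subr_eq0 => /eqP/esym.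
move=> s s1 s2; have w0 : 0 < w by lra.
have [s0|s0|->//] := ltgtP s 0; first by apply: key.
by apply/esym/key => //; rewrite oppr_lt0.
Qed.

(** The boundary function 1 has density 0, so both partial derivatives vanish. Moving horizontally
    to the axis x = 0, then vertically to the origin, reaches the constant kernel 1 / (2 pi). *)
Lemma poisson_int1 (x y : R) : x ^+ 2 + y ^+ 2 < 1 -> poisson_int (cst 1) x y = 1.
Proof.
move=> xy.
have i1 : mu.-integrable I2 (EFin \o cst 1) by exact: integrable_cst_itv.
have i0 : mu.-integrable setT (EFin \o cst 0) by exact: integrable0.
have R0 (D : set R) (h : R -> R) : Rintegral mu D (fun t => h t * cst 0 t) = 0.
  by rewrite /Rintegral integral0_eq// => t _; rewrite /= mulr0.
have E1 (t : R) : 0 <= t -> t <= 2 * pi ->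
    (cst 1 : R -> R) t = (cst 1 : R -> R) 0 + Rintegral mu `[0, t]%classic (cst 0 : R -> R).
  by move=> _ _; rewrite /Rintegral integral0_eq ?addr0.
have y1 : y ^+ 2 < 1 by apply: le_lt_trans xy; rewrite lerDr sqr_ge0.
pose w := Num.sqrt (1 - y ^+ 2).
have w2 : w ^+ 2 = 1 - y ^+ 2 by rewrite sqr_sqrtr// subr_ge0 ltW.
have w0 : 0 <= w by exact: sqrtr_ge0.
have inw s : - w < s -> s < w -> s ^+ 2 + y ^+ 2 < 1.
  move=> s1 s2; rewrite -ltrBrDr -w2 -(real_normK (num_real s)).
  by rewrite ltr_pXn2r ?nnegrE// ltr_norml s1.
have /andP[xw1 xw2] : - w < x < w.
  rewrite -ltr_norml -(@ltr_pXn2r _ 2) ?nnegrE// real_normK ?num_real// w2.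
  by rewrite ltrBrDr.
have -> : poisson_int (cst 1) x y = poisson_int (cst 1) 0 y.
  have dh (s : R) : - w < s -> s < w -> is_derive s 1 (poisson_int (cst 1) ^~ y) 0.
    move=> s1 s2; have := is_derive_poisson_int_x i1 i0 E1 erefl (inw _ s1 s2) => h.
    by apply: (is_derive_eq h); rewrite R0 oppr0.
  exact: (is_derive0_cst dh xw1 xw2).
have /andP[yw1 yw2] : - 1 < y < 1.
  by rewrite -ltr_norml -(@ltr_pXn2r _ 2) ?nnegrE// real_normK ?num_real// expr1n.
have -> : poisson_int (cst 1) 0 y = poisson_int (cst 1) 0 0.
  have dh (s : R) : - 1 < s -> s < 1 -> is_derive s 1 (poisson_int (cst 1) 0) 0.
  move=> s1 s2.
  have s1' : 0 ^+ 2 + s ^+ 2 < 1 :> R.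
    rewrite expr0n add0r -(real_normK (num_real s)) expr_lt1//.
    by rewrite ltr_norml s1.
  have := is_derive_poisson_int_y i1 i0 E1 erefl s1' => h.
  by apply: (is_derive_eq h); rewrite R0 oppr0.
  exact: (is_derive0_cst dh yw1 yw2).
rewrite /poisson_int (_ : (fun t => _) = cst (2 * pi)^-1); last first.
  by apply/funext => t; rewrite /poisson_kernel !mul0r expr0n/= !addr0 !subr0 mulr0 subr0 divr1 !mulr1.
have muI : fine (mu I2) = 2 * pi by rewrite lebesgue_measure_itv/= lte_fin two_pi_gt0 sube0.
transitivity ((2 * pi)^-1 * fine (mu I2)); first exact: Rintegral_cst.
by rewrite muI mulVf// gt_eqF// two_pi_gt0.
Qed.

End gradient.

(** * Integration over the disk *)

Section weighted_average.
Context {R : realType}.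
Local Notation mu := (@lebesgue_measure R).
Local Notation I2 := (`[0, 2 * pi]%classic : set R).
Local Notation rho := (fun z : R * R => Num.sqrt (z.1 ^+ 2 + z.2 ^+ 2)).

(* [integral] is a supremum over simple functions, so monotonicity needs no
   measurability. *)
Lemma ge0_le_integral_nonmeasurable d (T : measurableType d)
    (m : {measure set T -> \bar R}) (D : set T) (f1 f2 : T -> \bar R) :
  (forall x, D x -> 0 <= f1 x)%E -> (forall x, D x -> f1 x <= f2 x)%E ->
  (\int[m]_(x in D) f1 x <= \int[m]_(x in D) f2 x)%E.
Proof.
move=> f10 f12; rewrite !ge0_integralE//; last first.
  by move=> x Dx; apply: le_trans (f10 x Dx) (f12 x Dx).
apply: le_ereal_sup => _ [h hf1 <-]; exists h => // x.
apply: le_trans (hf1 x) _; rewrite !patchE; case: ifPn => // /set_mem Dx.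
exact: f12.
Qed.

Lemma sigma_finite_leb2 : sigma_finite setT (@leb2 R).
Proof.
exists (fun n : nat => zdisc (n.+1%:R : R)).
  apply/esym; rewrite -subTset => z _.
  have z0 : 0 <= z.1 ^+ 2 + z.2 ^+ 2 by rewrite addr_ge0 ?sqr_ge0.
  exists (Num.bound (z.1 ^+ 2 + z.2 ^+ 2)) => //; rewrite /zdisc/=.
  apply: lt_le_trans (archi_boundP z0) _; rewrite -natrX ler_nat.
  by apply: leq_trans (leqnSn _) _; rewrite leq_pmulr.
move=> n; split; first exact: measurable_zdisc.
by rewrite disc_area ?ltry.
Qed.

(** Area as a packaged sigma-finite measure, for Tonelli on (R * R) * R. *)
Definition leb2_sigma_finite :
    {sigma_finite_measure set (measurableTypeR R * measurableTypeR R)%type -> \bar R} :=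
  HB.pack (mu \x mu)%E (Measure_isSigmaFinite.Build _ _ _ (mu \x mu)%E sigma_finite_leb2).

Lemma indic_nneg T (D : set T) (x : T) : 0 <= \1_D x :> R.
Proof. by rewrite indicE ler0n. Qed.

Lemma rho_rotation (t : R) (z : R * R) :
  rho (cos t * z.1 + sin t * z.2, cos t * z.2 - sin t * z.1) = rho z.
Proof.
congr Num.sqrt => /=.
transitivity ((cos t ^+ 2 + sin t ^+ 2) * (z.1 ^+ 2 + z.2 ^+ 2)); first by ring.
by rewrite cos2Dsin2 mul1r.
Qed.

(* For a kernel that depends only on the position of z relative to e^{it},
   the z-integral against a radial weight does not depend on t. *)
Lemma radial_kernel_average (k : (R * R) * R -> R) (phi : R -> R) :
  measurable_fun setT k -> measurable_fun setT phi ->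
  (forall z t, 0 <= k (z, t)) -> (forall r, 0 <= phi r) ->
  (forall (z : R * R) t,
     k ((cos t * z.1 + sin t * z.2, cos t * z.2 - sin t * z.1), 0) = k (z, t)) ->
  exists J : \bar R, forall H : R -> R, measurable_fun setT H -> (forall t, 0 <= H t) ->
   (\int[leb2]_(z in unit_disk) ((phi (rho z))%:E * \int[mu]_(t in I2) (k (z, t) * H t)%:E) =
    J * \int[mu]_(t in I2) (H t)%:E)%E.
Proof.
move=> mk mphi k0 phi0 kR.
pose K0 (z : R * R) : R := \1_unit_disk z * (phi (rho z) * k (z, 0)).
exists (\int[leb2]_z (K0 z)%:E)%E => H mH H0.
have mrho : measurable_fun setT rho := measurable_rho.
have mphirho : measurable_fun setT (fun z => phi (rho z)) by exact: (measurableT_comp mphi mrho).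
have m1D : measurable_fun setT (\1_(@unit_disk R) : R * R -> R).
  exact: (measurable_indic (@measurable_unit_disk R)).
have mK0 : measurable_fun setT K0.
  apply: measurable_funM => //; apply: measurable_funM => //.
  by apply: (measurableT_comp mk); exact: measurable_fun_pair.
have K00 z : 0 <= K0 z by rewrite mulr_ge0 ?indic_nneg// mulr_ge0.
(* Indicators extend the integrand by 0, so that Tonelli is used on the whole space. *)
pose h (w : (R * R) * R) : R :=
  \1_unit_disk w.1 * (phi (rho w.1) * (k w * (\1_I2 w.2 * H w.2))).
have mh : measurable_fun setT h.
  apply: measurable_funM; first exact: (measurableT_comp m1D measurable_fst).
  apply: measurable_funM; first exact: (measurableT_comp mphirho measurable_fst).
  apply: measurable_funM => //.
  apply: measurable_funM; last exact: (measurableT_comp mH measurable_snd).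
  have m1I : measurable_fun setT (\1_I2 : R -> R) by exact: measurable_indic.
  exact: (measurableT_comp m1I measurable_snd).
have h0 w : 0 <= h w.
  case: w => z t; rewrite /h; apply: mulr_ge0; first exact: indic_nneg.
  apply: mulr_ge0 => //; apply: mulr_ge0; first exact: k0.
  by apply: mulr_ge0 => //; exact: indic_nneg.
transitivity (\int[leb2]_z \int[mu]_t (h (z, t))%:E)%E.
  rewrite integral_mkcond; apply: eq_integral => z _; rewrite patchE.
  case: ifPn => zD; last first.
    rewrite integral0_eq// => t _; rewrite /h/= indicE (negbTE zD) mul0r//.
  rewrite integral_mkcond -ge0_integralZl//=; last 3 first.
  - apply/(measurable_restrictT _ _).1 => //; apply: measurable_funTS.
    apply/measurable_EFinP; apply: measurable_funM => //.
    by apply: (measurableT_comp mk); exact: measurable_fun_pair.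
  - by move=> t _; rewrite patchE; case: ifP => // _; rewrite lee_fin mulr_ge0.
  - by rewrite lee_fin.
  apply: eq_integral => t _; rewrite patchE /h/= !indicE zD mul1r.
  by case: ifPn => _; rewrite ?mul1r ?mul0r ?mulr0 ?mule0// -EFinM.
rewrite (fubini_tonelli (m1 := leb2_sigma_finite) (m2 := mu) (fun w => (h w)%:E))//; last first.
  exact/measurable_EFinP.
rewrite [X in (_ * X)%E]integral_mkcond -ge0_integralZl//; last 3 first.
- apply/(measurable_restrictT _ _).1 => //; apply: measurable_funTS.
  exact/measurable_EFinP.
- by move=> t _; rewrite patchE; case: ifP => // _; rewrite lee_fin.
- by apply: integral_ge0 => z _; rewrite lee_fin.
apply: eq_integral => t _; rewrite patchE; case: ifPn => tI; last first.
  by rewrite mule0 integral0_eq// => z _; rewrite /h/= [\1_I2 t]indicE (negbTE tI) mul0r !mulr0.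
have cs : cos t ^+ 2 + (- sin t) ^+ 2 = 1 by rewrite sqrrN cos2Dsin2.
(* The rotation by - t carries e^{it} to 1, so [K0] at the rotated point is the integrand for the
   boundary point e^{it}. *)
rewrite -(@ge0_integral_rotation R (fun z => (K0 z)%:E) (cos t) (- sin t) cs); last 2 first.
- exact/measurable_EFinP.
- by move=> z; rewrite lee_fin.
rewrite muleC -ge0_integralZl//; last 3 first.
- apply/measurable_EFinP; apply: (measurableT_comp mK0).
  by apply: measurable_fun_pair => /=; [apply: measurable_funB|apply: measurable_funD];
    exact: measurable_funM.
- by move=> z _; rewrite lee_fin.
- by rewrite lee_fin.
apply: eq_integral => z _; rewrite -EFinM; congr (_%:E).
have -> : (cos t * z.1 - - sin t * z.2, - sin t * z.1 + cos t * z.2) =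
   (cos t * z.1 + sin t * z.2, cos t * z.2 - sin t * z.1).
  by congr (_, _); ring.
rewrite /K0 /h kR rho_rotation/= [\1_I2 t]indicE tI mul1r.
have -> : \1_unit_disk (cos t * z.1 + sin t * z.2, cos t * z.2 - sin t * z.1) =
    \1_unit_disk z :> R.
  rewrite !indicE; congr ((nat_of_bool _)%:R).
  have E : (cos t * z.1 + sin t * z.2) ^+ 2 + (cos t * z.2 - sin t * z.1) ^+ 2 = z.1 ^+ 2 + z.2 ^+ 2.
    transitivity ((cos t ^+ 2 + sin t ^+ 2) * (z.1 ^+ 2 + z.2 ^+ 2)); first by ring.
    by rewrite cos2Dsin2 mul1r.
  by apply/idP/idP; rewrite !inE /unit_disk/= E.
by ring.
Qed.

Lemma measurable_weighted_average (k : (R * R) * R -> R) (phi H : R -> R) :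
  measurable_fun setT k -> measurable_fun setT phi -> measurable_fun setT H ->
  (forall z t, 0 <= k (z, t)) -> (forall t, 0 <= H t) ->
  measurable_fun setT (fun z : R * R =>
    (phi (rho z))%:E * \int[mu]_(t in I2) (k (z, t) * H t)%:E)%E.
Proof.
move=> mk mphi mH k0 H0; apply: emeasurable_funM.
  apply/measurable_EFinP; exact: (measurableT_comp mphi measurable_rho).
pose h (w : (R * R) * R) : R := k w * (\1_I2 w.2 * H w.2).
have mh : measurable_fun setT h.
  apply: measurable_funM => //.
  apply: measurable_funM; last exact: (measurableT_comp mH measurable_snd).
  have m1I : measurable_fun setT (\1_I2 : R -> R) by exact: measurable_indic.
  exact: (measurableT_comp m1I measurable_snd).
have -> : (fun z => \int[mu]_(t in I2) (k (z, t) * H t)%:E)%E = fubini_F mu (EFin \o h).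
  apply/funext => z; rewrite integral_mkcond /fubini_F; apply: eq_integral => t _.
  by rewrite patchE /h/= indicE; case: ifPn => _; rewrite ?mul1r ?mul0r ?mulr0.
have mEh : measurable_fun setT (EFin \o h) by exact/measurable_EFinP.
refine (measurable_fun_fubini_tonelli_F (m2 := mu) _ mEh _) => -[z t].
by rewrite lee_fin mulr_ge0// mulr_ge0// indic_nneg.
Qed.

(* The constant of radial_kernel_average is evaluated at H = 1. *)
Lemma radial_kernel_bound (k : (R * R) * R -> R) (phi m : R -> R) (c : \bar R) :
  measurable_fun setT k -> measurable_fun setT phi -> measurable_fun setT m ->
  (forall z t, 0 <= k (z, t)) -> (forall r, 0 <= phi r) -> (forall r, 0 <= m r) ->
  (forall (z : R * R) t,
     k ((cos t * z.1 + sin t * z.2, cos t * z.2 - sin t * z.1), 0) = k (z, t)) ->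
  (forall z, unit_disk z -> \int[mu]_(t in I2) (k (z, t))%:E = (m (rho z))%:E)%E ->
  (\int[mu]_(r in `[0%R, 1%R]) (phi r * m r * r)%:E <= c)%E ->
  forall H : R -> R, measurable_fun setT H -> (forall t, 0 <= H t) ->
   (\int[leb2]_(z in unit_disk) ((phi (rho z))%:E * \int[mu]_(t in I2) (k (z, t) * H t)%:E) <=
    c * \int[mu]_(t in I2) (H t)%:E)%E.
Proof.
move=> mk mphi mm k0 phi0 m0 kR km cE H mH H0.
have [J JE] := radial_kernel_average mk mphi k0 phi0 kR.
rewrite JE//; apply: lee_wpmul2r; first by apply: integral_ge0 => t _; rewrite lee_fin.
have pip := @two_pi_gt0 R.
have := JE (cst 1) (measurable_cst _) (fun=> ler01).
have -> : (\int[mu]_(t in I2) (cst 1 t)%:E = (2 * pi)%:E)%E.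
  have muI : mu I2 = (2 * pi)%:E by rewrite lebesgue_measure_itv/= lte_fin pip sube0.
  by rewrite -[RHS]mul1e -muI -[RHS](integral_cst mu (measurable_itv _)).
move=> J2.
(* J is compared with c after multiplication by 2 pi, the integral of H = 1; [integral_radial]
   supplies the same factor. *)
rewrite -(lee_pmul2r (_ : (2 * pi)%:E \is a fin_num) (_ : 0 < (2 * pi)%:E)%E)//.
rewrite -J2.
have -> : (\int[leb2]_(z in unit_disk) ((phi (rho z))%:E * \int[mu]_(t in I2) (k (z, t) * 1)%:E) =
    \int[leb2]_(z in unit_disk) (phi (rho z) * m (rho z))%:E)%E.
  apply: eq_integral => z /set_mem zD; rewrite EFinM -km//; congr (_ * _)%E.
  by apply: eq_integral => t _; rewrite mulr1.
rewrite (@integral_radial R (fun r => (phi r * m r)%:E)); last 2 first.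
- by apply/measurable_EFinP; exact: measurable_funM.
- by move=> r; rewrite lee_fin mulr_ge0.
apply: (@le_trans _ _ ((2 * pi)%:E * \int[mu]_(r in `[0%R, 1%R]) (phi r * m r * r)%:E)%E).
  rewrite -ge0_integralZl//=; last 3 first.
  - apply: measurable_funTS; apply/measurable_EFinP; apply: measurable_funM => //.
    exact: measurable_funM.
  - by move=> r; rewrite in_itv/= => /andP[r0 _]; rewrite lee_fin !mulr_ge0.
  - by rewrite lee_fin ltW.
  rewrite le_eqVlt; apply/orP; left; apply/eqP; apply: eq_integral => r _.
  by rewrite -!EFinM; congr (_%:E); ring.
by rewrite muleC lee_wpmul2r// lee_fin ltW.
Qed.

End weighted_average.

(** * The pointwise bound on the gradient *)

Section pointwise.
Context {R : realType}.
Local Notation mu := (@lebesgue_measure R).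
Local Notation I2 := (`[0, 2 * pi]%classic : set R).
Local Notation rho := (fun z : R * R => Num.sqrt (z.1 ^+ 2 + z.2 ^+ 2)).

Lemma cmod_mul (x y c d : R) :
  Num.sqrt (x ^+ 2 + y ^+ 2) * cmod c d = cmod (c * x - d * y) (c * y + d * x).
Proof.
rewrite /cmod -sqrtrM ?addr_ge0 ?sqr_ge0//; congr Num.sqrt; ring.
Qed.

Lemma powR_inv (a q : R) : 0 <= a -> a^-1 `^ q = a `^ (- q).
Proof. by move=> a0; rewrite -[a^-1]powR_inv1// -powRrM mulN1r. Qed.

Lemma cmodN (a b : R) : cmod (- a) (- b) = cmod a b.
Proof. by rewrite /cmod !sqrrN. Qed.

Lemma cmodC (a b : R) : cmod a b = cmod b a.
Proof. by rewrite /cmod addrC. Qed.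

Lemma cmodNr (a b : R) : cmod a (- b) = cmod a b.
Proof. by rewrite /cmod sqrrN. Qed.

Lemma cmod_half (a b : R) : cmod (a / 2) (b / 2) = cmod a b / 2.
Proof. by rewrite ![_ / 2]mulrC cmodZ ger0_norm. Qed.

(* 2 z w_z = z (w_x - i w_y) = r w_r - i w_theta, and similarly for the
   conjugate of w_zbar. *)
Lemma cmod_wz_le (x y a1 b1 a2 b2 : R) :
  Num.sqrt (x ^+ 2 + y ^+ 2) * cmod ((- a1 + - b2) / 2) ((- a2 - - b1) / 2) <=
    (cmod (x * a1 + y * b1) (x * a2 + y * b2) +
     cmod (y * a1 - x * b1) (y * a2 - x * b2)) / 2.
Proof.
set S1 := x * a1 + _; set S2 := x * a2 + _.
set T1 := y * a1 - _; set T2 := y * a2 - _; rewrite cmod_mul.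
have -> : (- a1 + - b2) / 2 * x - (- a2 - - b1) / 2 * y = (- S1 + T2) / 2.
  by rewrite /S1 /T2; lra.
have -> : (- a1 + - b2) / 2 * y + (- a2 - - b1) / 2 * x = (- S2 + - T1) / 2.
  by rewrite /S2 /T1; lra.
rewrite cmod_half ler_pM2r// (le_trans (cmodD _ _ _ _))//.
by rewrite cmodN cmodNr lerD2l cmodC.
Qed.

Lemma cmod_wzbar_le (x y a1 b1 a2 b2 : R) :
  Num.sqrt (x ^+ 2 + y ^+ 2) * cmod ((- a1 - - b2) / 2) (- ((- a2 + - b1) / 2)) <=
    (cmod (x * a1 + y * b1) (x * a2 + y * b2) +
     cmod (y * a1 - x * b1) (y * a2 - x * b2)) / 2.
Proof.
set S1 := x * a1 + _; set S2 := x * a2 + _.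
set T1 := y * a1 - _; set T2 := y * a2 - _; rewrite cmod_mul.
have -> : (- a1 - - b2) / 2 * x - - ((- a2 + - b1) / 2) * y = (- S1 + - T2) / 2.
  by rewrite /S1 /T2; lra.
have -> : (- a1 - - b2) / 2 * y + - ((- a2 + - b1) / 2) * x = (S2 + - T1) / 2.
  by rewrite /S2 /T1; lra.
rewrite cmod_half ler_pM2r// (le_trans (cmodD _ _ _ _))//.
by rewrite cmodN [cmod T2 T1]cmodC lerD2r /cmod sqrrN.
Qed.

(** The mass A of the conjugate kernel; the absolute value makes it nonnegative for every real r, as
    [radial_kernel_bound] asks. *)
Definition circle_mass (r : R) : R := `|4 * artanh r / pi|.

(** The factor 1/2 comes from convexity, r^(-p) from dividing by r^p, and A^(p-1) from Jensen's
    inequality; for the Poisson kernel, of mass 1, the last factor is 1. *)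
Definition weight_conj (p r : R) : R := 2^-1 * (r `^ (- p) * circle_mass r `^ (p - 1)).

Definition weight_poisson (p r : R) : R := 2^-1 * r `^ (- p).

Definition abs_conj_kernel (w : (R * R) * R) : R := `|conj_kernel w.1.1 w.1.2 w.2|.

Definition abs_poisson_kernel (w : (R * R) * R) : R := `|poisson_kernel w.1.1 w.1.2 w.2|.

Lemma conj_kernelE (x y t : R) : conj_kernel x y t = x * pa x y t + y * pb x y t.
Proof. by rewrite /conj_kernel /pa /pb; ring. Qed.

(** The kernel of w_theta is the Poisson kernel up to the constant 1 / (2 pi), which integrates to 0
    against a density of mean 0. *)
Lemma poisson_kernelE (x y t : R) : x ^+ 2 + y ^+ 2 < 1 ->
  poisson_kernel x y t - (2 * pi)^-1 = y * pa x y t - x * pb x y t.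
Proof.
move=> xy; have d0 : pden x y t != 0 by rewrite gt_eqF// pden_gt0.
rewrite /poisson_kernel -/(pden x y t) /pa /pb.
have -> : 1 - (x ^+ 2 + y ^+ 2) =
    2 - pden x y t - 2 * (x * cos t + y * sin t) by rewrite /pden; ring.
have -> : y * ((sin t - y) / (pi * pden x y t)) - x * ((x - cos t) / (pi * pden x y t)) =
    (x * cos t + y * sin t - (x ^+ 2 + y ^+ 2)) / (pi * pden x y t) by ring.
have -> : x ^+ 2 + y ^+ 2 = pden x y t - 1 + 2 * (x * cos t + y * sin t) by rewrite /pden; ring.
move: d0; move: (pden x y t) => D D0; move: (pi) (@pi_neq0 R) => q q0.
by field; rewrite D0 q0.
Qed.

Lemma poisson_kernel_ge0 (x y t : R) : x ^+ 2 + y ^+ 2 < 1 -> 0 <= poisson_kernel x y t.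
Proof.
move=> xy; apply: mulr_ge0; first by rewrite invr_ge0 ltW// two_pi_gt0.
by apply: divr_ge0; [rewrite subr_ge0 ltW|exact/ltW/pden_gt0].
Qed.

Section derivatives.
Variables (f1 f2 g1 g2 : R -> R) (p : R).
Hypotheses (p1 : 1 <= p).
Hypotheses (if1 : mu.-integrable I2 (EFin \o f1)) (if2 : mu.-integrable I2 (EFin \o f2)).
Hypotheses (ig1 : mu.-integrable setT (EFin \o g1)) (ig2 : mu.-integrable setT (EFin \o g2)).
Hypothesis f1E : forall t, 0 <= t -> t <= 2 * pi ->
  f1 t = f1 0 + Rintegral mu `[0, t]%classic g1.
Hypothesis f2E : forall t, 0 <= t -> t <= 2 * pi ->
  f2 t = f2 0 + Rintegral mu `[0, t]%classic g2.
Hypotheses (f12 : f1 (2 * pi) = f1 0) (f22 : f2 (2 * pi) = f2 0).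

(** For w = P[f] the partial derivatives are w_x = - a and w_y = - b, so the two combinations are -
    r w_r and w_theta. *)
Lemma kernel_combination (f g : R -> R) (x y : R) : x ^+ 2 + y ^+ 2 < 1 ->
  mu.-integrable setT (EFin \o g) ->
  (forall t, 0 <= t -> t <= 2 * pi -> f t = f 0 + Rintegral mu `[0, t]%classic g) ->
  f (2 * pi) = f 0 ->
  let a := Rintegral mu I2 (fun t => pa x y t * g t) in
  let b := Rintegral mu I2 (fun t => pb x y t * g t) in
  x * a + y * b = Rintegral mu I2 (fun t => conj_kernel x y t * g t) /\
  y * a - x * b = Rintegral mu I2 (fun t => poisson_kernel x y t * g t).
Proof.
move=> xy ig fE fpi a b.
have [rho0 /andP[r0 r1] xyr] := disk_radius xy.
have [M bM] := kernel_bounds r0 r1.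
have ig' : mu.-integrable I2 (EFin \o g) by exact: integrableS ig.
have mc (h : R -> R) : continuous h -> measurable_fun I2 h.
  by move=> ch; apply: measurable_funTS; exact: continuous_measurable_fun.
have bnd (h : R -> R) (c : R) : mu.-integrable I2 (EFin \o h) -> mu.-integrable I2 (EFin \o (fun t => c * h t)).
  move=> ih; rewrite (_ : _ \o _ = fun t => (c%:E * (EFin \o h) t)%E); last by apply/funext.
  exact: integrableZl.
have ipa : mu.-integrable I2 (EFin \o (fun t => pa x y t * g t)).
  apply: (@integrable_bounded_mul R (pa x y) g M (mc _ (continuous_pa xy)) _ ig') => t.
  by have [] := bM x y t (ltW xyr).
have ipb : mu.-integrable I2 (EFin \o (fun t => pb x y t * g t)).
  apply: (@integrable_bounded_mul R (pb x y) g M (mc _ (continuous_pb xy)) _ ig') => t.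
  by have [] := bM x y t (ltW xyr).
have iP : mu.-integrable I2 (EFin \o (fun t => poisson_kernel x y t * g t)).
  apply: (@integrable_bounded_mul R (poisson_kernel x y) g M (mc _ (continuous_poisson_kernel xy)) _ ig') => t.
  by have [] := bM x y t (ltW xyr).
have Rg0 : Rintegral mu I2 g = 0.
  have := fE _ (ltW (two_pi_gt0 (R := R))) (lexx _); rewrite fpi => /esym/eqP.
  by rewrite -subr_eq0 addrAC subrr add0r => /eqP.
split.
  rewrite /a /b -RintegralZl// -RintegralZl// -RintegralD//; [|exact: bnd|exact: bnd].
  by apply: eq_Rintegral => t _; rewrite conj_kernelE; ring.
transitivity (Rintegral mu I2 (fun t => poisson_kernel x y t * g t - (2 * pi)^-1 * g t)).
  rewrite /a /b -RintegralZl// -RintegralZl// -RintegralB//; [|exact: bnd|exact: bnd].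
  by apply: eq_Rintegral => t _; rewrite -mulrBl poisson_kernelE//; ring.
by rewrite RintegralB//; [rewrite [X in _ - X]RintegralZl// Rg0 mulr0 subr0|exact: bnd].
Qed.

Lemma integral_abs_poisson_kernel (x y : R) : x ^+ 2 + y ^+ 2 < 1 ->
  (\int[mu]_(t in I2) `|poisson_kernel x y t|%:E = 1)%E.
Proof.
move=> xy.
have iP : mu.-integrable I2 (EFin \o (fun t => poisson_kernel x y t)).
  by apply: integrable_cont_itv; exact: continuous_poisson_kernel.
transitivity (\int[mu]_(t in I2) (poisson_kernel x y t)%:E)%E.
  by apply: eq_integral => t _; rewrite ger0_norm// poisson_kernel_ge0.
have iPf : (\int[mu]_(t in I2) (poisson_kernel x y t)%:E)%E \is a fin_num.
  exact: integrable_fin_num.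
rewrite -(fineK iPf).
rewrite -[RHS](congr1 EFin (poisson_int1 xy)); congr (_%:E).
by apply: eq_Rintegral => t _; rewrite mulr1.
Qed.

Local Notation H := (fun t => cmod (g1 t) (g2 t) `^ p).

(** W stands for |w_z| or |w_zbar|, which satisfy the same inequality r W <= (S + T) / 2; midpoint
    convexity separates S from T, and Jensen's inequality treats each. *)
Lemma gradient_bound (x y W : R) : x ^+ 2 + y ^+ 2 < 1 -> Num.sqrt (x ^+ 2 + y ^+ 2) != 0 ->
  0 <= W ->
  (forall a1 b1 a2 b2 : R,
   a1 = Rintegral mu I2 (fun t => pa x y t * g1 t) ->
   b1 = Rintegral mu I2 (fun t => pb x y t * g1 t) ->
   a2 = Rintegral mu I2 (fun t => pa x y t * g2 t) ->
   b2 = Rintegral mu I2 (fun t => pb x y t * g2 t) ->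
   Num.sqrt (x ^+ 2 + y ^+ 2) * W <=
    (cmod (x * a1 + y * b1) (x * a2 + y * b2) +
     cmod (y * a1 - x * b1) (y * a2 - x * b2)) / 2) ->
  ((W `^ p)%:E <=
   (weight_conj p (rho (x, y)))%:E *
      \int[mu]_(t in I2) (abs_conj_kernel ((x, y), t) * H t)%:E +
   (weight_poisson p (rho (x, y)))%:E *
      \int[mu]_(t in I2) (abs_poisson_kernel ((x, y), t) * H t)%:E)%E.
Proof.
move=> xy + W0 /=; set r := Num.sqrt (x ^+ 2 + y ^+ 2) => rn0.
have r0 : 0 < r by rewrite lt_neqAle eq_sym rn0 sqrtr_ge0.
have r1 : r < 1 by rewrite -[ltRHS]sqrtr1 ltr_sqrt.
have p0 : 0 < p by apply: lt_le_trans p1.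
move=> /(_ _ _ _ _ erefl erefl erefl erefl).
have [-> ->] := kernel_combination xy ig1 f1E f12.
have [-> ->] := kernel_combination xy ig2 f2E f22.
set S := cmod _ _; set T := cmod _ _ => hW.
have ig1' : mu.-integrable I2 (EFin \o g1) by exact: integrableS ig1.
have ig2' : mu.-integrable I2 (EFin \o g2) by exact: integrableS ig2.
have A0 : 0 <= circle_mass r by exact: normr_ge0.
have JS := @jensen_kernel R (conj_kernel x y) g1 g2 p (circle_mass r) p1 A0
  (continuous_conj_kernel xy) ig1' ig2'.
have JT := @jensen_kernel R (poisson_kernel x y) g1 g2 p 1 p1 ler01
  (continuous_poisson_kernel xy) ig1' ig2' (integral_abs_poisson_kernel xy).
have {}JS : ((S `^ p)%:E <= (circle_mass r `^ (p - 1))%:E *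
    \int[mu]_(t in I2) (abs_conj_kernel ((x, y), t) * H t)%:E)%E.
  apply: JS; rewrite integral_abs_conj_kernel// -/r /circle_mass ger0_norm//.
  by rewrite divr_ge0 ?pi_ge0// mulr_ge0// artanh_ge0// ltW.
rewrite powR1 mul1e in JT.
have rp0 : 0 <= r `^ (- p) by exact: powR_ge0.
have S0 : 0 <= S by exact: cmod_ge0.
have T0 : 0 <= T by exact: cmod_ge0.
apply: (@le_trans _ _ ((2^-1 * (r `^ (- p)))%:E * ((S `^ p)%:E + (T `^ p)%:E))%E).
  rewrite -EFinD -EFinM lee_fin.
  have WE : W <= r^-1 * ((S + T) / 2).
    by rewrite ler_pdivlMl.
  apply: (@le_trans _ _ ((r^-1 * ((S + T) / 2)) `^ p)).
    apply: ge0_ler_powR; rewrite ?nnegrE ?(ltW p0)//.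
    by rewrite mulr_ge0 ?invr_ge0 ?(ltW r0)// divr_ge0// addr_ge0.
  rewrite powRM ?invr_ge0 ?(ltW r0)//; last by rewrite divr_ge0// addr_ge0.
  rewrite powR_inv ?(ltW r0)// [2^-1 * _]mulrC -mulrA ler_wpM2l//.
  by rewrite [2^-1 * _]mulrC powR_mid_convex.
rewrite ge0_muleDr ?lee_fin ?powR_ge0//; apply: leeD.
  have -> : weight_conj p r = 2^-1 * r `^ (- p) * circle_mass r `^ (p - 1).
    by rewrite /weight_conj mulrA.
  by rewrite [X in (_ <= X * _)%E]EFinM -muleA lee_wpmul2l// lee_fin mulr_ge0.
by rewrite lee_wpmul2l// lee_fin mulr_ge0.
Qed.

Local Notation u := (poisson_int f1).
Local Notation v := (poisson_int f2).

Lemma abs_wz_bound (x y : R) : x ^+ 2 + y ^+ 2 < 1 -> Num.sqrt (x ^+ 2 + y ^+ 2) != 0 ->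
  ((`|abs_wz u v x y| `^ p)%:E <=
   (weight_conj p (rho (x, y)))%:E *
      \int[mu]_(t in I2) (abs_conj_kernel ((x, y), t) * H t)%:E +
   (weight_poisson p (rho (x, y)))%:E *
      \int[mu]_(t in I2) (abs_poisson_kernel ((x, y), t) * H t)%:E)%E.
Proof.
move=> xy r0; rewrite ger0_norm; last exact: cmod_ge0.
apply: gradient_bound => //; first exact: cmod_ge0.
rewrite /abs_wz /dx /dy !derive1E.
have d1 := is_derive_poisson_int_x if1 ig1 f1E f12 xy.
have d2 := is_derive_poisson_int_y if1 ig1 f1E f12 xy.
have d3 := is_derive_poisson_int_x if2 ig2 f2E f22 xy.
have d4 := is_derive_poisson_int_y if2 ig2 f2E f22 xy.
rewrite (@derive_val _ _ _ _ _ _ _ d1) (@derive_val _ _ _ _ _ _ _ d2).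
rewrite (@derive_val _ _ _ _ _ _ _ d3) (@derive_val _ _ _ _ _ _ _ d4).
by move=> a1 b1 a2 b2 <- <- <- <-; exact: cmod_wz_le.
Qed.

Lemma abs_conj_wzbar_bound (x y : R) :
  x ^+ 2 + y ^+ 2 < 1 -> Num.sqrt (x ^+ 2 + y ^+ 2) != 0 ->
  ((`|abs_conj_wzbar u v x y| `^ p)%:E <=
   (weight_conj p (rho (x, y)))%:E *
      \int[mu]_(t in I2) (abs_conj_kernel ((x, y), t) * H t)%:E +
   (weight_poisson p (rho (x, y)))%:E *
      \int[mu]_(t in I2) (abs_poisson_kernel ((x, y), t) * H t)%:E)%E.
Proof.
move=> xy r0; rewrite ger0_norm; last exact: cmod_ge0.
apply: gradient_bound => //; first exact: cmod_ge0.
rewrite /abs_conj_wzbar /dx /dy !derive1E.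
have d1 := is_derive_poisson_int_x if1 ig1 f1E f12 xy.
have d2 := is_derive_poisson_int_y if1 ig1 f1E f12 xy.
have d3 := is_derive_poisson_int_x if2 ig2 f2E f22 xy.
have d4 := is_derive_poisson_int_y if2 ig2 f2E f22 xy.
rewrite (@derive_val _ _ _ _ _ _ _ d1) (@derive_val _ _ _ _ _ _ _ d2).
rewrite (@derive_val _ _ _ _ _ _ _ d3) (@derive_val _ _ _ _ _ _ _ d4).
by move=> a1 b1 a2 b2 <- <- <- <-; exact: cmod_wzbar_le.
Qed.

End derivatives.
End pointwise.

(** * Integration of the pointwise bound *)

Section disk_norm.
Context {R : realType}.
Local Notation mu := (@lebesgue_measure R).
Local Notation I2 := (`[0, 2 * pi]%classic : set R).
Local Notation rho := (fun z : R * R => Num.sqrt (z.1 ^+ 2 + z.2 ^+ 2)).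

Lemma measurable_circle_mass : measurable_fun setT (@circle_mass R).
Proof.
apply: measurableT_comp => //; apply: measurable_funM => //.
by apply: measurable_funM => //; exact: measurable_artanh.
Qed.

Lemma measurable_weight_conj (p : R) : measurable_fun setT (weight_conj p).
Proof.
apply: measurable_funM => //; apply: measurable_funM; first exact: measurable_powR.
exact: (measurableT_comp (measurable_powR (p - 1)) measurable_circle_mass).
Qed.

Lemma measurable_weight_poisson (p : R) : measurable_fun setT (weight_poisson p).
Proof. by apply: measurable_funM => //; exact: measurable_powR. Qed.

Lemma weight_conj_ge0 (p r : R) : 0 <= weight_conj p r.
Proof. by rewrite mulr_ge0 ?mulr_ge0 ?powR_ge0. Qed.

Lemma weight_poisson_ge0 (p r : R) : 0 <= weight_poisson p r.
Proof. by rewrite mulr_ge0 ?powR_ge0. Qed.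

Lemma measurable_fst1 : measurable_fun setT (fun w : (R * R) * R => w.1.1).
Proof. exact: (measurableT_comp measurable_fst measurable_fst). Qed.

Lemma measurable_fst2 : measurable_fun setT (fun w : (R * R) * R => w.1.2).
Proof. exact: (measurableT_comp measurable_snd measurable_fst). Qed.

Lemma measurable_sin_snd : measurable_fun setT (fun w : (R * R) * R => sin w.2).
Proof.
have ms : measurable_fun setT (@sin R).
  by apply: continuous_measurable_fun; exact: continuous_sin.
exact: (measurableT_comp ms measurable_snd).
Qed.

Lemma measurable_cos_snd : measurable_fun setT (fun w : (R * R) * R => cos w.2).
Proof.
have ms : measurable_fun setT (@cos R).
  by apply: continuous_measurable_fun; exact: continuous_cos.
exact: (measurableT_comp ms measurable_snd).
Qed.

Lemma measurable_normsqr : measurable_fun setT (fun w : (R * R) * R => w.1.1 ^+ 2 + w.1.2 ^+ 2).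
Proof.
by apply: measurable_funD; apply: measurable_funX; [exact: measurable_fst1|exact: measurable_fst2].
Qed.

Lemma measurable_pden : measurable_fun setT (fun w : (R * R) * R => pden w.1.1 w.1.2 w.2).
Proof.
apply: measurable_funD; last exact: measurable_normsqr.
apply: measurable_funB => //; apply: measurable_funM => //.
apply: measurable_funD; apply: measurable_funM.
- exact: measurable_fst1.
- exact: measurable_cos_snd.
- exact: measurable_fst2.
- exact: measurable_sin_snd.
Qed.

Lemma measurable_abs_conj_kernel : measurable_fun setT (@abs_conj_kernel R).
Proof.
apply: measurableT_comp => //; apply: measurable_funM.
  apply: measurable_funB; apply: measurable_funM.
  - exact: measurable_fst1.
  - exact: measurable_sin_snd.
  - exact: measurable_fst2.
  - exact: measurable_cos_snd.
apply: (measurableT_comp measurable_invr); apply: measurable_funM => //.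
exact: measurable_pden.
Qed.

Lemma measurable_abs_poisson_kernel : measurable_fun setT (@abs_poisson_kernel R).
Proof.
apply: measurableT_comp => //; apply: measurable_funM => //; apply: measurable_funM.
  by apply: measurable_funB => //; exact: measurable_normsqr.
exact: (measurableT_comp measurable_invr measurable_pden).
Qed.

Lemma pden_rotation (x y t : R) :
  pden (cos t * x + sin t * y) (cos t * y - sin t * x) 0 = pden x y t.
Proof.
rewrite /pden cos0 sin0.
have -> : (cos t * x + sin t * y) ^+ 2 + (cos t * y - sin t * x) ^+ 2 =
  (cos t ^+ 2 + sin t ^+ 2) * (x ^+ 2 + y ^+ 2) by ring.
by rewrite cos2Dsin2; ring.
Qed.

Lemma abs_conj_kernel_rotation (z : R * R) (t : R) :
  abs_conj_kernel ((cos t * z.1 + sin t * z.2, cos t * z.2 - sin t * z.1), 0) =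
  abs_conj_kernel (z, t).
Proof.
rewrite /abs_conj_kernel /conj_kernel/= pden_rotation cos0 sin0.
by congr (`|_ / _|); ring.
Qed.

Lemma abs_poisson_kernel_rotation (z : R * R) (t : R) :
  abs_poisson_kernel ((cos t * z.1 + sin t * z.2, cos t * z.2 - sin t * z.1), 0) =
  abs_poisson_kernel (z, t).
Proof.
rewrite /abs_poisson_kernel /poisson_kernel/= -!/(pden _ _ _) pden_rotation.
have -> : (cos t * z.1 + sin t * z.2) ^+ 2 + (cos t * z.2 - sin t * z.1) ^+ 2 =
  (cos t ^+ 2 + sin t ^+ 2) * (z.1 ^+ 2 + z.2 ^+ 2) by ring.
by rewrite cos2Dsin2 mul1r.
Qed.

Lemma artanh1 : artanh 1 = 0 :> R.
Proof. by rewrite /artanh subrr invr0 mulr0 ln0// mulr0. Qed.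

(** The mass A supplies the missing power: r^(-p) A^(p-1) A = (A / r)^p, the integrand of C(p). *)
Lemma weight_conj_integral (p : R) : 1 <= p ->
  (\int[mu]_(r in `[0%R, 1%R]) (weight_conj p r * circle_mass r * r)%:E <= 2^-1%:E * Cp p)%E.
Proof.
move=> p1; have p0 : 0 < p by apply: lt_le_trans p1.
have mC := measurable_Cp_integrand p.
rewrite /Cp /itv01 -ge0_integralZl//; last 2 first.
- by apply: measurable_funTS; exact/measurable_EFinP.
- by move=> r; rewrite /= in_itv/= => /andP[r0 _]; rewrite lee_fin mulr_ge0 ?powR_ge0.
apply: ge0_le_integral => //.
- move=> r; rewrite /= in_itv/= => /andP[r0 _].
  by rewrite lee_fin; apply: mulr_ge0 => //; apply: mulr_ge0;
    [exact: weight_conj_ge0|exact: normr_ge0].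
- apply: measurable_funTS; apply/measurable_EFinP; apply: measurable_funM => //.
  by apply: measurable_funM; [exact: measurable_weight_conj|exact: measurable_circle_mass].
- by apply: measurable_funTS; apply: measurable_funeM; exact/measurable_EFinP.
move=> r; rewrite /= in_itv/= => /andP[r0 r1]; rewrite -EFinM lee_fin.
have [->|rn0] := eqVneq r 0; first by rewrite !mulr0.
have rp : 0 < r by rewrite lt_neqAle eq_sym rn0.
have at0 : 0 <= artanh r.
  (* At the endpoint r = 1 [artanh] takes its default value 0. *)
  move: r1; rewrite le_eqVlt => /orP[/eqP->|r1]; first by rewrite artanh1.
  exact: artanh_ge0.
have A0 : 0 <= 4 * artanh r / pi by rewrite divr_ge0 ?pi_ge0// mulr_ge0.
have E : r `^ (- p) * (4 * artanh r / pi) `^ (p - 1) * (4 * artanh r / pi) =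
    (4 * artanh r / (pi * r)) `^ p.
  have -> : 4 * artanh r / (pi * r) = r^-1 * (4 * artanh r / pi).
    by move: (pi) (@pi_neq0 R) => q q0; field; rewrite q0 rn0.
  move: (4 * artanh r / pi) A0 => A A0.
  rewrite [RHS]powRM ?invr_ge0// powR_inv// -mulrA; congr (_ * _).
  by rewrite -{2}[A]powRr1// -powRD ?subrK// gt_eqF.
by rewrite /weight_conj /circle_mass ger0_norm// -E !mulrA.
Qed.

Lemma weight_poisson_integral (p : R) : p < 2 ->
  (\int[mu]_(r in `[0%R, 1%R]) (weight_poisson p r * 1 * r)%:E <= (2^-1 * (2 - p)^-1)%:E)%E.
Proof.
move=> p2; have p1 : -1 < 1 - p by lra.
have m1 : measurable_fun setT (fun r : R => r `^ (1 - p)) by exact: measurable_powR.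
apply: (@le_trans _ _ (2^-1%:E * \int[mu]_(r in `[0%R, 1%R]) (r `^ (1 - p))%:E)%E); last first.
  rewrite EFinM lee_wpmul2l ?lee_fin//.
  by have := integral_powR_le p1; rewrite (_ : 1 - p + 1 = 2 - p)//; ring.
rewrite -ge0_integralZl//; last 2 first.
- by apply: measurable_funTS; exact/measurable_EFinP.
- by move=> r _; rewrite lee_fin powR_ge0.
apply: ge0_le_integral => //.
- move=> r; rewrite /= in_itv/= => /andP[r0 _].
  by rewrite lee_fin mulr1 mulr_ge0// weight_poisson_ge0.
- apply: measurable_funTS; apply/measurable_EFinP; apply: measurable_funM => //.
  by apply: measurable_funM => //; exact: measurable_weight_poisson.
- by apply: measurable_funTS; apply: measurable_funeM; exact/measurable_EFinP.
move=> r; rewrite /= in_itv/= => /andP[r0 r1]; rewrite -EFinM lee_fin mulr1.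
have [->|rn0] := eqVneq r 0; first by rewrite mulr0 mulr_ge0 ?powR_ge0.
rewrite /weight_poisson -mulrA ler_pM2l// le_eqVlt; apply/orP; left; apply/eqP.
by rewrite -{2}[r]powRr1// -powRD ?rn0 ?implybT// addrC.
Qed.

Lemma leb2_origin : leb2 [set (0 : R, 0 : R)] = 0%E.
Proof.
rewrite (_ : [set _] = [set 0] `*` [set 0]); last first.
  by apply/seteqP; split => -[x y] /= [-> ->].
transitivity (mu [set (0%R : R)] * mu [set (0%R : R)])%E.
  exact: (product_measure1E mu mu (measurable_set1 0) (measurable_set1 0)).
by rewrite lebesgue_measure_set1 mul0e.
Qed.

(** The bound on W is known off the origin; the term [N], supported on that null point, extends it
    to the whole disk. Measurability is established for the majorant hQ + hP + N and not for W. *)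
Lemma disk_integral_bound (p : R) (W : R -> R -> R) (H : R -> R) : 1 <= p -> p < 2 ->
  measurable_fun setT H -> (forall t, 0 <= H t) ->
  (forall x y : R, x ^+ 2 + y ^+ 2 < 1 -> Num.sqrt (x ^+ 2 + y ^+ 2) != 0 ->
   ((`|W x y| `^ p)%:E <=
   (weight_conj p (rho (x, y)))%:E *
      \int[mu]_(t in I2) (abs_conj_kernel ((x, y), t) * H t)%:E +
   (weight_poisson p (rho (x, y)))%:E *
      \int[mu]_(t in I2) (abs_poisson_kernel ((x, y), t) * H t)%:E)%E) ->
  (\int[leb2]_(z in unit_disk) (`|W z.1 z.2| `^ p)%:E <=
   (2^-1%:E * (Cp p + ((2 - p)^-1)%:E)) * \int[mu]_(t in I2) (H t)%:E)%E.
Proof.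
move=> p1 p2 mH H0 hW.
pose hQ (z : R * R) := ((weight_conj p (rho z))%:E *
      \int[mu]_(t in I2) (abs_conj_kernel (z, t) * H t)%:E)%E.
pose hP (z : R * R) := ((weight_poisson p (rho z))%:E *
      \int[mu]_(t in I2) (abs_poisson_kernel (z, t) * H t)%:E)%E.
have kQ0 z t : 0 <= abs_conj_kernel (z, t) :> R by exact: normr_ge0.
have kP0 z t : 0 <= abs_poisson_kernel (z, t) :> R by exact: normr_ge0.
have mQ : measurable_fun setT hQ.
  by apply: measurable_weighted_average => //;
    [exact: measurable_abs_conj_kernel|exact: measurable_weight_conj].
have mP : measurable_fun setT hP.
  by apply: measurable_weighted_average => //;
    [exact: measurable_abs_poisson_kernel|exact: measurable_weight_poisson].
have hQ0 z : (0 <= hQ z)%E.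
  apply: mule_ge0; first by rewrite lee_fin weight_conj_ge0.
  by apply: integral_ge0 => t _; rewrite lee_fin mulr_ge0.
have hP0 z : (0 <= hP z)%E.
  apply: mule_ge0; first by rewrite lee_fin weight_poisson_ge0.
  by apply: integral_ge0 => t _; rewrite lee_fin mulr_ge0.
have mD : measurable (unit_disk : set (R * R)) by exact: measurable_unit_disk.
pose c := `|W 0 0| `^ p; have c0 : 0 <= c by exact: powR_ge0.
have m0 : measurable [set (0 : R, 0 : R)].
  rewrite (_ : [set _] = [set 0] `*` [set 0]); last first.
    by apply/seteqP; split => -[x y] /= [-> ->].
  exact: measurableX.
pose N (z : R * R) : \bar R := (c%:E * (\1_[set (0 : R, 0 : R)] z)%:E)%E.
have mN : measurable_fun setT N.
  by apply: measurable_funeM; apply/measurable_EFinP; exact: measurable_indic.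
have N0 z : (0 <= N z)%E by rewrite mule_ge0// lee_fin// indic_nneg.
apply: (@le_trans _ _ (\int[leb2]_(z in unit_disk) (hQ z + hP z + N z))%E).
  apply: ge0_le_integral_nonmeasurable; first by move=> z _; rewrite lee_fin powR_ge0.
  move=> [x y] xy /=; have [r0|r0] := eqVneq (Num.sqrt (x ^+ 2 + y ^+ 2)) 0.
    have /eqP : x ^+ 2 + y ^+ 2 = 0.
      apply/eqP; rewrite eq_le addr_ge0 ?sqr_ge0// andbT.
      by rewrite -sqrtr_eq0 r0.
    rewrite paddr_eq0 ?sqr_ge0// !sqrf_eq0 => /andP[/eqP x0 /eqP y0].
    rewrite x0 y0 -/c; apply: (@le_trans _ _ (N (0, 0))).
      by rewrite /N indicE mem_set// mule1.
    by rewrite leeDr// adde_ge0.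
  apply: le_trans (hW x y xy r0) _.
  by rewrite -/(hQ (x, y)) -/(hP (x, y)) leeDl.
rewrite ge0_integralD//; last 3 first.
- by move=> z _; rewrite adde_ge0.
- by apply: measurable_funTS; exact: emeasurable_funD.
- exact: measurable_funTS.
have -> : (\int[leb2]_(z in unit_disk) N z = 0)%E.
  have mI0 : measurable_fun setT (fun z : R * R => (\1_[set (0 : R, 0 : R)] z : R)%:E).
    by apply/measurable_EFinP; exact: measurable_indic.
  have mI : measurable_fun (@unit_disk R) (fun z : R * R => (\1_[set (0 : R, 0 : R)] z : R)%:E).
    exact: measurable_funTS mI0.
  have I0 (z : R * R) : unit_disk z -> (0 <= ((\1_[set (0 : R, 0 : R)] z)%R : R)%:E)%E.
    by move=> _; rewrite lee_fin indic_nneg.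
  have cE0 : (0 <= c%:E)%E by rewrite lee_fin.
  have EZ := ge0_integralZl leb2 mD mI I0 cE0.
  have n0 : leb2 ([set (0 : R, 0 : R)] `&` unit_disk) = 0%E.
    apply/eqP; rewrite eq_le measure_ge0 andbT -leb2_origin.
    by apply: le_measure; rewrite ?inE//; exact: measurableI.
  by rewrite [LHS]EZ integral_indic// [X in (_ * X)%E]n0 mule0.
rewrite adde0 ge0_integralD//; [|exact: measurable_funTS|exact: measurable_funTS].
have C0 : (0 <= Cp p)%E.
  by apply: integral_ge0 => r; rewrite /itv01/= in_itv/= => /andP[r0 _]; rewrite lee_fin mulr_ge0 ?powR_ge0.
have IH0 : (0 <= \int[mu]_(t in I2) (H t)%:E)%E by apply: integral_ge0 => t _; rewrite lee_fin.
have i20 : (0 <= ((2 - p)^-1)%:E)%E by rewrite lee_fin invr_ge0 subr_ge0 ltW.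
have h0 : (0 <= (2^-1)%:E :> \bar R)%E by rewrite lee_fin.
rewrite (ge0_muleDr _ C0 i20) (ge0_muleDl _ (mule_ge0 h0 C0) (mule_ge0 h0 i20)) -EFinM.
apply: leeD.
- apply: (@radial_kernel_bound R (@abs_conj_kernel R) (weight_conj p) (@circle_mass R)) => //.
  + exact: measurable_abs_conj_kernel.
  + exact: measurable_weight_conj.
  + exact: measurable_circle_mass.
  + exact: weight_conj_ge0.
  + by move=> r; exact: normr_ge0.
  + exact: abs_conj_kernel_rotation.
  + move=> [x y] xy; rewrite /abs_conj_kernel/= integral_abs_conj_kernel//.
    rewrite /circle_mass ger0_norm// divr_ge0 ?pi_ge0// mulr_ge0// artanh_ge0 ?sqrtr_ge0//.
    by rewrite -[ltRHS]sqrtr1 ltr_sqrt.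
  + exact: weight_conj_integral.
- apply: (@radial_kernel_bound R (@abs_poisson_kernel R) (weight_poisson p) (cst 1)) => //.
  + exact: measurable_abs_poisson_kernel.
  + exact: measurable_weight_poisson.
  + exact: weight_poisson_ge0.
  + exact: abs_poisson_kernel_rotation.
  + by move=> [x y] xy; rewrite /abs_poisson_kernel/= integral_abs_poisson_kernel.
  + exact: weight_poisson_integral.
Qed.

Lemma LpD_bound (p : R) (W : R -> R -> R) (G : R -> R) : 1 <= p -> p < 2 ->
  measurable_fun setT G -> (forall t, 0 <= G t) ->
  (forall x y : R, x ^+ 2 + y ^+ 2 < 1 -> Num.sqrt (x ^+ 2 + y ^+ 2) != 0 ->
   ((`|W x y| `^ p)%:E <=
   (weight_conj p (rho (x, y)))%:E *
      \int[mu]_(t in I2) (abs_conj_kernel ((x, y), t) * G t `^ p)%:E +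
   (weight_poisson p (rho (x, y)))%:E *
      \int[mu]_(t in I2) (abs_poisson_kernel ((x, y), t) * G t `^ p)%:E)%E) ->
  (LpD p W <= ((Cp p + ((2 - p)^-1)%R%:E) `^ (p^-1)%R) * LpT p G)%E.
Proof.
move=> p1 p2 mG G0 hW; have p0 : 0 < p by apply: lt_le_trans p1.
have mGp : measurable_fun setT (fun t => G t `^ p).
  exact: (measurableT_comp (measurable_powR p) mG).
have C0 : (0 <= Cp p)%E.
  by apply: integral_ge0 => r; rewrite /itv01/= in_itv/= => /andP[r0 _]; rewrite lee_fin mulr_ge0 ?powR_ge0.
have K0 : (0 <= Cp p + ((2 - p)^-1)%:E)%E.
  by rewrite adde_ge0// lee_fin invr_ge0 subr_ge0 ltW.
have IG0 : (0 <= \int[mu]_(t in I2) (G t `^ p)%:E)%E.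
  by apply: integral_ge0 => t _; rewrite lee_fin powR_ge0.
have ID0 : (0 <= \int[leb2]_(z in unit_disk) (`|W z.1 z.2| `^ p)%:E)%E.
  by apply: integral_ge0 => t _; rewrite lee_fin powR_ge0.
have pi2 : 0 <= (2 * pi)^-1 :> R by rewrite invr_ge0 ltW// two_pi_gt0.
have absG : (\int[mu]_(t in I2) (`|G t| `^ p)%:E = \int[mu]_(t in I2) (G t `^ p)%:E)%E.
  by apply: eq_integral => t _; rewrite (ger0_norm (G0 t)).
rewrite /LpD /LpT /itv02pi absG -poweRM//; last by rewrite mule_ge0 ?lee_fin.
apply: gt0_ler_poweR.
- by rewrite invr_ge0 ltW.
- by rewrite in_itv/= leey andbT mule_ge0// lee_fin invr_ge0 pi_ge0.
- by rewrite in_itv/= leey andbT !mule_ge0// lee_fin.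
have := disk_integral_bound p1 p2 mGp (fun t => powR_ge0 _ _) hW.
move=> /(lee_wpmul2l (_ : 0 <= (pi^-1)%:E)%E) h; apply: le_trans (h _) _.
  by rewrite lee_fin invr_ge0 pi_ge0.
rewrite le_eqVlt; apply/orP; left; apply/eqP.
(* The constants match: 1 / pi times 1/2 is 1 / (2 pi). *)
rewrite [RHS]muleCA !muleA -EFinM; congr (_%:E * _ * _)%E.
by move: (pi) (@pi_neq0 R) => q q0; field.
Qed.

End disk_norm.

(** * From densities back to the derivative of the boundary function *)

(** The endpoints 0 and 2 pi, where [derive1] depends on values outside the interval, are discarded
    as null sets. *)
Lemma ae_derivative_modulus (R : realType) (f1 f2 g1 g2 : R -> R) (p : R) :
  {ae @lebesgue_measure R, forall t, 0 < t -> t < 2 * pi -> derive1 f1 t = g1 t} ->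
  {ae @lebesgue_measure R, forall t, 0 < t -> t < 2 * pi -> derive1 f2 t = g2 t} ->
  measurable_fun itv02pi (fun t => cmod (derive1 f1 t) (derive1 f2 t)) ->
  measurable_fun setT (fun t => cmod (g1 t) (g2 t)) ->
  LpT p (fun t => cmod (derive1 f1 t) (derive1 f2 t)) = LpT p (fun t => cmod (g1 t) (g2 t)).
Proof.
move=> ae1 ae2 mf mg.
have mp (h : R -> R) : measurable_fun itv02pi h ->
    measurable_fun itv02pi (fun t => (`|h t| `^ p)%:E).
  move=> mh; apply/measurable_EFinP.
  by apply: (measurableT_comp (measurable_powR p)); exact: measurableT_comp.
have nz (c : R) : {ae @lebesgue_measure R, forall t, t != c}.
  exists [set c]; split => //; first exact: lebesgue_measure_set1.
  by move=> t /= /negP; rewrite negbK => /eqP.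
suff E : (\int[@lebesgue_measure R]_(t in itv02pi) (`|cmod (derive1 f1 t) (derive1 f2 t)| `^ p)%:E =
    \int[@lebesgue_measure R]_(t in itv02pi) (`|cmod (g1 t) (g2 t)| `^ p)%:E)%E.
  by rewrite /LpT E.
apply: ae_eq_integral.
- exact: measurable_itv.
- exact: mp.
- by apply: mp; exact: measurable_funTS.
have FF := ae_filter_ringOfSetsType (@lebesgue_measure R).
have H := @filterI _ _ FF _ _ (@filterI _ _ FF _ _ (nz 0) (nz (2 * pi)))
  (@filterI _ _ FF _ _ ae1 ae2).
apply: (@filterS _ _ FF _ _ _ H) => t [[t0 t2] [h1 h2]]; rewrite /itv02pi/= in_itv/= => /andP[t0' t2'].
have tp : 0 < t by rewrite lt_neqAle eq_sym t0.
have tl : t < 2 * pi by rewrite lt_neqAle t2.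
by rewrite h1// h2.
Qed.

Lemma bound_lty (R : realType) (p : R) (G : R -> R) : 1 <= p -> p < 2 ->
  (\int[@lebesgue_measure R]_(t in itv02pi) ((`|G t| `^ p)%R%:E) < +oo)%E ->
  (((Cp p + ((2 - p)^-1)%R%:E) `^ (p^-1)%R) * LpT p G < +oo)%E.
Proof.
move=> p1 p2; rewrite /LpT; set I := integral _ _ _ => Ioo.
have C0 : (0 <= Cp p)%E.
  by apply: integral_ge0 => r; rewrite /itv01/= in_itv/= => /andP[r0 _];
    rewrite lee_fin mulr_ge0 ?powR_ge0.
have Cfin : Cp p \is a fin_num by rewrite ge0_fin_numE// Cp_lty.
have I0 : (0 <= I)%E by apply: integral_ge0 => t _; rewrite lee_fin powR_ge0.
have Ifin : I \is a fin_num by rewrite ge0_fin_numE.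
have Sfin : (Cp p + ((2 - p)^-1)%:E)%E \is a fin_num by rewrite fin_numD Cfin.
have Kfin := fin_num_poweR (p^-1) Sfin.
have Lfin := fin_num_poweR (p^-1) (fin_numM (isT : ((2 * pi)^-1)%:E \is a fin_num) Ifin).
by rewrite ltey_eq (fin_numM Kfin Lfin).
Qed.

(** The clamped function agrees with f on [0, 2 pi] and is continuous, hence integrable there. *)
Lemma density_on_circle (R : realType) (f : R -> R) : abs_cont (f \o clamp (2 * pi)) ->
  exists g : R -> R, [/\ (@lebesgue_measure R).-integrable setT (EFin \o g),
    (forall t, 0 <= t -> t <= 2 * pi ->
      f t = f 0 + Rintegral (@lebesgue_measure R) `[0, t]%classic g) &
    (@lebesgue_measure R).-integrable `[0, 2 * pi]%classic (EFin \o f)].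
Proof.
have T0 : 0 <= 2 * pi :> R by rewrite ltW// two_pi_gt0.
move=> acf; have [g [ig gE]] := abs_cont_density T0 acf; exists g; split => //.
  by move=> t t0 t2; have := gE t t0 t2; rewrite /= !clamp_id.
apply: eq_integrable (integrable_cont_itv (abs_cont_continuous acf)) => // t.
by rewrite inE/= in_itv/= => /andP[t0 t2]; rewrite clamp_id.
Qed.

Theorem theorem1p2 (R : realType) (p : R) (f1 f2 : R -> R) :
  1 <= p -> p < 2 ->
  abs_continuous_on 0 (2 * pi) f1 f2 ->
  f1 0 = f1 (2 * pi) -> f2 0 = f2 (2 * pi) ->
  (* \dot F = f1' + i f2' lies in L^p(0, 2 pi) *)
  measurable_fun itv02pi (fun t => cmod (derive1 f1 t) (derive1 f2 t)) ->
  (\int[@lebesgue_measure R]_(t in itv02pi)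
     ((`|cmod (derive1 f1 t) (derive1 f2 t)| `^ p)%R%:E) < +oo)%E ->
  let u := poisson_int f1 in
  let v := poisson_int f2 in
  let K := ((Cp p + ((2 - p)^-1)%R%:E) `^ (p^-1)%R)%E in
  let nFdot := LpT p (fun t => cmod (derive1 f1 t) (derive1 f2 t)) in
  [/\ (LpD p (abs_wz u v) <= K * nFdot)%E,
      (LpD p (abs_conj_wzbar u v) <= K * nFdot)%E,
      (LpD p (abs_wz u v) < +oo)%E &
      (LpD p (abs_conj_wzbar u v) < +oo)%E].
Proof.
move=> p1 p2 ac f10 f20 mF intF u v K nFdot.
have T0 : 0 <= 2 * pi :> R by rewrite ltW// two_pi_gt0.
have [ac1 ac2] := abs_cont_clamp T0 ac.
have [g1 [ig1 g1E if1]] := density_on_circle ac1.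
have [g2 [ig2 g2E if2]] := density_on_circle ac2.
have mg1 : measurable_fun setT g1 by apply/measurable_EFinP; exact: measurable_int ig1.
have mg2 : measurable_fun setT g2 by apply/measurable_EFinP; exact: measurable_int ig2.
have mG : measurable_fun setT (fun t => cmod (g1 t) (g2 t)).
  have ms : measurable_fun setT (@Num.sqrt R).
    by apply: continuous_measurable_fun; exact: sqrt_continuous.
  by apply: (measurableT_comp ms); apply: measurable_funD; exact: measurable_funX.
(* All estimates are made with the densities, measurable on the whole line; this equality of norms
   brings the derivative back. *)
have nE : nFdot = LpT p (fun t => cmod (g1 t) (g2 t)).
  have d1 := density_derive1 ig1 g1E; have d2 := density_derive1 ig2 g2E.
  exact: (ae_derivative_modulus p d1 d2 mF mG).
have G0 (t : R) : 0 <= cmod (g1 t) (g2 t) := cmod_ge0 _ _.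
have bz : (LpD p (abs_wz u v) <= K * nFdot)%E.
  rewrite nE; apply: (LpD_bound p1 p2 mG G0) => x y xy r0.
  exact: (abs_wz_bound p1 if1 if2 ig1 ig2 g1E g2E (esym f10) (esym f20) xy r0).
have bzbar : (LpD p (abs_conj_wzbar u v) <= K * nFdot)%E.
  rewrite nE; apply: (LpD_bound p1 p2 mG G0) => x y xy r0.
  exact: (abs_conj_wzbar_bound p1 if1 if2 ig1 ig2 g1E g2E (esym f10) (esym f20) xy r0).
have finite : (K * nFdot < +oo)%E := bound_lty p1 p2 intF.
split; [exact: bz|exact: bzbar|exact: le_lt_trans bz finite|exact: le_lt_trans bzbar finite].
Qed.
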